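(* Let $r\ge0$. Each of the following adjunctions (left adjoint written on the left) is a Quillen equivalence between the indicated model categories. (a) $\mathrm{Shift}^r\dashv\mathrm{Dec}^r$, with $\mathrm{Shift}^r\colon\mathrm{ESpSe}_0\to\mathrm{ESpSe}_r$, and $\mathrm{LDec}^r\dashv\mathrm{Shift}^r$, with $\mathrm{LDec}^r\colon\mathrm{ESpSe}_r\to\mathrm{ESpSe}_0$. (b) $\mathrm{Shift}\dashv\mathrm{Dec}$, with $\mathrm{Shift}\colon\mathrm{ESpSe}_r\to\mathrm{ESpSe}_{r+1}$, and $\mathrm{LDec}\dashv\mathrm{Shift}$, with $\mathrm{LDec}\colon\mathrm{ESpSe}_{r+1}\to\mathrm{ESpSe}_r$. (c) $(\mathcal F_{\ge1}\circ\mathcal T)^r\dashv(\mathcal T^{-1}\circ\mathcal U_{\ge1})^r$ between $\mathrm{LWB}_0$ and $\mathrm{LWB}_r$, and $\mathcal F_{\ge1}\circ\mathcal T\dashv\mathcal T^{-1}\circ\mathcal U_{\ge1}$ between $\mathrm{LWB}_r$ and $\mathrm{LWB}_{r+1}$. (d) The isomorphisms of categories $\mathcal T^r$ (with inverse $\mathcal T^{-r}$) between $0$-bigraded complexes and $r$-bigraded complexes, and $\mathcal T$ (with inverse $\mathcal T^{-1}$) between $r$-bigraded complexes and $(r+1)$-bigraded complexes, with the projective model structures. (e) For $t\in\{0,r,r+1\}$: $\mathcal Q\dashv\mathcal N$ between $\mathrm{LWB}_t$ and $\mathrm{ESpSe}_t$, and $\mathcal F_{[t]}\dashv\mathcal U_{[t]}$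 between $t$-bigraded complexes (with the projective model structure) and $\mathrm{LWB}_t$.
   Context: $R$ is a commutative ring with unit. A bigraded module is a family $A=\{A^{p,n}\}_{p,n\in\mathbb Z}$ of $R$-modules. For $r\ge 0$, an $r$-bigraded complex is a bigraded module with $R$-linear maps $d_r\colon A^{p,n}\to A^{p-r,n+1-r}$, $d_r^2=0$; morphisms are bidegree-preserving maps commuting with $d_r$; $H(A)=\ker d_r/\operatorname{im} d_r$. The projective model structure on $r$-bigraded complexes has as fibrations the bidegreewise surjections and as weak equivalences the quasi-isomorphisms. Extended spectral sequence $(X,\varphi)$: a family of $r$-bigraded complexes $(X_r,d_r)$, $r\ge0$, with morphisms of bigraded modules $\varphi_{r+1}\colon X_{r+1}\to H(X_r)$ (characteristic maps). A morphism is a family of morphisms of $r$-bigraded complexes $f_r\colon X_r\to Y_r$ with $\varphi^Y_{r+1}f_{r+1}=H(f_r)\varphi^X_{r+1}$. The category is $\mathrm{ESpSe}$. Linear witness book $L$: a family of $r$-bigraded complexes $(L_r,d_r)$, $r\ge0$, with $R$-linear maps $w_{r+1}\colon L_{r+1}\to L_r$ of bidegree $(0,0)$ and $s_r\colon L_r\to L_{r+1}$ of bidegree $(1,1)$ such that $w_{r+1}s_r=0$, $s_rw_{r+1}=0$, $d_r=w_{r+1}d_{r+1}s_r$. Morphisms are families of morphisms of $r$-bigraded complexes compatible with $w$ and $s$. The category is $\mathrm{LWB}$. Model structures: $\mathrm{LWB}_r$ (on $\mathrm{LWB}$) and $\mathrm{ESpSe}_r$ (on $\mathrm{ESpSe}$)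 are the model structures in which the fibrations are the maps $f$ with $f_i$ bidegreewise surjective for $0\le i\le r$ and the weak equivalences are the maps $f$ with $f_r$ a quasi-isomorphism. Nerve $\mathcal N\colon \mathrm{ESpSe}\to\mathrm{LWB}$: $\mathcal N(X)_r^{p,n}$ is the module of pairs $(x;x')=((x_0,\dots,x_r);(x'_0,\dots,x'_r))$, $x_i\in X_i^{p,n}$, $x'_i\in X_i^{p-r,n+1-r}$, such that for $0\le i<r$: $d_ix_i=0$, $\varphi_{i+1}(x_{i+1})=[x_i]$, $d_ix'_i=0$, $\varphi_{i+1}(x'_{i+1})=[x'_i]$, and $d_rx_r=x'_r$; with $d_r(x;x')=(x';0)$, $w_r(x;x')=((x_0,\dots,x_{r-1});0)$, $s_r(x;x')=(0;(x'_0,\dots,x'_r,0))$. Its left adjoint $\mathcal Q$ is $\mathcal Q(L)_0=L_0$, $\mathcal Q(L)_r=L_r/(s_{r-1}L_{r-1}+d_rs_{r-1}L_{r-1})$ for $r>0$, with induced differentials and $\varphi_r(\overline a)=[\overline{w_r(a)}]$. $\mathcal U_{[t]}$ sends $L\in\mathrm{LWB}$ to its $t$-page $L_t$, and $\mathcal F_{[t]}$ is its left adjoint. Translation: for an $r$-bigraded complex $A$, $(\mathcal TA)^{p,n}=A^{n,2n-p}$ with the differential of $A$ is an $(r+1)$-bigraded complex. Let $\mathrm{tr}_{\ge1}\mathrm{LWB}$ be defined as $\mathrm{LWB}$ but with only pages $i\ge1$; applying $\mathcal T$ to each page gives an isomorphism $\mathcal T\colon\mathrm{LWB}\to\mathrm{tr}_{\ge1}\mathrm{LWB}$.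 $\mathcal U_{\ge1}\colon\mathrm{LWB}\to\mathrm{tr}_{\ge1}\mathrm{LWB}$ forgets the $0$-page; its left adjoint $\mathcal F_{\ge1}$ has $\mathcal F_{\ge1}(L)_0=L_1$ with $d_0=0$, $w_1=1$, $s_0=0$, and coincides with $L$ on pages $i\ge1$. $\mathrm{Shift}\colon\mathrm{ESpSe}\to\mathrm{ESpSe}$ is (up to natural isomorphism) given by $\mathrm{Shift}(X)_0=\mathcal T(X_0)$ with zero differential, $\mathrm{Shift}(X)_i=\mathcal T(X_{i-1})$ for $i\ge1$, with characteristic maps $\varphi_1=\mathrm{id}$, $\varphi_i=\mathcal T(\varphi^X_{i-1})$ for $i\ge2$. $\mathrm{LDec}$ and $\mathrm{Dec}$ denote respectively its left and right adjoint (both exist, and are therefore determined up to natural isomorphism). $\mathrm{Dec}$ is given by $\mathrm{Dec}(X)_0=\mathcal T^{-1}(\mathcal N(X)_1)$, $\mathrm{Dec}(X)_i=\mathcal T^{-1}(X_{i+1})$ for $i\ge1$, with $\varphi_1=\mathcal T^{-1}(H(\rho_1)^{-1}\varphi^X_2)$, where $\rho_1\colon\mathcal N(X)_1\to X_1$, $(x;x')\mapsto x_1$, is a quasi-isomorphism, and $\varphi_i=\mathcal T^{-1}(\varphi^X_{i+1})$ for $i\ge2$. $F^r$ denotes the $r$-fold composite of a functor $F$. *)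

(* Defs.v *)
From HB Require Import structures.
From mathcomp Require Import all_boot all_order all_algebra.
From mathcomp Require Import boolp zify.

Set Implicit Arguments.
Unset Strict Implicit.
Unset Printing Implicit Defensive.

Import GRing.Theory.
Local Open Scope ring_scope.

Record category := Category {
  ob :> Type;
  hom : ob -> ob -> Type;
  idm : forall x, hom x x;
  compm : forall x y z, hom y z -> hom x y -> hom x z;
  comp1m : forall x y (f : hom x y), compm (idm y) f = f;
  compm1 : forall x y (f : hom x y), compm f (idm x) = f;
  compmA : forall x y z t (h : hom z t) (g : hom y z) (f : hom x y),
    compm h (compm g f) = compm (compm h g) f
}.
Arguments hom {c} x y.
Arguments idm {c} x.
Arguments compm {c x y z} g f.

Record functor (C D : category) := Functor {
  fob :> C -> D;
  fmap : forall x y, hom x y -> hom (fob x) (fob y);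
  fmap1 : forall x, fmap (idm x) = idm (fob x);
  fmapM : forall x y z (g : hom y z) (f : hom x y),
    fmap (compm g f) = compm (fmap g) (fmap f)
}.
Arguments fmap {C D} F {x y} f : rename.

Definition idF (C : category) : functor C C :=
  @Functor C C (fun x => x) (fun x y f => f) (fun x => erefl) (fun x y z g f => erefl).

Program Definition compF (C D E : category) (G : functor D E) (F : functor C D) :
    functor C E :=
  @Functor C E (fun x => G (F x)) (fun x y f => fmap G (fmap F f)) _ _.
Next Obligation. by rewrite !fmap1. Qed.
Next Obligation. by rewrite !fmapM. Qed.

Fixpoint iterF (C : category) (F : functor C C) (n : nat) : functor C C :=
  if n is m.+1 then compF F (iterF F m) else idF C.

Record adjunction (C D : category) (F : functor C D) (G : functor D C) := Adjunction {
  adj : forall x y, hom (F x) y -> hom x (G y);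
  adj_bij : forall x y, bijective (@adj x y);
  adj_natl : forall x x' y (f : hom x' x) (g : hom (F x) y),
    adj (compm g (fmap F f)) = compm (adj g) f;
  adj_natr : forall x y y' (h : hom y y') (g : hom (F x) y),
    adj (compm h g) = compm (fmap G h) (adj g)
}.

Definition morphism_class (C : category) := forall x y : C, hom x y -> Prop.

Definition lifts (C : category) (a b x y : C) (i : hom a b) (p : hom x y) :=
  forall (u : hom a x) (v : hom b y), compm p u = compm v i ->
  exists h : hom b x, compm h i = u /\ compm p h = v.

Definition retract_of (C : category) (x y x' y' : C) (f : hom x y) (g : hom x' y') :=
  exists (ix : hom x x') (rx : hom x' x) (iy : hom y y') (ry : hom y' y),
    [/\ compm rx ix = idm x, compm ry iy = idm y,
        compm g ix = compm iy f & compm f rx = compm ry g].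

Definition retract_closed (C : category) (K : morphism_class C) :=
  forall (x y x' y' : C) (f : hom x y) (g : hom x' y'),
    retract_of f g -> K x' y' g -> K x y f.

(* A model structure on C in the sense of Hovey, with non-functorial
   factorizations; limits and colimits in C are not part of the structure. *)
Record model_structure (C : category) := ModelStructure {
  weq : morphism_class C;
  fib : morphism_class C;
  cof : morphism_class C;
  weq_comp : forall x y z (g : hom y z) (f : hom x y),
    weq f -> weq g -> weq (compm g f);
  weq_cancell : forall x y z (g : hom y z) (f : hom x y),
    weq g -> weq (compm g f) -> weq f;
  weq_cancelr : forall x y z (g : hom y z) (f : hom x y),
    weq f -> weq (compm g f) -> weq g;
  weq_retract : retract_closed weq;
  fib_retract : retract_closed fib;
  cof_retract : retract_closed cof;
  cof_lift : forall a b x y (i : hom a b) (p : hom x y),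
    cof i -> fib p -> weq p -> lifts i p;
  tcof_lift : forall a b x y (i : hom a b) (p : hom x y),
    cof i -> weq i -> fib p -> lifts i p;
  factor_cof_tfib : forall x y (f : hom x y),
    exists z (i : hom x z) (p : hom z y),
      [/\ f = compm p i, cof i, fib p & weq p];
  factor_tcof_fib : forall x y (f : hom x y),
    exists z (i : hom x z) (p : hom z y),
      [/\ f = compm p i, cof i, weq i & fib p]
}.
Arguments weq {C} m {x y} f.
Arguments fib {C} m {x y} f.
Arguments cof {C} m {x y} f.

(* The model structure, unique if it exists, with prescribed fibrations and
   weak equivalences. *)
Definition has_fib_weq (C : category) (M : model_structure C)
    (fibP weqP : morphism_class C) :=
  forall x y (f : hom x y), (fib M f <-> fibP x y f) /\ (weq M f <-> weqP x y f).

Definition initial (C : category) (x : C) :=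
  forall y, exists f : hom x y, forall g : hom x y, g = f.

Definition terminal (C : category) (x : C) :=
  forall y, exists f : hom y x, forall g : hom y x, g = f.

Definition cofibrant (C : category) (M : model_structure C) (x : C) :=
  exists2 i : C, initial i & exists f : hom i x, cof M f.

Definition fibrant (C : category) (M : model_structure C) (x : C) :=
  exists2 t : C, terminal t & exists f : hom x t, fib M f.

Section Quillen.
Variables (C D : category) (M : model_structure C) (N : model_structure D).
Variables (F : functor C D) (G : functor D C).

Definition left_quillen :=
  (forall x y (f : hom x y), cof M f -> cof N (fmap F f)) /\
  (forall x y (f : hom x y), cof M f -> weq M f ->
     cof N (fmap F f) /\ weq N (fmap F f)).

Definition quillen_equivalence_adj (a : adjunction F G) :=
  left_quillen /\
  forall x y (f : hom (F x) y), cofibrant M x -> fibrant N y ->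
    (weq N f <-> weq M (adj a f)).

(* F is left adjoint to G, and every adjunction between them (any two differ
   by an automorphism of F) is a Quillen equivalence. *)
Definition quillen_equivalence :=
  inhabited (adjunction F G) /\
  forall a : adjunction F G, quillen_equivalence_adj a.

End Quillen.

Section Modules.
Variable R : comPzRingType.

Definition mklin (U V : lmodType R) (f : U -> V) (hf : linear f) : {linear U -> V} :=
  HB.pack f (GRing.isLinear.Build R U V _ f hf).

Lemma linear_ext (U V : lmodType R) (f g : {linear U -> V}) : f =1 g -> f = g.
Proof.
move=> /funext; case: f => f cf; case: g => g cg /= e.
subst g; congr (GRing.Linear.Pack _).
case: cf => [[a1] [a2]]; case: cg => [[b1] [b2]].
by rewrite (Prop_irrelevance a1 b1) (Prop_irrelevance a2 b2).
Qed.

Definition linid (U : lmodType R) : {linear U -> U} :=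
  @mklin U U (fun x => x) (fun a u v => erefl).

Definition lincomp (U V W : lmodType R) (g : {linear V -> W}) (f : {linear U -> V}) :
    {linear U -> W} :=
  mklin (fun a u v => etrans (congr1 g (linearP f a u v)) (linearP g a (f u) (f v))).

Lemma lin0_subproof (U V : lmodType R) : linear (fun _ : U => 0 : V).
Proof. by move=> a u v; rewrite scaler0 addr0. Qed.
Definition lin0 (U V : lmodType R) : {linear U -> V} := mklin (@lin0_subproof U V).

Record submodule (V : lmodType R) := Submodule {
  submod_pred :> V -> Prop;
  submod0 : submod_pred 0;
  submodZD : forall a u v, submod_pred u -> submod_pred v -> submod_pred (a *: u + v)
}.

Section SubQuot.
Variables (V : lmodType R) (S : submodule V).

Definition submod_mem : V -> bool := fun x => `[< S x >].

Lemma submod_mem_closed : submod_closed submod_mem.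
Proof.
split; first by apply/asboolP; exact: submod0.
by move=> a u v /asboolP hu /asboolP hv; apply/asboolP; exact: submodZD.
Qed.

HB.instance Definition _ :=
  GRing.isSubmodClosed.Build R V submod_mem submod_mem_closed.

Definition subm : Type := {x : V | submod_mem x}.
HB.instance Definition _ := SubChoice.on subm.
HB.instance Definition _ := [SubChoice_isSubLmodule of subm by <:].

Lemma subm_inP (x : V) : S x -> submod_mem x.
Proof. by move=> h; apply/asboolP. Qed.

Definition msub (x : V) (hx : S x) : subm := exist _ x (subm_inP hx).
Definition mval : {linear subm -> V} := mklin (fun a (u v : subm) => erefl (a *: \val u + \val v)).

Lemma msubP (x : subm) : S (mval x).
Proof. exact: (asboolW (valP x)). Qed.

Lemma mval_inj : injective mval.
Proof. exact: val_inj. Qed.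

Definition submod_zmod : zmodClosed V := GRing.ZmodClosed.clone V submod_mem _.

Definition quotm : Type := @Quotient.quot V submod_zmod.
HB.instance Definition _ := GRing.Zmodule.on quotm.

Definition qpi_fun (x : V) : quotm := (\pi_(@Quotient.quot V submod_zmod) x)%qT.

Lemma qpi_eq (x y : V) : (qpi_fun x = qpi_fun y) <-> S (x - y).
Proof.
have E : submod_mem (x - y) = (qpi_fun x == qpi_fun y).
  exact: (Quotient.idealrBE submod_zmod x y).
split=> [/eqP|/subm_inP]; first by rewrite -E => /asboolP.
by rewrite E => /eqP.
Qed.

Definition qrepr (q : quotm) : V := repr (q : @Quotient.quot V submod_zmod).
Lemma qreprK q : qpi_fun (qrepr q) = q.
Proof. exact: reprK. Qed.

Definition qscale (a : R) (q : quotm) : quotm := qpi_fun (a *: qrepr q).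

Lemma qpiD (x y : V) : qpi_fun (x + y) = qpi_fun x + qpi_fun y.
Proof. by rewrite /qpi_fun !piE. Qed.

Lemma submodZ a x : S x -> S (a *: x).
Proof. by move=> h; rewrite -[_ *: _]addr0; apply: submodZD => //; exact: submod0. Qed.

Lemma qpiZ a (x : V) : qpi_fun (a *: x) = qscale a (qpi_fun x).
Proof.
apply/qpi_eq; rewrite -scalerBr; apply: submodZ; apply/qpi_eq.
by rewrite qreprK.
Qed.

Lemma qscaleA a b q : qscale a (qscale b q) = qscale (a * b) q.
Proof. by rewrite -(qreprK q) -!qpiZ scalerA. Qed.
Lemma qscale1 : left_id 1 qscale.
Proof. by move=> q; rewrite -(qreprK q) -!qpiZ scale1r. Qed.
Lemma qscaleDr : right_distributive qscale +%R.
Proof.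
by move=> a q q'; rewrite -(qreprK q) -(qreprK q') -!(qpiZ, qpiD) scalerDr.
Qed.
Lemma qscaleDl q : {morph qscale^~ q : a b / a + b}.
Proof. by move=> a b; rewrite -(qreprK q) -!(qpiZ, qpiD) scalerDl. Qed.

HB.instance Definition _ :=
  GRing.Zmodule_isLmodule.Build R quotm qscaleA qscale1 qscaleDr qscaleDl.

Lemma qpi_linear : linear qpi_fun.
Proof. by move=> a u v; rewrite qpiD qpiZ. Qed.
Definition qpi : {linear V -> quotm} := mklin qpi_linear.

Lemma qpi_eq0 x : qpi x = 0 <-> S x.
Proof. by rewrite -(linear0 qpi) -[X in _ <-> S X]subr0; exact: qpi_eq. Qed.

Lemma qpi_surj (q : quotm) : exists x, qpi x = q.
Proof. by exists (qrepr q); exact: qreprK. Qed.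

Section Lift.
Variables (W : lmodType R) (f : {linear V -> W}) (hf : forall x, S x -> f x = 0).

Lemma qlift_subproof x : f (qrepr (qpi x)) = f x.
Proof.
apply/eqP; rewrite -subr_eq0 -linearB; apply/eqP/hf/qpi_eq0.
by rewrite linearB; apply/eqP; rewrite subr_eq0; apply/eqP; exact: qreprK.
Qed.

Lemma qlift_linear : linear (fun q => f (qrepr q)).
Proof.
move=> a q q'; have [x <-] := qpi_surj q; have [y <-] := qpi_surj q'.
by rewrite -linearP !qlift_subproof linearP.
Qed.
Definition qlift : {linear quotm -> W} := mklin qlift_linear.

Lemma qliftE x : qlift (qpi x) = f x.
Proof. exact: qlift_subproof. Qed.
End Lift.

End SubQuot.

Section SubLift.
Variables (U V : lmodType R) (S : submodule V) (f : {linear U -> V}).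
Hypothesis hf : forall x, S (f x).
Lemma sublift_linear : linear (fun x => msub (hf x)).
Proof. by move=> a u v; apply: mval_inj; rewrite [RHS]linearP; exact: linearP. Qed.
Definition sublift : {linear U -> subm S} := mklin sublift_linear.
End SubLift.

Section Inverse.
Variables (U V : lmodType R) (f : {linear U -> V}) (hf : bijective f).
Lemma lininv_subproof y : exists x, f x = y.
Proof. by case: hf => g _ gK; exists (g y). Qed.
Definition lininv_fun y := sval (cid (lininv_subproof y)).
Lemma lininv_funK y : f (lininv_fun y) = y.
Proof. by rewrite /lininv_fun; case: cid. Qed.
Lemma lininv_linear : linear lininv_fun.
Proof. by move=> a u v; apply: (bij_inj hf); rewrite linearP !lininv_funK. Qed.
Definition lininv : {linear V -> U} := mklin lininv_linear.
Lemma lininvK y : f (lininv y) = y. Proof. exact: lininv_funK. Qed.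
Lemma lininvKV x : lininv (f x) = x.
Proof. by apply: (bij_inj hf); rewrite lininvK. Qed.
End Inverse.

Section Product.
Variables (I : Type) (V : I -> lmodType R).
Definition dprod : Type := forall i, V i.
HB.instance Definition _ := gen_eqMixin dprod.
HB.instance Definition _ := gen_choiceMixin dprod.

Let dext (x y : dprod) : (forall i, x i = y i) -> x = y.
Proof. exact: functional_extensionality_dep. Qed.
Let dadd (x y : dprod) : dprod := fun i => x i + y i.
Let dopp (x : dprod) : dprod := fun i => - x i.
Let dzero : dprod := fun i => 0.
Let dscale (a : R) (x : dprod) : dprod := fun i => a *: x i.
Lemma daddA : associative dadd.
Proof. by move=> x y z; apply: dext => i; exact: addrA. Qed.
Lemma daddC : commutative dadd.
Proof. by move=> x y; apply: dext => i; exact: addrC. Qed.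
Lemma dadd0 : left_id dzero dadd.
Proof. by move=> x; apply: dext => i; exact: add0r. Qed.
Lemma daddN : left_inverse dzero dopp dadd.
Proof. by move=> x; apply: dext => i; exact: addNr. Qed.
HB.instance Definition _ := GRing.isZmodule.Build dprod daddA daddC dadd0 daddN.
Lemma dscaleA a b x : dscale a (dscale b x) = dscale (a * b) x.
Proof. by apply: dext => i; exact: scalerA. Qed.
Lemma dscale1 : left_id 1 dscale.
Proof. by move=> x; apply: dext => i; exact: scale1r. Qed.
Lemma dscaleDr : right_distributive dscale +%R.
Proof. by move=> a x y; apply: dext => i; exact: scalerDr. Qed.
Lemma dscaleDl x : {morph dscale^~ x : a b / a + b}.
Proof. by move=> a b; apply: dext => i; exact: scalerDl. Qed.
HB.instance Definition _ :=
  GRing.Zmodule_isLmodule.Build R dprod dscaleA dscale1 dscaleDr dscaleDl.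

Lemma dprod_ext (x y : dprod) : (forall i, x i = y i) -> x = y.
Proof. exact: dext. Qed.
Lemma dprodP a (x y : dprod) i : (a *: x + y) i = a *: x i + y i.
Proof. by []. Qed.
End Product.

End Modules.
Arguments mval {R V S}.
Arguments qpi {R V} S.

Section Complexes.
Variable R : comPzRingType.
Implicit Types p n : int.

Definition bimod := int -> int -> lmodType R.

Definition gcast (A : bimod) p n p' n' (ep : p = p') (en : n = n') :
    {linear A p n -> A p' n'} :=
  match ep, en with erefl, erefl => linid (A p n) end.

Lemma gcast_id (A : bimod) p n (ep : p = p) (en : n = n) x : gcast A ep en x = x.
Proof. by rewrite (Prop_irrelevance ep erefl) (Prop_irrelevance en erefl). Qed.

Lemma gcast_comp (A : bimod) p n p1 n1 p2 n2 (ep : p = p1) (en : n = n1)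
  (ep' : p1 = p2) (en' : n1 = n2) (ep2 : p = p2) (en2 : n = n2) x :
  gcast A ep' en' (gcast A ep en x) = gcast A ep2 en2 x.
Proof. by subst; rewrite !gcast_id. Qed.

Section Fixed_r.
Variable r : nat.

(* The target bidegree of the differential is a free pair (p', n') together
   with proofs that it is (p - r, n + 1 - r), which spares transports along
   equations between bidegrees. *)
Record bcomplex := BComplex {
  bmod :> int -> int -> lmodType R;
  bdiff : forall p n p' n' : int, p' = p - r%:Z -> n' = n + 1 - r%:Z ->
    {linear bmod p n -> bmod p' n'};
  bdiffK : forall p n p1 n1 p2 n2 (ep1 : p1 = p - r%:Z) (en1 : n1 = n + 1 - r%:Z)
    (ep2 : p2 = p1 - r%:Z) (en2 : n2 = n1 + 1 - r%:Z) x,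
    bdiff ep2 en2 (bdiff ep1 en1 x) = 0
}.
Arguments bdiff _ {p n p' n'} ep en : rename.

Record bhom (A B : bcomplex) := BHom {
  bfun :> forall p n, {linear A p n -> B p n};
  bfun_d : forall p n p' n' (ep : p' = p - r%:Z) (en : n' = n + 1 - r%:Z) x,
    bfun p' n' (bdiff A ep en x) = bdiff B ep en (bfun p n x)
}.

Lemma bhom_ext A B (f g : bhom A B) : (forall p n x, f p n x = g p n x) -> f = g.
Proof.
case: f g => f hf [g hg] /= e.
have E : f = g.
  apply: functional_extensionality_dep => p.
  apply: functional_extensionality_dep => n.
  by apply: linear_ext => x; exact: e.
by subst g; rewrite (Prop_irrelevance hf hg).
Qed.

Definition bid (A : bcomplex) : bhom A A :=
  @BHom A A (fun p n => linid (A p n)) (fun p n p' n' ep en x => erefl).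

Program Definition bcomp A B C (g : bhom B C) (f : bhom A B) : bhom A C :=
  @BHom A C (fun p n => lincomp (g p n) (f p n)) _.
Next Obligation. by rewrite !bfun_d. Qed.

Program Definition bC : category := @Category bcomplex bhom bid bcomp _ _ _.
Next Obligation. by apply: bhom_ext. Qed.
Next Obligation. by apply: bhom_ext. Qed.
Next Obligation. by apply: bhom_ext. Qed.

Section Homology.
Variables (A : bcomplex) (p n : int).

Definition is_cycle (x : A p n) := bdiff A erefl erefl x = 0.

Definition is_bnd (x : A p n) :=
  exists p0 n0 (ep : p = p0 - r%:Z) (en : n = n0 + 1 - r%:Z) (y : A p0 n0),
    bdiff A ep en y = x.

Lemma cycleP (x : A p n) p' n' (ep : p' = p - r%:Z) (en : n' = n + 1 - r%:Z) :
  is_cycle x <-> bdiff A ep en x = 0.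
Proof. by subst. Qed.

Lemma bnd_cycle x : is_bnd x -> is_cycle x.
Proof. by move=> [p0 [n0 [ep [en [y <-]]]]]; exact: bdiffK. Qed.

Program Definition cycles : submodule (A p n) := @Submodule R (A p n) is_cycle _ _.
Next Obligation. exact: linear0. Qed.
Next Obligation. by rewrite /is_cycle linearP H H0 scaler0 addr0. Qed.

Definition cyc : lmodType R := subm cycles.

Lemma bnd0 : is_bnd 0.
Proof.
have ep : p = (p + r%:Z) - r%:Z by lia.
have en : n = (n + r%:Z - 1) + 1 - r%:Z by lia.
by exists (p + r%:Z), (n + r%:Z - 1), ep, en, 0; rewrite linear0.
Qed.

Lemma bndZD a x y : is_bnd x -> is_bnd y -> is_bnd (a *: x + y).
Proof.
move=> [p0 [n0 [ep [en [u <-]]]]] [p1 [n1 [ep' [en' [v <-]]]]].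
have e1 : p1 = p0 by lia.
have e2 : n1 = n0 by lia.
subst p1 n1; exists p0, n0, ep, en, (a *: u + v).
by rewrite linearP (Prop_irrelevance ep ep') (Prop_irrelevance en en').
Qed.

Program Definition bnds : submodule cyc :=
  @Submodule R cyc (fun z => is_bnd (mval z)) _ _.
Next Obligation. exact: bnd0. Qed.
Next Obligation. exact: bndZD. Qed.

Definition homology : lmodType R := quotm bnds.

Definition hcl : {linear cyc -> homology} := qpi bnds.

(* h = [a], including that a is a cycle *)
Definition represents (h : homology) (a : A p n) :=
  exists2 z : cyc, mval z = a & hcl z = h.

Lemma hcl_surj h : exists z, hcl z = h.
Proof. exact: qpi_surj. Qed.

Lemma represents_ex h : exists a, represents h a.
Proof. by have [z <-] := hcl_surj h; exists (mval z); exists z. Qed.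

Lemma represents_cycle h a : represents h a -> is_cycle a.
Proof. by move=> [z <- _]; exact: (@msubP _ _ cycles z). Qed.

Lemma representsZD c h h' a a' :
  represents h a -> represents h' a' -> represents (c *: h + h') (c *: a + a').
Proof. by move=> [z <- <-] [z' <- <-]; exists (c *: z + z'); rewrite linearP. Qed.

Lemma represents0 a : represents 0 a <-> is_bnd a.
Proof.
split=> [[z <-] /qpi_eq0 //|h].
exists (msub (S := cycles) (bnd_cycle h)) => //.
exact/qpi_eq0.
Qed.

Lemma represents_uniq h h' a : represents h a -> represents h' a -> h = h'.
Proof. by move=> [z <- <-] [z' /mval_inj -> <-]. Qed.

End Homology.

End Fixed_r.
Arguments hcl {r A p n}.
Arguments bdiff {r} _ {p n p' n'} ep en : rename.

(* The map in homology induced by a linear map A^{p,n} -> B^{p',n'} preserving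
   cycles and boundaries. *)
Section InducedMap.
Variables (r r' : nat) (A : bcomplex r) (B : bcomplex r') (p n p' n' : int).
Variable f : {linear A p n -> B p' n'}.
Hypothesis fc : forall x, is_cycle x -> is_cycle (f x).
Hypothesis fb : forall x, is_bnd x -> is_bnd (f x).

Let fcyc : {linear cyc A p n -> cyc B p' n'} :=
  sublift (S := cycles B p' n') (f := lincomp f (mval (S := cycles A p n)))
    (fun z => fc (msubP z)).

Lemma Hind_subproof z : bnds A p n z -> lincomp hcl fcyc z = 0.
Proof. by move=> h; apply/qpi_eq0; exact: fb. Qed.

Definition Hind : {linear homology A p n -> homology B p' n'} := qlift Hind_subproof.

Lemma Hind_represents h a : represents h a -> represents (Hind h) (f a).
Proof. by move=> [z <- <-]; exists (fcyc z); rewrite // /Hind qliftE. Qed.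
End InducedMap.

Section Functoriality.
Variables (r : nat) (A B : bcomplex r) (f : bhom A B).
Lemma bhom_cycle p n (x : A p n) : is_cycle x -> is_cycle (f p n x).
Proof. by rewrite /is_cycle -bfun_d => ->; exact: linear0. Qed.
Lemma bhom_bnd p n (x : A p n) : is_bnd x -> is_bnd (f p n x).
Proof.
by move=> [p0 [n0 [ep [en [y <-]]]]]; exists p0, n0, ep, en, (f p0 n0 y); rewrite bfun_d.
Qed.

Definition Hmap p n : {linear homology A p n -> homology B p n} :=
  Hind (@bhom_cycle p n) (@bhom_bnd p n).

Lemma Hmap_represents p n (h : homology A p n) a :
  represents h a -> represents (Hmap p n h) (f p n a).
Proof. exact: Hind_represents. Qed.

Definition quasi_iso := forall p n, bijective (Hmap p n).
Definition surjective := forall p n (y : B p n), exists x : A p n, f p n x = y.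
End Functoriality.

Definition fib_bC r : morphism_class (bC r) := fun A B f => surjective f.
Definition weq_bC r : morphism_class (bC r) := fun A B f => quasi_iso f.

Section Translation.
Variable r : nat.

Section Tcx.
Variable A : bcomplex r.
Let Tp (p n p' n' : int) : p' = p - r.+1%:Z -> n' = n + 1 - r.+1%:Z -> n' = n - r%:Z.
Proof. lia. Qed.
Let Tn (p n p' n' : int) : p' = p - r.+1%:Z -> n' = n + 1 - r.+1%:Z ->
  2 * n' - p' = (2 * n - p) + 1 - r%:Z.
Proof. lia. Qed.
Program Definition Tcx : bcomplex r.+1 :=
  @BComplex r.+1 (fun p n => A n (2 * n - p))
    (fun p n p' n' ep en => bdiff A (Tp ep en) (Tn ep en)) _.
Next Obligation. by rewrite bdiffK. Qed.

Lemma Tcx_cycle (p n : int) (x : A n (2 * n - p)) : is_cycle x -> is_cycle (A := Tcx) (x : Tcx p n).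
Proof. by move=> h; exact: (cycleP x _ _).1 h. Qed.

Lemma Tcx_bnd (p n : int) (x : A n (2 * n - p)) : is_bnd x -> is_bnd (A := Tcx) (x : Tcx p n).
Proof.
move=> [p0 [n0 [ep [en [y <-]]]]].
have [p1 e] : exists p1, n0 = 2 * p0 - p1 by exists (2 * p0 - n0); lia.
subst n0.
have ep1 : p = p1 - r.+1%:Z by lia.
have en1 : n = p0 + 1 - r.+1%:Z by lia.
exists p1, p0, ep1, en1, y.
by rewrite /= (Prop_irrelevance (Tp ep1 en1) ep) (Prop_irrelevance (Tn ep1 en1) en).
Qed.

(* The identification H(A)^{n,2n-p} = H(TA)^{p,n}, [x] |-> [x]. *)
Definition HT (p n : int) : {linear homology A n (2 * n - p) -> homology Tcx p n} :=
  Hind (f := linid (A n (2 * n - p)) : {linear A n (2 * n - p) -> Tcx p n})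
    (@Tcx_cycle p n) (@Tcx_bnd p n).
End Tcx.

Section Tcx_hom.
Variables (A B : bcomplex r) (f : bhom A B).
Program Definition Tcx_hom : bhom (Tcx A) (Tcx B) :=
  @BHom r.+1 (Tcx A) (Tcx B) (fun p n => f n (2 * n - p)) _.
Next Obligation. by rewrite bfun_d. Qed.
End Tcx_hom.

Program Definition T : functor (bC r) (bC r.+1) :=
  @Functor (bC r) (bC r.+1) Tcx Tcx_hom _ _.
Next Obligation. by apply: bhom_ext. Qed.
Next Obligation. by apply: bhom_ext. Qed.

(* The inverse of (TA)^{p,n} = A^{n,2n-p} is (T^-1 B)^{p,n} = B^{2p-n,p}. *)
Section Tinvcx.
Variable B : bcomplex r.+1.
Let Tip (p n p' n' : int) : p' = p - r%:Z -> n' = n + 1 - r%:Z ->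
  2 * p' - n' = 2 * p - n - r.+1%:Z.
Proof. lia. Qed.
Let Tin (p n p' n' : int) : p' = p - r%:Z -> n' = n + 1 - r%:Z -> p' = p + 1 - r.+1%:Z.
Proof. lia. Qed.
Program Definition Tinvcx : bcomplex r :=
  @BComplex r (fun p n => B (2 * p - n) p)
    (fun p n p' n' ep en => bdiff B (Tip ep en) (Tin ep en)) _.
Next Obligation. by rewrite bdiffK. Qed.

Lemma Tinvcx_cycle (p n : int) (x : B (2 * p - n) p) :
  is_cycle x -> is_cycle (A := Tinvcx) (x : Tinvcx p n).
Proof. by move=> h; exact: (cycleP x _ _).1 h. Qed.

Lemma Tinvcx_bnd (p n : int) (x : B (2 * p - n) p) :
  is_bnd x -> is_bnd (A := Tinvcx) (x : Tinvcx p n).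
Proof.
move=> [p0 [n0 [ep [en [y <-]]]]].
have [n1 e] : exists n1, p0 = 2 * n0 - n1 by exists (2 * n0 - p0); lia.
subst p0.
have ep1 : p = n0 - r%:Z by lia.
have en1 : n = n1 + 1 - r%:Z by lia.
exists n0, n1, ep1, en1, y.
by rewrite /= (Prop_irrelevance (Tip ep1 en1) ep) (Prop_irrelevance (Tin ep1 en1) en).
Qed.

Definition HTinv (p n : int) : {linear homology B (2 * p - n) p -> homology Tinvcx p n} :=
  Hind (f := linid (B (2 * p - n) p) : {linear B (2 * p - n) p -> Tinvcx p n})
    (@Tinvcx_cycle p n) (@Tinvcx_bnd p n).
End Tinvcx.

Section Tinvcx_hom.
Variables (A B : bcomplex r.+1) (f : bhom A B).
Program Definition Tinvcx_hom : bhom (Tinvcx A) (Tinvcx B) :=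
  @BHom r (Tinvcx A) (Tinvcx B) (fun p n => f (2 * p - n) p) _.
Next Obligation. by rewrite bfun_d. Qed.
End Tinvcx_hom.

Program Definition Tinv : functor (bC r.+1) (bC r) :=
  @Functor (bC r.+1) (bC r) Tinvcx Tinvcx_hom _ _.
Next Obligation. by apply: bhom_ext. Qed.
Next Obligation. by apply: bhom_ext. Qed.

End Translation.

(* T^r *)
Fixpoint Titer r : functor (bC 0) (bC r) :=
  if r is k.+1 then compF (T k) (Titer k) else idF (bC 0).

(* T^-r *)
Fixpoint Tinviter r : functor (bC r) (bC 0) :=
  if r is k.+1 then compF (Tinviter k) (Tinv k) else idF (bC 0).

Local Obligation Tactic := intros.

Lemma Hmap_id r (A : bcomplex r) p n h : Hmap (bid A) p n h = h.
Proof.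
have [a ha] := represents_ex h.
exact: represents_uniq (Hmap_represents (bid A) ha) ha.
Qed.

Lemma Hmap_comp r (A B C : bcomplex r) (g : bhom B C) (f : bhom A B) p n h :
  Hmap (bcomp g f) p n h = Hmap g p n (Hmap f p n h).
Proof.
have [a ha] := represents_ex h.
apply: represents_uniq (Hmap_represents (bcomp g f) ha) _.
exact: Hmap_represents (Hmap_represents f ha).
Qed.

Record ess := Ess {
  epage :> forall i, bcomplex i;
  ephi : forall i (p n : int), {linear epage i.+1 p n -> homology (epage i) p n}
}.
Arguments ephi _ {i p n} : rename.

Record esshom (X Y : ess) := EssHom {
  efun :> forall i, bhom (X i) (Y i);
  efun_phi : forall i p n (x : X i.+1 p n),
    ephi Y (efun i.+1 p n x) = Hmap (efun i) p n (ephi X x)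
}.

Lemma esshom_ext X Y (f g : esshom X Y) :
  (forall i p n x, f i p n x = g i p n x) -> f = g.
Proof.
case: f g => f hf [g hg] /= e.
have E : f = g.
  by apply: functional_extensionality_dep => i; apply: bhom_ext; exact: e.
by subst g; rewrite (Prop_irrelevance hf hg).
Qed.

Program Definition essid (X : ess) : esshom X X :=
  @EssHom X X (fun i => bid (X i)) _.
Next Obligation. exact: esym (Hmap_id _). Qed.

Program Definition esscomp X Y Z (g : esshom Y Z) (f : esshom X Y) : esshom X Z :=
  @EssHom X Z (fun i => bcomp (g i) (f i)) _.
Next Obligation. by rewrite Hmap_comp -!efun_phi. Qed.

Program Definition ESpSe : category := @Category ess esshom essid esscomp _ _ _.
Next Obligation. by apply: esshom_ext. Qed.
Next Obligation. by apply: esshom_ext. Qed.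
Next Obligation. by apply: esshom_ext. Qed.

Definition fib_ESpSe r : morphism_class ESpSe :=
  fun X Y f => forall i, (i <= r)%N -> surjective (f i).
Definition weq_ESpSe r : morphism_class ESpSe := fun X Y f => quasi_iso (f r).

(* Linear witness books with pages i >= k, the page i being stored at index
   i - k: LWB is the case k = 0 and tr_{>=1} LWB the case k = 1. *)

Section LWB.
Variable k : nat.

Record lwb := Lwb {
  lpage :> forall i, bcomplex (k + i)%N;
  lw : forall i (p n : int), {linear lpage i.+1 p n -> lpage i p n};
  ls : forall i (p n p' n' : int), p' = p + 1 -> n' = n + 1 ->
    {linear lpage i p n -> lpage i.+1 p' n'};
  lws : forall i (p n p' n' : int) (ep : p' = p + 1) (en : n' = n + 1) x,
    lw i p' n' (ls i ep en x) = 0;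
  lsw : forall i (p n p' n' : int) (ep : p' = p + 1) (en : n' = n + 1) x,
    ls i ep en (lw i p n x) = 0;
  ldE : forall i (p n p1 n1 p2 n2 : int) (ep : p1 = p + 1) (en : n1 = n + 1)
    (ep' : p2 = p1 - (k + i.+1)%N%:Z) (en' : n2 = n1 + 1 - (k + i.+1)%N%:Z)
    (ep'' : p2 = p - (k + i)%N%:Z) (en'' : n2 = n + 1 - (k + i)%N%:Z)
    (x : lpage i p n),
    bdiff (lpage i) ep'' en'' x =
      lw i p2 n2 (bdiff (lpage i.+1) ep' en' (ls i ep en x))
}.
Arguments lw _ {i p n} : rename.
Arguments ls _ {i p n p' n'} ep en : rename.

Record lwbhom (L M : lwb) := LwbHom {
  lfun :> forall i, bhom (L i) (M i);
  lfun_w : forall i p n (x : L i.+1 p n), lfun i p n (lw L x) = lw M (lfun i.+1 p n x);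
  lfun_s : forall i p n p' n' (ep : p' = p + 1) (en : n' = n + 1) (x : L i p n),
    lfun i.+1 p' n' (ls L ep en x) = ls M ep en (lfun i p n x)
}.

Lemma lwbhom_ext L M (f g : lwbhom L M) :
  (forall i p n x, f i p n x = g i p n x) -> f = g.
Proof.
case: f g => f hf hf' [g hg hg'] /= e.
have E : f = g.
  by apply: functional_extensionality_dep => i; apply: bhom_ext; exact: e.
by subst g; rewrite (Prop_irrelevance hf hg) (Prop_irrelevance hf' hg').
Qed.

Definition lwbid (L : lwb) : lwbhom L L :=
  @LwbHom L L (fun i => bid (L i)) (fun i p n x => erefl)
    (fun i p n p' n' ep en x => erefl).

Program Definition lwbcomp L M N (g : lwbhom M N) (f : lwbhom L M) : lwbhom L N :=
  @LwbHom L N (fun i => bcomp (g i) (f i)) _ _.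
Next Obligation. by rewrite /= !lfun_w. Qed.
Next Obligation. by rewrite /= !lfun_s. Qed.

Program Definition LWBfrom : category := @Category lwb lwbhom lwbid lwbcomp _ _ _.
Next Obligation. by apply: lwbhom_ext. Qed.
Next Obligation. by apply: lwbhom_ext. Qed.
Next Obligation. by apply: lwbhom_ext. Qed.
End LWB.
Arguments lw {k} _ {i p n} : rename.
Arguments ls {k} _ {i p n p' n'} ep en : rename.

Definition LWB := LWBfrom 0.
Definition trLWB := LWBfrom 1.

Definition fib_LWB r : morphism_class LWB :=
  fun L M f => forall i, (i <= r)%N -> surjective (lfun f i).
Definition weq_LWB r : morphism_class LWB := fun L M f => quasi_iso (lfun f r).

Program Definition Upage (t : nat) : functor LWB (bC t) :=
  @Functor LWB (bC t) (fun L => lpage L t) (fun L M f => lfun f t) _ _.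
Next Obligation. by []. Qed.
Next Obligation. by []. Qed.

Section TranslateLWB.
Variable k : nat.

Section ObT.
Variable L : lwb k.
Let Tsp (p n p' n' : int) : p' = p + 1 -> n' = n + 1 -> 2 * n' - p' = 2 * n - p + 1.
Proof. lia. Qed.
Program Definition Tlwb : lwb k.+1 :=
  @Lwb k.+1 (fun i => Tcx (L i))
    (fun i p n => lw L)
    (fun i p n p' n' ep en => ls L en (Tsp ep en)) _ _ _.
Next Obligation. by rewrite lws. Qed.
Next Obligation. by rewrite /= lsw. Qed.
Next Obligation. exact: ldE. Qed.
End ObT.

Program Definition Tlwbhom L M (f : lwbhom L M) : lwbhom (Tlwb L) (Tlwb M) :=
  @LwbHom k.+1 (Tlwb L) (Tlwb M) (fun i => Tcx_hom (lfun f i)) _ _.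
Next Obligation. exact: (lfun_w f x). Qed.
Next Obligation. exact: (lfun_s f _ _ x). Qed.

(* T applied to each page *)
Program Definition TL : functor (LWBfrom k) (LWBfrom k.+1) :=
  @Functor (LWBfrom k) (LWBfrom k.+1) Tlwb Tlwbhom _ _.
Next Obligation. by apply: lwbhom_ext. Qed.
Next Obligation. by apply: lwbhom_ext. Qed.

Section ObTinv.
Variable L : lwb k.+1.
Let Tisp (p n p' n' : int) : p' = p + 1 -> n' = n + 1 -> 2 * p' - n' = 2 * p - n + 1.
Proof. lia. Qed.
Program Definition Tinvlwb : lwb k :=
  @Lwb k (fun i => Tinvcx (L i : bcomplex (k + i).+1))
    (fun i p n => lw L)
    (fun i p n p' n' ep en => ls L (Tisp ep en) ep) _ _ _.
Next Obligation. by rewrite lws. Qed.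
Next Obligation. by rewrite /= lsw. Qed.
Next Obligation. exact: ldE. Qed.
End ObTinv.

Program Definition Tinvlwbhom L M (f : lwbhom L M) : lwbhom (Tinvlwb L) (Tinvlwb M) :=
  @LwbHom k (Tinvlwb L) (Tinvlwb M)
    (fun i => Tinvcx_hom (lfun f i : @bhom (k + i).+1 (L i) (M i))) _ _.
Next Obligation. exact: (lfun_w f x). Qed.
Next Obligation. exact: (lfun_s f _ _ x). Qed.

Program Definition TLinv : functor (LWBfrom k.+1) (LWBfrom k) :=
  @Functor (LWBfrom k.+1) (LWBfrom k) Tinvlwb Tinvlwbhom _ _.
Next Obligation. by apply: lwbhom_ext. Qed.
Next Obligation. by apply: lwbhom_ext. Qed.
End TranslateLWB.

Section Truncation.
Variable L : lwb 0.
Program Definition Utr_ob : lwb 1 :=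
  @Lwb 1 (fun i => L i.+1) (fun i p n => lw L)
    (fun i p n p' n' ep en => ls L ep en) _ _ _.
Next Obligation. exact: lws. Qed.
Next Obligation. exact: lsw. Qed.
Next Obligation. exact: ldE. Qed.
End Truncation.

Program Definition Utr_hom (L M : lwb 0) (f : lwbhom L M) :
    lwbhom (Utr_ob L) (Utr_ob M) :=
  @LwbHom 1 (Utr_ob L) (Utr_ob M) (fun i => lfun f i.+1) _ _.
Next Obligation. exact: (lfun_w f x). Qed.
Next Obligation. exact: (lfun_s f _ _ x). Qed.

(* U_{>=1} *)
Program Definition Utr : functor LWB trLWB :=
  @Functor LWB trLWB Utr_ob Utr_hom _ _.
Next Obligation. by apply: lwbhom_ext. Qed.
Next Obligation. by apply: lwbhom_ext. Qed.

Program Definition zero_cx (r : nat) (A : bimod) : bcomplex r :=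
  @BComplex r A (fun p n p' n' _ _ => lin0 (A p n) (A p' n')) _.
Next Obligation. by []. Qed.

Program Definition zero_cx_hom (r : nat) (A B : bimod)
    (f : forall p n, {linear A p n -> B p n}) : bhom (zero_cx r A) (zero_cx r B) :=
  @BHom r (zero_cx r A) (zero_cx r B) f _.
Next Obligation. exact: linear0. Qed.

Section Prolongation.
Variable L : lwb 1.

Definition Ftr_page (i : nat) : bcomplex (0 + i)%N :=
  if i is j.+1 then L j else zero_cx 0 (L 0).

Definition Ftr_w (i : nat) (p n : int) : {linear Ftr_page i.+1 p n -> Ftr_page i p n} :=
  if i is j.+1 then lw L else linid (L 0 p n).

Definition Ftr_s (i : nat) (p n p' n' : int) : p' = p + 1 -> n' = n + 1 ->
    {linear Ftr_page i p n -> Ftr_page i.+1 p' n'} :=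
  if i is j.+1 then fun ep en => ls L ep en else fun _ _ => lin0 (L 0 p n) (L 0 p' n').

Program Definition Ftr_ob : lwb 0 := @Lwb 0 Ftr_page Ftr_w Ftr_s _ _ _.
Next Obligation. by case: i x => [|i] x //; exact: lws. Qed.
Next Obligation. by case: i x => [|i] x //; exact: lsw. Qed.
Next Obligation.
case: i ep' en' ep'' en'' x => [|i] ep' en' ep'' en'' x; last exact: ldE.
by rewrite /= linear0.
Qed.
End Prolongation.

Definition Ftr_fun (L M : lwb 1) (f : lwbhom L M) (i : nat) :
    bhom (Ftr_page L i) (Ftr_page M i) :=
  if i is j.+1 then lfun f j else zero_cx_hom 0 (lfun f 0).

Program Definition Ftr_hom (L M : lwb 1) (f : lwbhom L M) :
    lwbhom (Ftr_ob L) (Ftr_ob M) :=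
  @LwbHom 0 (Ftr_ob L) (Ftr_ob M) (Ftr_fun f) _ _.
Next Obligation. by case: i x => [|i] x //; exact: (lfun_w f x). Qed.
Next Obligation.
case: i x => [|i] x; last exact: (lfun_s f _ _ x).
exact: linear0.
Qed.

(* F_{>=1} *)
Program Definition Ftr : functor trLWB LWB :=
  @Functor trLWB LWB Ftr_ob Ftr_hom _ _.
Next Obligation. by apply: lwbhom_ext => -[|i]. Qed.
Next Obligation. by apply: lwbhom_ext => -[|i]. Qed.

Section Nerve.
Variable X : ess.

Definition wtuple (r : nat) (p n : int) : lmodType R :=
  dprod (fun i : 'I_r.+1 => X i p n).

Definition witness r p n (x : wtuple r p n) :=
  forall i (h : (i.+1 < r.+1)%N),
    represents (ephi X (x (Ordinal h))) (x (Ordinal (ltnW h))).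

Lemma witness0 r p n : witness (0 : wtuple r p n).
Proof.
move=> i h.
rewrite (_ : ephi X _ = 0) ?represents0; last exact: linear0.
exact: bnd0.
Qed.

Lemma witnessZD r p n a (x y : wtuple r p n) :
  witness x -> witness y -> witness (a *: x + y).
Proof.
move=> hx hy i h.
rewrite (_ : ephi X _ = a *: ephi X (x (Ordinal h)) + ephi X (y (Ordinal h))).
  exact: representsZD.
exact: linearP.
Qed.

Definition wtop r p n (x : wtuple r p n) : X r p n := x ord_max.

(* pairs (x;x') = ((x_0, ..., x_r);(x'_0, ..., x'_r)); x' lives in the bidegree
   of the target of d_r *)
Definition nerve_amb r p n : lmodType R :=
  (wtuple r p n * wtuple r (p - r%:Z) (n + 1 - r%:Z))%type.

Definition is_nerve r p n (u : nerve_amb r p n) :=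
  [/\ witness u.1, witness u.2 & bdiff (X r) erefl erefl (wtop u.1) = wtop u.2].

Program Definition nerve_sub r p n : submodule (nerve_amb r p n) :=
  @Submodule R _ (@is_nerve r p n) _ _.
Next Obligation. by split; [exact: witness0|exact: witness0|exact: linear0]. Qed.
Next Obligation.
case: H => u1 u2 ud; case: H0 => v1 v2 vd; split; [exact: witnessZD|exact: witnessZD|].
exact: etrans (linearP _ a _ _) (congr2 (fun x y => a *: x + y) ud vd).
Qed.

Definition nerve_mod r p n : lmodType R := subm (nerve_sub r p n).

Definition wcast r p n p' n' (ep : p = p') (en : n = n') :
    {linear wtuple r p n -> wtuple r p' n'} :=
  mklin (f := fun x : wtuple r p n => (fun i => gcast (X i) ep en (x i)) : wtuple r p' n')
    (fun a x y => dprod_ext (fun i : 'I_r.+1 => linearP (gcast (X i) ep en) a (x i) (y i))).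

Definition wtrunc r p n : {linear wtuple r.+1 p n -> wtuple r p n} :=
  mklin (f := fun x : wtuple r.+1 p n =>
           (fun i : 'I_r.+1 => x (widen_ord (leqnSn r.+1) i)) : wtuple r p n)
    (fun a x y => erefl).

Definition wext_fun r p n (x : wtuple r p n) : wtuple r.+1 p n := fun i : 'I_r.+2 =>
  match @idP (i < r.+1)%N with
  | ReflectT h => x (Ordinal h)
  | ReflectF _ => 0
  end.

Lemma wext_linear r p n : linear (@wext_fun r p n).
Proof.
move=> a x y; apply: dprod_ext => i; rewrite dprodP /wext_fun.
by case: {-}_ / idP => h //; rewrite scaler0 addr0.
Qed.
Definition wext r p n : {linear wtuple r p n -> wtuple r.+1 p n} :=
  mklin (@wext_linear r p n).

Lemma wext_lt r p n (x : wtuple r p n) i (h : (i < r.+2)%N) (h' : (i < r.+1)%N) :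
  wext r p n x (Ordinal h) = x (Ordinal h').
Proof.
rewrite /= /wext_fun; case: {-}_ / idP => //= h2.
by rewrite (bool_irrelevance h2 h').
Qed.

Lemma wext_max r p n (x : wtuple r p n) (h : (r.+1 < r.+2)%N) :
  wext r p n x (Ordinal h) = 0.
Proof. by rewrite /= /wext_fun; case: {-}_ / idP => //= h2; exfalso; rewrite ltnn in h2. Qed.

Lemma witness_cast r p n p' n' (ep : p = p') (en : n = n') (x : wtuple r p n) :
  witness x -> witness (wcast r ep en x).
Proof. by subst. Qed.

Lemma wtop_cast r p n p' n' (ep : p = p') (en : n = n') (x : wtuple r p n) :
  wtop (wcast r ep en x) = gcast (X r) ep en (wtop x).
Proof. by []. Qed.

Lemma ordinal_irr r p n (x : wtuple r p n) i (h h' : (i < r.+1)%N) :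
  x (Ordinal h) = x (Ordinal h').
Proof. by rewrite (bool_irrelevance h h'). Qed.

Lemma witness_trunc r p n (x : wtuple r.+1 p n) : witness x -> witness (wtrunc r p n x).
Proof.
move=> hx i h; have h1 : (i.+1 < r.+2)%N by exact: ltnW.
have := hx i h1; congr (represents (ephi X _) _); exact: ordinal_irr.
Qed.

Lemma trunc_top_cycle r p n (x : wtuple r.+1 p n) :
  witness x -> is_cycle (wtop (wtrunc r p n x)).
Proof.
move=> hx; have := represents_cycle (hx r (ltnSn r.+1)).
by congr (is_cycle _); exact: ordinal_irr.
Qed.

Lemma witness_ext r p n (x : wtuple r p n) :
  witness x -> is_bnd (wtop x) -> witness (wext r p n x).
Proof.
move=> hx hb i h.
have h1 : (i < r.+1)%N by [].
rewrite (wext_lt x (ltnW h) h1); have := h; rewrite ltnS leq_eqVlt => /orP[/eqP e|h2].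
  case: e => e; subst i; rewrite (wext_max x h) linear0; apply/represents0.
  by move: hb; congr (is_bnd _); exact: ordinal_irr.
rewrite (wext_lt x h h2); have := hx i h2.
by congr (represents _ _); exact: ordinal_irr.
Qed.

Lemma wtop_ext r p n (x : wtuple r p n) : wtop (wext r p n x) = 0.
Proof. exact: (wext_max x (ltnSn r.+1)). Qed.

Lemma nerveP r p n (u : nerve_mod r p n) : is_nerve (mval u).
Proof. exact: (@msubP _ _ (nerve_sub r p n) u). Qed.

Section NerveDiff.
Variables (r : nat) (p n p' n' : int).
Hypotheses (ep : p' = p - r%:Z) (en : n' = n + 1 - r%:Z).

Definition nerve_d_fun (u : nerve_mod r p n) : nerve_amb r p' n' :=
  (wcast r (esym ep) (esym en) (mval u).2, 0).

Lemma nerve_d_linear : linear nerve_d_fun.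
Proof.
move=> a u v; congr pair; last by rewrite /= scaler0 addr0.
exact: (linearP (wcast r (esym ep) (esym en))).
Qed.

Lemma nerve_dP u : is_nerve (nerve_d_fun u).
Proof.
have [h1 h2 h3] := nerveP u; split; [exact: witness_cast|exact: witness0|].
rewrite /nerve_d_fun wtop_cast -h3.
move: (mval u).1 => x; subst p' n'; rewrite gcast_id; exact: bdiffK.
Qed.

Definition nerve_d : {linear nerve_mod r p n -> nerve_mod r p' n'} :=
  sublift (S := nerve_sub r p' n') (f := mklin nerve_d_linear) nerve_dP.
End NerveDiff.

Program Definition nerve_cx r : bcomplex r :=
  @BComplex r (nerve_mod r) (@nerve_d r) _.
Next Obligation.
apply: mval_inj; congr pair; exact: linear0.
Qed.

Section NerveW.
Variables (r : nat) (p n : int).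

Definition nerve_w_fun (u : nerve_mod r.+1 p n) : nerve_amb r p n :=
  (wtrunc r p n (mval u).1, 0).

Lemma nerve_w_linear : linear nerve_w_fun.
Proof. by move=> a u v; congr pair; rewrite /= scaler0 addr0. Qed.

Lemma nerve_wP u : is_nerve (nerve_w_fun u).
Proof.
have [h1 h2 h3] := nerveP u; split; [exact: witness_trunc|exact: witness0|].
exact: trunc_top_cycle.
Qed.

Definition nerve_w : {linear nerve_mod r.+1 p n -> nerve_mod r p n} :=
  sublift (S := nerve_sub r p n) (f := mklin nerve_w_linear) nerve_wP.
End NerveW.

Section NerveS.
Variables (r : nat) (p n p' n' : int).
Hypotheses (ep : p' = p + 1) (en : n' = n + 1).
Let sp : p - r%:Z = p' - r.+1%:Z. Proof. lia. Qed.
Let sn : n + 1 - r%:Z = n' + 1 - r.+1%:Z. Proof. lia. Qed.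

Definition nerve_s_fun (u : nerve_mod r p n) : nerve_amb r.+1 p' n' :=
  (0, wcast r.+1 sp sn (wext r _ _ (mval u).2)).

Lemma nerve_s_linear : linear nerve_s_fun.
Proof.
move=> a u v; congr pair; first by rewrite /= scaler0 addr0.
exact: (linearP (lincomp (wcast r.+1 sp sn) (wext r _ _))).
Qed.

Lemma nerve_sP u : is_nerve (nerve_s_fun u).
Proof.
have [h1 h2 h3] := nerveP u; split; [exact: witness0|apply: witness_cast|].
  apply: witness_ext => //; rewrite -h3.
  by exists p, n, erefl, erefl, (wtop (mval u).1).
by rewrite /nerve_s_fun wtop_cast wtop_ext !linear0.
Qed.

Definition nerve_s : {linear nerve_mod r p n -> nerve_mod r.+1 p' n'} :=
  sublift (S := nerve_sub r.+1 p' n') (f := mklin nerve_s_linear) nerve_sP.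
End NerveS.

Program Definition nerve : lwb 0 := @Lwb 0 nerve_cx nerve_w nerve_s _ _ _.
Next Obligation.
apply: mval_inj; congr pair; exact: linear0.
Qed.
Next Obligation.
apply: mval_inj; congr pair.
exact: (linear0 (lincomp (wcast i.+1 _ _) (wext i _ _))).
Qed.
Next Obligation.
apply: mval_inj; congr pair; apply: dprod_ext => -[j hj].
have E : forall e1 e2 e3 e4,
    gcast (X j) e3 e4 (gcast (X j) e1 e2 (wext i _ _ (mval x).2
      (widen_ord (leqnSn i.+1) (Ordinal hj)))) =
    gcast (X j) (esym ep'') (esym en'') ((mval x).2 (Ordinal hj)).
  move=> q m e1 e2 e3 e4.
  apply: (etrans (gcast_comp (A := X j) e1 e2 e3 e4 (esym ep'') (esym en'') _)).
  congr (gcast _ _ _ _); exact: wext_lt.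
exact/esym/E.
Qed.
End Nerve.

Section NerveMap.
Variables (X Y : ess) (f : esshom X Y).

Definition wmap r p n : {linear wtuple X r p n -> wtuple Y r p n} :=
  mklin (f := fun x : wtuple X r p n => (fun i => f i p n (x i)) : wtuple Y r p n)
    (fun a x y => dprod_ext (fun i : 'I_r.+1 => linearP (f i p n) a (x i) (y i))).

Lemma witness_map r p n (x : wtuple X r p n) : witness x -> witness (wmap r p n x).
Proof.
move=> hx i h.
rewrite (_ : ephi Y _ = Hmap (f i) p n (ephi X (x (Ordinal h)))); last exact: efun_phi.
exact: Hmap_represents.
Qed.

Definition nerve_map_fun r p n (u : nerve_mod X r p n) : nerve_amb Y r p n :=
  (wmap r _ _ (mval u).1, wmap r _ _ (mval u).2).

Lemma nerve_map_linear r p n : linear (@nerve_map_fun r p n).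
Proof. by move=> a u v; congr pair; exact: (linearP (wmap r _ _)). Qed.

Lemma nerve_mapP r p n u : is_nerve (@nerve_map_fun r p n u).
Proof.
have [h1 h2 h3] := nerveP u; split; [exact: witness_map|exact: witness_map|].
by rewrite [RHS](congr1 (f r _ _) (esym h3)) bfun_d.
Qed.

Definition nerve_map r p n : {linear nerve_mod X r p n -> nerve_mod Y r p n} :=
  sublift (S := nerve_sub Y r p n) (f := mklin (@nerve_map_linear r p n))
    (@nerve_mapP r p n).

Lemma wmap_cast r p n p' n' (ep : p = p') (en : n = n') (x : wtuple X r p n) :
  wmap r p' n' (wcast X r ep en x) = wcast Y r ep en (wmap r p n x).
Proof. by subst; exact: dprod_ext. Qed.

Lemma wmap_ext r p n (x : wtuple X r p n) :
  wmap r.+1 p n (wext X r p n x) = wext Y r p n (wmap r p n x).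
Proof.
apply: dprod_ext => i; rewrite /= /wext_fun.
by case: {-}_ / idP => h //; exact: linear0.
Qed.

Program Definition nerve_map_bhom r : bhom (nerve_cx X r) (nerve_cx Y r) :=
  @BHom r (nerve_cx X r) (nerve_cx Y r) (nerve_map r) _.
Next Obligation.
apply: mval_inj; congr pair; first exact: wmap_cast.
exact: (linear0 (wmap r _ _)).
Qed.

Program Definition nerve_hom : lwbhom (nerve X) (nerve Y) :=
  @LwbHom 0 (nerve X) (nerve Y) nerve_map_bhom _ _.
Next Obligation.
apply: mval_inj; congr pair.
exact: (linear0 (wmap i _ _)).
Qed.
Next Obligation.
apply: mval_inj; congr pair; first exact: (linear0 (wmap i.+1 _ _)).
by rewrite -wmap_ext; exact: wmap_cast.
Qed.
End NerveMap.

Program Definition Nerve : functor ESpSe LWB :=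
  @Functor ESpSe LWB nerve nerve_hom _ _.
Next Obligation.
apply: lwbhom_ext => i p n u; apply: mval_inj.
by rewrite [RHS]surjective_pairing; congr pair; exact: dprod_ext.
Qed.
Next Obligation.
by apply: lwbhom_ext => i p n u; apply: mval_inj.
Qed.

Section Rho.
Variables (X : ess) (r : nat).

Definition rho_fun p n : {linear nerve_mod X r p n -> X r p n} :=
  mklin (f := fun u : nerve_mod X r p n => wtop (mval u).1) (fun a u v => erefl).

Program Definition rho : bhom (nerve_cx X r) (X r) :=
  @BHom r (nerve_cx X r) (X r) rho_fun _.
Next Obligation.
have [_ _ h] := nerveP x.
rewrite [LHS]wtop_cast -h /=; subst p' n'; exact: gcast_id.
Qed.
End Rho.

Section RhoQuasiIso.
Variable X : ess.

Definition wpair p n (x0 : X 0 p n) (x1 : X 1 p n) : wtuple X 1 p n :=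
  fun i => let: Ordinal k _ := i in
    match k return X k p n with 0 => x0 | 1 => x1 | _ => 0 end.

Lemma wpair_witness p n (x0 : X 0 p n) (x1 : X 1 p n) :
  represents (ephi X x1) x0 -> witness (wpair x0 x1).
Proof. by move=> h [|i]. Qed.

Lemma rho1_surj p n (h : homology (X 1) p n) : exists k, Hmap (rho X 1) p n k = h.
Proof.
have [x1 hx] := represents_ex h; have [x0 hx0] := represents_ex (ephi X x1).
have hu : @is_nerve X 1 p n (wpair x0 x1, 0).
  split; [exact: wpair_witness|exact: witness0|exact: (represents_cycle hx)].
pose u : nerve_mod X 1 p n := msub (S := nerve_sub X 1 p n) hu.
have cu : is_cycle (A := nerve_cx X 1) u.
  by apply: mval_inj; congr pair; exact: linear0.
exists (hcl (msub (S := cycles _ p n) cu)).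
have hr : represents (hcl (msub (S := cycles _ p n) cu)) u.
  by exists (msub (S := cycles _ p n) cu).
exact: represents_uniq (Hmap_represents (rho X 1) hr) hx.
Qed.

Lemma rho1_ker p n (k : homology (nerve_cx X 1) p n) :
  Hmap (rho X 1) p n k = 0 -> k = 0.
Proof.
move=> hk; have [u hu] := represents_ex k.
have := Hmap_represents (rho X 1) hu; rewrite hk represents0.
move=> [p0 [n0 [ep [en [y hy]]]]].
have cu : is_cycle u := represents_cycle hu.
have u2 : (mval u).2 = 0.
  have := congr1 (fun v => (mval v).1) cu.
  move=> /= /(congr1 (fun x : wtuple X 1 _ _ => wcast X 1 erefl erefl x)).
  by move=> h; apply: dprod_ext => i; exact: (congr1 (fun x : wtuple X 1 _ _ => x i) h).
suff : is_bnd u by move=> /represents0 h0; exact: represents_uniq hu h0.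
have [y0 hy0] := represents_ex (ephi X y).
subst p n; have [h1 _ _] := nerveP u.
have hv : @is_nerve X 1 p0 n0 (wpair y0 y, (mval u).1).
  by split; [exact: wpair_witness|exact: h1|exact: hy].
exists p0, n0, erefl, erefl, (msub (S := nerve_sub X 1 p0 n0) hv).
by apply: mval_inj; rewrite [RHS]surjective_pairing u2; congr pair; exact: dprod_ext.
Qed.

Lemma rho1_quasi_iso : quasi_iso (rho X 1).
Proof.
move=> p n; have hs := @rho1_surj p n.
exists (fun h => sval (cid (hs h))) => [k|h]; last by case: cid.
case: cid => k' /= e; apply/eqP; rewrite -subr_eq0; apply/eqP/rho1_ker.
by rewrite linearB /= e; exact: subrr.
Qed.
End RhoQuasiIso.

Lemma HT_represents r (A : bcomplex r) (p n : int) (h : homology A n (2 * n - p)) a :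
  represents h a -> represents (HT A p n h) (a : Tcx A p n).
Proof. exact: Hind_represents. Qed.

Lemma HTinv_represents r (B : bcomplex r.+1) (p n : int)
    (h : homology B (2 * p - n) p) b :
  represents h b -> represents (HTinv B p n h) (b : Tinvcx B p n).
Proof. exact: Hind_represents. Qed.

Section ZeroComplex.
Variables (r : nat) (A : bimod) (p n : int).
Lemma zero_cx_cycle (x : A p n) : is_cycle (A := zero_cx r A) (x : zero_cx r A p n).
Proof. by []. Qed.

(* The identification A = H(A) for a complex with zero differential. *)
Definition Hzero : {linear A p n -> homology (zero_cx r A) p n} :=
  lincomp hcl (sublift (S := cycles (zero_cx r A) p n) (f := linid (A p n)) zero_cx_cycle).

Lemma Hzero_represents x : represents (Hzero x) x.
Proof. by exists (msub (S := cycles (zero_cx r A) p n) (zero_cx_cycle x)). Qed.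
End ZeroComplex.

Section Shift.
Variable X : ess.

Definition shift_page (i : nat) : bcomplex i :=
  if i is j.+1 then Tcx (X j) else zero_cx 0 (Tcx (X 0)).

Definition shift_phi (i : nat) (p n : int) :
    {linear shift_page i.+1 p n -> homology (shift_page i) p n} :=
  if i is j.+1 then lincomp (HT (X j) p n) (ephi X)
  else Hzero 0 (Tcx (X 0)) p n.

Definition shift : ess := Ess shift_phi.
End Shift.

Section ShiftHom.
Variables (X Y : ess) (f : esshom X Y).

Definition shift_fun (i : nat) : bhom (shift X i) (shift Y i) :=
  if i is j.+1 then Tcx_hom (f j) else zero_cx_hom 0 (Tcx_hom (f 0)).

Lemma shift_fun_phi i p n (x : shift X i.+1 p n) :
  ephi (shift Y) (shift_fun i.+1 p n x) = Hmap (shift_fun i) p n (ephi (shift X) x).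
Proof.
case: i x => [|j] x.
  have h := Hmap_represents (zero_cx_hom 0 (Tcx_hom (f 0))) (Hzero_represents 0 x).
  exact: represents_uniq (Hzero_represents 0 _) h.
have [a ha] := represents_ex (ephi X (x : X j.+1 n (2 * n - p))).
have h1 := Hmap_represents (Tcx_hom (f j)) (HT_represents ha).
have := Hmap_represents (f j) ha; rewrite -efun_phi => /HT_represents h2.
exact: represents_uniq h2 h1.
Qed.

Definition shift_hom : esshom (shift X) (shift Y) := EssHom shift_fun_phi.
End ShiftHom.

Program Definition Shift : functor ESpSe ESpSe :=
  @Functor ESpSe ESpSe shift shift_hom _ _.
Next Obligation. by apply: esshom_ext => -[|i]. Qed.
Next Obligation. by apply: esshom_ext => -[|i]. Qed.

Section Dec.
Variable X : ess.

Definition dec_page (i : nat) : bcomplex i :=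
  if i is j.+1 then Tinvcx (X j.+2) else Tinvcx (nerve_cx X 1).

Definition dec_phi (i : nat) (p n : int) :
    {linear dec_page i.+1 p n -> homology (dec_page i) p n} :=
  if i is j.+1 then lincomp (HTinv (X j.+2) p n) (ephi X)
  else lincomp (HTinv (nerve_cx X 1) p n)
         (lincomp (lininv (@rho1_quasi_iso X (2 * p - n) p)) (ephi X)).

Definition dec : ess := Ess dec_phi.
End Dec.

Section DecHom.
Variables (X Y : ess) (f : esshom X Y).

Definition dec_fun (i : nat) : bhom (dec X i) (dec Y i) :=
  if i is j.+1 then Tinvcx_hom (f j.+2) else Tinvcx_hom (nerve_map_bhom f 1).

Lemma lininv_rho_nat p n (h : homology (X 1) p n) :
  lininv (@rho1_quasi_iso Y p n) (Hmap (f 1) p n h) =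
  Hmap (nerve_map_bhom f 1) p n (lininv (@rho1_quasi_iso X p n) h).
Proof.
set k := lininv _ h; apply: (bij_inj (@rho1_quasi_iso Y p n)).
rewrite lininvK -[h](lininvK (@rho1_quasi_iso X p n)) -/k.
have [u hu] := represents_ex k.
have h1 := Hmap_represents (f 1) (Hmap_represents (rho X 1) hu).
have h2 := Hmap_represents (rho Y 1) (Hmap_represents (nerve_map_bhom f 1) hu).
exact: represents_uniq h1 h2.
Qed.

Lemma HTinv_nat r (A B : bcomplex r.+1) (g : bhom A B) (p n : int)
    (h : homology A (2 * p - n) p) :
  HTinv B p n (Hmap g _ _ h) = Hmap (Tinvcx_hom g) p n (HTinv A p n h).
Proof.
have [a ha] := represents_ex h.
have h1 := HTinv_represents (Hmap_represents g ha).
exact: represents_uniq h1 (Hmap_represents (Tinvcx_hom g) (HTinv_represents ha)).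
Qed.

Lemma dec_fun_phi i p n (x : dec X i.+1 p n) :
  ephi (dec Y) (dec_fun i.+1 p n x) = Hmap (dec_fun i) p n (ephi (dec X) x).
Proof.
case: i x => [|j] x.
  apply: etrans (HTinv_nat _ _); congr (HTinv _ _ _ _).
  apply: etrans (lininv_rho_nat _); congr (lininv _ _); exact: efun_phi.
apply: etrans (HTinv_nat _ _); congr (HTinv _ _ _ _); exact: efun_phi.
Qed.

Definition dec_hom : esshom (dec X) (dec Y) := EssHom dec_fun_phi.
End DecHom.

Program Definition Dec : functor ESpSe ESpSe :=
  @Functor ESpSe ESpSe dec dec_hom _ _.
Next Obligation.
apply: esshom_ext => -[|i] p n u //; apply: mval_inj.
by rewrite [RHS]surjective_pairing; congr pair; exact: dprod_ext.
Qed.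
Next Obligation. by apply: esshom_ext => -[|i] p n u //; apply: mval_inj. Qed.

Section QuotientComplex.
Variables (r : nat) (A : bcomplex r) (S : forall p n, submodule (A p n)).
Hypothesis Sd : forall p n p' n' (ep : p' = p - r%:Z) (en : n' = n + 1 - r%:Z) x,
  S p n x -> S p' n' (bdiff A ep en x).

Lemma quot_d_subproof p n p' n' (ep : p' = p - r%:Z) (en : n' = n + 1 - r%:Z) x :
  S p n x -> lincomp (qpi (S p' n')) (bdiff A ep en) x = 0.
Proof. by move=> h; apply/qpi_eq0; exact: Sd. Qed.

Program Definition quot_cx : bcomplex r :=
  @BComplex r (fun p n => quotm (S p n))
    (fun p n p' n' ep en => qlift (@quot_d_subproof p n p' n' ep en)) _.
Next Obligation.
have [y <-] := qpi_surj x.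
apply: etrans (congr1 (qlift (@quot_d_subproof _ _ _ _ ep2 en2)) (qliftE _ _)) _.
by apply: etrans (qliftE _ _) _; apply/qpi_eq0; rewrite bdiffK; exact: submod0.
Qed.

Program Definition quot_pi : bhom A quot_cx :=
  @BHom r A quot_cx (fun p n => qpi (S p n)) _.
Next Obligation. exact: (esym (qliftE (@quot_d_subproof p n p' n' ep en) x)). Qed.
End QuotientComplex.

Section QObj.
Variable L : lwb 0.

Section Relations.
Variables (i : nat).

Definition in_s p n (x : L i.+1 p n) :=
  exists p0 n0 (ep : p = p0 + 1) (en : n = n0 + 1) (b : L i p0 n0), x = ls L ep en b.

Definition in_ds p n (x : L i.+1 p n) :=
  exists p0 n0 (ep : p = p0 - i.+1%:Z) (en : n = n0 + 1 - i.+1%:Z) (y : L i.+1 p0 n0),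
    in_s y /\ x = bdiff (L i.+1) ep en y.

Definition in_sds p n (x : L i.+1 p n) :=
  exists y z, [/\ in_s y, in_ds z & x = y + z].

Lemma in_s0 p n : in_s (0 : L i.+1 p n).
Proof.
have ep : p = (p - 1) + 1 by lia.
have en : n = (n - 1) + 1 by lia.
by exists (p - 1), (n - 1), ep, en, 0; rewrite linear0.
Qed.

Lemma in_sZD p n a (x y : L i.+1 p n) : in_s x -> in_s y -> in_s (a *: x + y).
Proof.
move=> [p0 [n0 [ep [en [b ->]]]]] [p1 [n1 [ep1 [en1 [c ->]]]]].
have e1 : p1 = p0 by lia.
have e2 : n1 = n0 by lia.
subst p1 n1; exists p0, n0, ep, en, (a *: b + c).
by rewrite linearP (Prop_irrelevance ep1 ep) (Prop_irrelevance en1 en).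
Qed.

Lemma in_ds0 p n : in_ds (0 : L i.+1 p n).
Proof.
have ep : p = (p + i.+1%:Z) - i.+1%:Z by lia.
have en : n = (n + i.+1%:Z - 1) + 1 - i.+1%:Z by lia.
exists (p + i.+1%:Z), (n + i.+1%:Z - 1), ep, en, 0; split; first exact: in_s0.
by rewrite linear0.
Qed.

Lemma in_dsZD p n a (x y : L i.+1 p n) : in_ds x -> in_ds y -> in_ds (a *: x + y).
Proof.
move=> [p0 [n0 [ep [en [b [hb ->]]]]]] [p1 [n1 [ep1 [en1 [c [hc ->]]]]]].
have e1 : p1 = p0 by lia.
have e2 : n1 = n0 by lia.
subst p1 n1; exists p0, n0, ep, en, (a *: b + c); split; first exact: in_sZD.
by rewrite linearP (Prop_irrelevance ep1 ep) (Prop_irrelevance en1 en).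
Qed.

Program Definition sds p n : submodule (L i.+1 p n) :=
  @Submodule R _ (@in_sds p n) _ _.
Next Obligation.
by exists 0, 0; split; [exact: in_s0|exact: in_ds0|rewrite addr0].
Qed.
Next Obligation.
case: H => y [z [hy hz ->]]; case: H0 => y' [z' [hy' hz' ->]].
exists (a *: y + y'), (a *: z + z').
split; [exact: in_sZD|exact: in_dsZD|by rewrite scalerDr addrACA].
Qed.

Lemma sds_d p n p' n' (ep : p' = p - i.+1%:Z) (en : n' = n + 1 - i.+1%:Z) x :
  sds p n x -> sds p' n' (bdiff (L i.+1) ep en x).
Proof.
move=> [y [z [hy [p0 [n0 [ep0 [en0 [u [_ hu]]]]]] ->]]].
exists 0, (bdiff (L i.+1) ep en y); split; [exact: in_s0|by exists p, n, ep, en, y|].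
by rewrite add0r linearD hu bdiffK addr0.
Qed.

Lemma lw_s p n (x : L i.+1 p n) : in_s x -> lw L x = 0.
Proof. by move=> [p0 [n0 [ep [en [b ->]]]]]; exact: lws. Qed.

Lemma lw_ds p n (x : L i.+1 p n) : in_ds x -> is_bnd (A := L i) (lw L x).
Proof.
move=> [p0 [n0 [ep [en [y [[p1 [n1 [ep1 [en1 [b ->]]]]] ->]]]]]].
have ep2 : p = p1 - (0 + i)%N%:Z by lia.
have en2 : n = n1 + 1 - (0 + i)%N%:Z by lia.
exists p1, n1, ep2, en2, b; exact: ldE.
Qed.

Lemma lw_cycle p n (x : L i.+1 p n) : is_cycle (A := L i) (lw L x).
Proof.
rewrite /is_cycle.
have ep : p - (0 + i)%N%:Z = (p + 1) - (0 + i.+1)%N%:Z by lia.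
have en : n + 1 - (0 + i)%N%:Z = (n + 1) + 1 - (0 + i.+1)%N%:Z by lia.
by rewrite (ldE erefl erefl ep en) lsw !linear0.
Qed.
End Relations.

Definition Qpage (i : nat) : bcomplex i :=
  if i is j.+1 then quot_cx (@sds_d j) else (L 0 : bcomplex 0).

Definition Qpi (i : nat) : bhom (L i : bcomplex i) (Qpage i) :=
  if i is j.+1 then quot_pi (@sds_d j) else bid (L 0 : bcomplex 0).

Section QPhi.
Variables (i : nat) (p n : int).

Definition Qw : {linear L i.+1 p n -> Qpage i p n} := lincomp (Qpi i p n) (lw L).

Lemma Qw_cycle x : is_cycle (Qw x).
Proof. exact: bhom_cycle (lw_cycle x). Qed.

Lemma Qw_bnd x : sds i p n x -> is_bnd (Qw x).
Proof.
move=> [y [z [hy hz ->]]]; apply: (bhom_bnd (Qpi i)).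
by rewrite linearD (lw_s hy) add0r; exact: lw_ds.
Qed.

Definition Qw_class : {linear L i.+1 p n -> homology (Qpage i) p n} :=
  lincomp hcl (sublift (S := cycles (Qpage i) p n) (f := Qw) Qw_cycle).

Lemma Qphi_subproof x : sds i p n x -> Qw_class x = 0.
Proof. by move=> h; apply/qpi_eq0; exact: Qw_bnd. Qed.

Definition Qphi : {linear Qpage i.+1 p n -> homology (Qpage i) p n} :=
  qlift Qphi_subproof.

Lemma Qphi_represents (x : L i.+1 p n) :
  represents (Qphi (Qpi i.+1 p n x)) (Qpi i p n (lw L x)).
Proof.
exists (msub (S := cycles (Qpage i) p n) (Qw_cycle x)) => //.
exact: (esym (qliftE Qphi_subproof x)).
Qed.
End QPhi.

Definition Qob : ess := Ess Qphi.
End QObj.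

Section QHom.
Variables (L M : lwb 0) (f : lwbhom L M).

Lemma in_s_hom i p n (x : L i.+1 p n) : in_s x -> in_s (lfun f i.+1 p n x).
Proof.
move=> [p0 [n0 [ep [en [b ->]]]]]; exists p0, n0, ep, en, (lfun f i p0 n0 b).
exact: lfun_s.
Qed.

Lemma Qhom_subproof i p n x : sds L i p n x ->
  lincomp (Qpi M i.+1 p n) (lfun f i.+1 p n) x = 0.
Proof.
move=> [y [z [hy [p0 [n0 [ep [en [u [hu ->]]]]]] ->]]]; apply/qpi_eq0.
rewrite linearD bfun_d; exists (lfun f i.+1 p n y); eexists.
split; [exact: in_s_hom| |reflexivity].
exists p0, n0, ep, en, (lfun f i.+1 p0 n0 u); split=> //; exact: in_s_hom.
Qed.

Program Definition Qhom_succ i : bhom (Qpage L i.+1) (Qpage M i.+1) :=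
  @BHom i.+1 (Qpage L i.+1) (Qpage M i.+1) (fun p n => qlift (@Qhom_subproof i p n)) _.
Next Obligation.
have [y <-] := qpi_surj x.
have e1 := esym (bfun_d (Qpi L i.+1) ep en y).
apply: etrans (congr1 (qlift (@Qhom_subproof i p' n')) e1) _.
apply: etrans (qliftE _ _) _.
have e2 := bfun_d (lfun f i.+1 : @bhom i.+1 (L i.+1) (M i.+1)) ep en y.
apply: etrans (congr1 (Qpi M i.+1 p' n') e2) _.
rewrite bfun_d; apply: congr1.
exact: esym (qliftE (@Qhom_subproof i p n) y).
Qed.

Definition Qhom_fun (i : nat) : bhom (Qpage L i) (Qpage M i) :=
  if i is j.+1 then Qhom_succ j else lfun f 0.

Lemma Qhom_pi i p n (x : L i p n) :
  Qhom_fun i p n (Qpi L i p n x) = Qpi M i p n (lfun f i p n x).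
Proof. by case: i x => [|i] x //; exact: qliftE. Qed.

Lemma Qhom_phi i p n (x : Qob L i.+1 p n) :
  ephi (Qob M) (Qhom_fun i.+1 p n x) = Hmap (Qhom_fun i) p n (ephi (Qob L) x).
Proof.
have [y <-] := qpi_surj x.
have h1 := Hmap_represents (Qhom_fun i) (Qphi_represents y).
have h2 := Qphi_represents (lfun f i.+1 p n y).
rewrite -lfun_w -(Qhom_pi (lw L y)) -(Qhom_pi y) in h2.
exact: represents_uniq h2 h1.
Qed.

Definition Qhom : esshom (Qob L) (Qob M) := EssHom Qhom_phi.
End QHom.

Program Definition Q : functor LWB ESpSe := @Functor LWB ESpSe Qob Qhom _ _.
Next Obligation.
by apply: esshom_ext => -[|i] p n u //; have [a <-] := qpi_surj u; exact: qliftE.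
Qed.
Next Obligation.
apply: esshom_ext => -[|i] p n u //; have [a <-] := qpi_surj u.
apply: etrans (Qhom_pi (lwbcomp g f) a) _.
apply: etrans (congr1 (Qhom_fun g i.+1 p n) (esym (Qhom_pi f a))).
exact: esym (Qhom_pi g (lfun f i.+1 p n a)).
Qed.
End Complexes.

(* Main.v *)
From Pilot Require Import Defs.
From mathcomp Require Import all_boot all_order all_algebra.
From mathcomp Require Import boolp zify.
(* The algebra library also has a hom; the one meant below is that of categories. *)
Import Pilot.Defs.

(** In every adjunction F -| G of the statement the right adjoint G preserves
    fibrations, and it both preserves and detects weak equivalences. Hence G is
    right Quillen, and a map F x -> y is a weak equivalence exactly when its adjunct
    is, provided the unit x -> G F x is a weak equivalence. For this unit it is
    enough, over each cofibrant x, to find one object z with a weak equivalence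
    z -> x for which the unit at z is a weak equivalence
    ([quillen_equivalence_criterion]). The unit at z is known up to an isomorphism
    of its target as soon as some universal arrow from z to G is known, so a left
    adjoint enters only through universal arrows ([universal]); this serves the
    functors LDec and F_[t], which are given only up to isomorphism, and it also
    yields their existence ([left_adjoint_of_universal]).

    - Translation of complexes, and prolongation of linear witness books, have units
      that are invertible on the page in question ([T_strong], [Tinv_strong],
      [prolong_strong]).
    - F_[0] A has A on page 0, and on page j > 0 two copies of A / dA, made of the
      elements s^j a and d s^j a ([free_book]). Translation and prolongation carry
      this to every page t ([free_at_page]); A -> (F_[t] A)_t is invertible, and s
      vanishes on page t - 1.
    - The projection rho from page r of the nerve to X_r is a quasi-isomorphism
      ([rho_quasi_iso]), so the nerve creates weak equivalences. Followed by rho, the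
      unit L -> N Q L is the projection of L_t onto its quotient by s and d s, which
      is bijective if s vanishes on page t - 1. So z = F_[t] (L_t) -> L is a suitable
      choice ([Q_strong]).
    - The unit X -> Dec Shift X is a quasi-isomorphism on every page
      ([shift_unit_quasi_iso]). Consequently the counit Shift Dec X -> X is a weak
      equivalence, and, Shift being fully faithful, the identity of Shift Dec X is a
      universal arrow to Shift: z = Shift Dec X settles LDec -| Shift
      ([ldec_strong]).
    - On page 0, LDec X is up to translation the complex obtained from X_1 by gluing
      the free complex on X_0 / d X_0 along the characteristic map ([glued_cx]).

    Iterates follow because the equivalences compose, the condition on F x -> y
    being established for all y and not only for fibrant ones
    ([strong_quillen_equivalence_comp]). *)

Set Implicit Arguments.
Unset Strict Implicit.
Unset Printing Implicit Defensive.
#[local] Obligation Tactic := intros.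

Import GRing.Theory.

(** * Adjunctions and universal arrows *)

Section UniversalArrows.
Variables (C D : category) (G : functor D C).

Definition universal (x : C) (y : D) (u : hom x (G y)) :=
  forall z (g : hom x (G z)),
    exists2 h : hom y z, compm (fmap G h) u = g &
      forall h' : hom y z, compm (fmap G h') u = g -> h' = h.

Lemma universal_inj x y (u : hom x (G y)) z (h h' : hom y z) :
  universal u -> compm (fmap G h) u = compm (fmap G h') u -> h = h'.
Proof. by move=> hu e; have [k _ hk] := hu _ (compm (fmap G h') u); rewrite (hk h e) -(hk h'). Qed.

Lemma adjunction_of_unit (F : functor C D) (u : forall x, hom x (G (F x))) :
  (forall x x' (f : hom x x'), compm (fmap G (fmap F f)) (u x) = compm (u x') f) ->
  (forall x, universal (u x)) ->
  adjunction F G.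
Proof.
move=> un uu.
refine (@Adjunction C D F G (fun x y f => compm (fmap G f) (u x)) _ _ _).
- move=> x y.
  pose g (k : hom x (G y)) := sval (cid2 (uu x y k)).
  have gK k : compm (fmap G (g k)) (u x) = k by rewrite /g; case: cid2.
  by exists g => // f; apply: (universal_inj (uu x)); rewrite gK.
- by move=> x x' y f g; rewrite fmapM -compmA un compmA.
- by move=> x y y' h g; rewrite fmapM compmA.
Qed.

(** Universality forces the action of the left adjoint on morphisms. *)
Lemma left_adjoint_of_universal :
  (forall x, exists y (u : hom x (G y)), universal u) ->
  exists F : functor C D, inhabited (adjunction F G).
Proof.
move=> hu.
pose ob x := sval (cid (hu x)).
pose u x : hom x (G (ob x)) := sval (cid (svalP (cid (hu x)))).
have uu x : universal (u x) := svalP (cid (svalP (cid (hu x)))).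
pose mor x x' (f : hom x x') := sval (cid2 (uu x _ (compm (u x') f))).
have morE x x' (f : hom x x') : compm (fmap G (mor x x' f)) (u x) = compm (u x') f.
  by rewrite /mor; case: cid2.
have mor1 x : mor x x (idm x) = idm (ob x).
  by apply: (universal_inj (uu x)); rewrite morE compm1 fmap1 comp1m.
have morM x y z (g : hom y z) (f : hom x y) :
    mor x z (compm g f) = compm (mor y z g) (mor x y f).
  apply: (universal_inj (uu x)).
  by rewrite morE fmapM -[RHS]compmA morE [RHS]compmA morE -compmA.
exists (@Functor C D ob mor mor1 morM).
by constructor; exact: (@adjunction_of_unit (Functor mor1 morM) u).
Qed.

Variables (F : functor C D) (a : adjunction F G).

Definition unit x : hom x (G (F x)) := adj a (idm (F x)).

Lemma adjE x y (f : hom (F x) y) : adj a f = compm (fmap G f) (unit x).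
Proof. by rewrite /unit -adj_natr compm1. Qed.

Lemma unit_nat x x' (f : hom x x') :
  compm (fmap G (fmap F f)) (unit x) = compm (unit x') f.
Proof. by rewrite -adjE /unit -adj_natl comp1m. Qed.

Lemma unit_universal x : universal (unit x).
Proof.
move=> z g; have [k ka ak] := adj_bij a x z.
exists (k g); first by rewrite -adjE ak.
by move=> h; rewrite -adjE => <-; rewrite ka.
Qed.

Lemma unit_factor x y (u : hom x (G y)) :
  universal u -> exists (h : hom y (F x)) (k : hom (F x) y),
    [/\ compm h k = idm _, compm k h = idm _ & unit x = compm (fmap G h) u].
Proof.
move=> hu; have [h he _] := hu _ (unit x); have [k ke _] := unit_universal u.
exists h, k; split=> //.
  by apply: (universal_inj (@unit_universal x)); rewrite fmapM -compmA ke he fmap1 comp1m.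
by apply: (universal_inj hu); rewrite fmapM -compmA he ke fmap1 comp1m.
Qed.
End UniversalArrows.

Lemma initial_left_adjoint (C D : category) (F : functor C D) (G : functor D C)
    (a : adjunction F G) x : initial x -> initial (F x).
Proof.
move=> hx y; have [k ka ak] := adj_bij a x y; have [f hf] := hx (G y).
by exists (k f) => g; apply: (bij_inj (adj_bij a x y)); rewrite ak; exact: hf.
Qed.

Section ComposeAdjunctions.
Variables (C D E : category).
Variables (F : functor C D) (G : functor D C) (F' : functor D E) (G' : functor E D).

Definition comp_adjunction (a : adjunction F G) (a' : adjunction F' G') :
  adjunction (compF F' F) (compF G G').
Proof.
refine (@Adjunction C E (compF F' F) (compF G G') (fun x y f => adj a (adj a' f)) _ _ _).
- by move=> x y; exact: bij_comp (adj_bij a _ _) (adj_bij a' _ _).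
- by move=> x x' y f g; rewrite /= adj_natl adj_natl.
- by move=> x y y' h g; rewrite /= adj_natr adj_natr.
Defined.

Definition id_adjunction : adjunction (idF C) (idF C).
Proof.
refine (@Adjunction C C (idF C) (idF C) (fun x y f => f) _ _ _) => //.
by move=> x y; exists id.
Defined.
End ComposeAdjunctions.

(** * Iterated functors *)

Lemma functor_eq (C D : category) (ob : C -> D)
    (mor : forall x y : C, hom x y -> hom (ob x) (ob y)) m1 m1' mM mM' :
  @Functor C D ob mor m1 mM = @Functor C D ob mor m1' mM'.
Proof. by rewrite (Prop_irrelevance m1 m1') (Prop_irrelevance mM mM'). Qed.

Lemma compFA (C D E B : category) (H : functor E B) (G : functor D E) (F : functor C D) :
  compF H (compF G F) = compF (compF H G) F.
Proof. exact: functor_eq. Qed.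

Lemma compF1 (C D : category) (F : functor C D) : compF F (idF C) = F.
Proof. by case: F => ob mor m1 mM; exact: functor_eq. Qed.

Lemma comp1F (C D : category) (F : functor C D) : compF (idF D) F = F.
Proof. by case: F => ob mor m1 mM; exact: functor_eq. Qed.

(** The right adjoint of a composite of n copies of F is composed in the opposite
    order, so the outermost factor has to be moved to the innermost place. *)
Lemma iterFS (C : category) (F : functor C C) n :
  iterF F n.+1 = compF (iterF F n) F.
Proof.
elim: n => [|n IH]; first by rewrite /= compF1 comp1F.
exact: etrans (congr1 (compF F) IH) (compFA _ _ _).
Qed.

(** * Quillen equivalences *)

Section ModelStructure.
Variables (C : category) (M : model_structure C).

(** The retract argument: in a factorization of f through a cofibration i, a
    lift of f against the second factor makes f a retract of i. *)
Lemma cof_of_lifts x y (f : hom x y) :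
  (forall a b (p : hom a b), fib M p -> weq M p -> lifts f p) -> cof M f.
Proof.
move=> hf; have [z [i [p [e ci fp wp]]]] := factor_cof_tfib M f.
have [h [h1 h2]] := hf _ _ p fp wp i (idm y) (etrans (esym e) (esym (comp1m f))).
apply: (cof_retract _ ci); exists (idm x), (idm x), h, p.
by split; rewrite ?comp1m ?compm1.
Qed.

Lemma tcof_of_lifts x y (f : hom x y) :
  (forall a b (p : hom a b), fib M p -> lifts f p) -> cof M f /\ weq M f.
Proof.
move=> hf; have [z [i [p [e ci wi fp]]]] := factor_tcof_fib M f.
have [h [h1 h2]] := hf _ _ p fp i (idm y) (etrans (esym e) (esym (comp1m f))).
have r : retract_of f i.
  exists (idm x), (idm x), h, p; by split; rewrite ?comp1m ?compm1.
by split; [exact: (cof_retract r) | exact: (weq_retract r)].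
Qed.

Lemma weq_id x : weq M (idm x).
Proof.
have [z [i [p [e _ _ wp]]]] := factor_cof_tfib M (idm x).
apply: (weq_retract _ wp); exists i, p, (idm x), (idm x).
by split; rewrite ?compm1 ?comp1m.
Qed.

Lemma weq_iso x y (f : hom x y) (g : hom y x) :
  compm g f = idm x -> compm f g = idm y -> weq M f.
Proof.
move=> gf fg; apply: (weq_retract _ (weq_id x)).
exists (idm x), (idm x), g, f; by split; rewrite ?compm1 ?comp1m.
Qed.

Lemma cofibrant_lift x y (p : hom y x) :
  cofibrant M x -> fib M p -> weq M p -> exists s, compm p s = idm x.
Proof.
move=> [i hi [f cf]] fp wp; have [u _] := hi y.
have [h [_ hh]] : exists h, compm h f = u /\ compm p h = idm x.
  apply: (cof_lift cf fp wp).
  by have [k hk] := hi x; rewrite (hk (compm p u)) (hk (compm _ f)).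
by exists h.
Qed.
End ModelStructure.

Section QuillenCriterion.
Variables (C D : category) (M : model_structure C) (N : model_structure D).
Variables (F : functor C D) (G : functor D C).

(** Here y is arbitrary, whereas in a Quillen equivalence it is fibrant. The condition
    composes without any knowledge of how right adjoints act on fibrant objects. *)
Definition strong_quillen_equivalence (a : adjunction F G) :=
  left_quillen M N F /\
  forall x y (f : hom (F x) y), cofibrant M x -> (weq N f <-> weq M (adj a f)).

Lemma left_quillen_of_right (a : adjunction F G) :
  (forall x y (p : hom x y), fib N p -> fib M (fmap G p)) ->
  (forall x y (p : hom x y), weq N p -> weq M (fmap G p)) ->
  left_quillen M N F.
Proof.
move=> Gfib Gweq.
have tr x y (i : hom x y) b c (p : hom b c) : lifts i (fmap G p) -> lifts (fmap F i) p.
  move=> hl u v e.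
  have [|h [h1 h2]] := hl (adj a u) (adj a v); first by rewrite -adj_natr e adj_natl.
  have [k ka ak] := adj_bij a y b.
  exists (k h); split; apply: (bij_inj (adj_bij a _ _)).
    by rewrite adj_natl ak.
  by rewrite adj_natr ak.
split=> x y i ci.
  apply: cof_of_lifts => b c p fp wp; apply: tr.
  exact: cof_lift ci (Gfib _ _ _ fp) (Gweq _ _ _ wp).
by move=> wi; apply: tcof_of_lifts => b c p fp; apply: tr; exact: tcof_lift ci wi (Gfib _ _ _ fp).
Qed.

(** The two units at x differ by an automorphism of F x, which is a weak equivalence. *)
Lemma strong_quillen_equivalence_indep (a a' : adjunction F G) :
  strong_quillen_equivalence a -> strong_quillen_equivalence a'.
Proof.
move=> [lq he]; split=> // x y f cx.
have [h [k [hk kh e]]] := unit_factor a' (unit_universal a (x := x)).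
have -> : adj a' f = adj a (compm f h) by rewrite !adjE e fmapM compmA.
have wh : weq N h := weq_iso N kh hk.
rewrite -he //; split=> [wf|]; [exact: weq_comp | exact: weq_cancelr].
Qed.

Lemma quillen_equivalence_of_strong (a : adjunction F G) :
  strong_quillen_equivalence a -> quillen_equivalence M N F G.
Proof.
move=> ha; split; first by constructor.
move=> a'; have [lq he] := strong_quillen_equivalence_indep a' ha.
by split=> // x y f cx _; exact: he.
Qed.

(** Let x be cofibrant and z -> x the given weak equivalence, factored as a trivial
    cofibration z -> m followed by a trivial fibration m -> x. The unit at z is a weak
    equivalence; so is the one at m, because G F sends the trivial cofibration
    z -> m to a weak equivalence; so is the one at x, because x is a retract of m. *)
Lemma quillen_equivalence_criterion (a : adjunction F G) :
  (forall x y (p : hom x y), fib N p -> fib M (fmap G p)) ->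
  (forall x y (p : hom x y), weq N p <-> weq M (fmap G p)) ->
  (forall x, exists z (h : hom z x) y (u : hom z (G y)),
     [/\ weq M h, universal u & weq M u]) ->
  strong_quillen_equivalence a.
Proof.
move=> Gfib Gweq hz.
have lq : left_quillen M N F.
  by apply: (left_quillen_of_right a) => // x y p /Gweq.
split=> // x y f cx; rewrite adjE Gweq.
suff ux : weq M (unit a x) by split; [exact: weq_comp | exact: weq_cancelr].
have [z [h [b [u [wh uu wu]]]]] := hz x.
have [k [k' [kk kk' ez]]] := unit_factor a uu.
have wz : weq M (unit a z).
  rewrite ez; apply: weq_comp => //; apply/Gweq; exact: weq_iso kk' kk.
have [m [i [p [e ci wi fp]]]] := factor_tcof_fib M h.
have wp : weq M p by apply: (weq_cancelr wi); rewrite -e.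
have wm : weq M (unit a m).
  apply: (weq_cancelr wi); rewrite -unit_nat; apply: weq_comp => //.
  by apply/Gweq; have [_ /(_ _ _ i ci wi) []] := lq.
have [s ps] := cofibrant_lift cx fp wp.
apply: (weq_retract _ wm); exists s, p, (fmap G (fmap F s)), (fmap G (fmap F p)).
by split; rewrite ?unit_nat // -!fmapM ps !fmap1.
Qed.
End QuillenCriterion.

Lemma strong_quillen_equivalence_id (C : category) (M : model_structure C) :
  strong_quillen_equivalence M M (id_adjunction C).
Proof. by split; first by split. Qed.

Lemma strong_quillen_equivalence_comp (C D E : category) (M : model_structure C)
    (N : model_structure D) (O : model_structure E)
    (F : functor C D) (G : functor D C) (F' : functor D E) (G' : functor E D)
    (a : adjunction F G) (a' : adjunction F' G') :
  strong_quillen_equivalence M N a -> strong_quillen_equivalence N O a' ->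
  strong_quillen_equivalence M O (comp_adjunction a a').
Proof.
move=> [[c1 t1] e1] [[c2 t2] e2]; split.
  split=> x y f cf; first by apply/c2/c1.
  by move=> /(t1 _ _ _ cf) [cf' wf']; exact: t2.
move=> x y f cx; rewrite e2 ?e1 //.
case: cx => i hi [g cg]; exists (F i); first exact: (initial_left_adjoint a hi).
by exists (fmap F g); exact: c1.
Qed.

Section IteratedEquivalence.
Variables (C : category) (M : nat -> model_structure C) (F G : functor C C).
Variable a : adjunction F G.

Lemma quillen_equivalence_iter_up r :
  (forall t, strong_quillen_equivalence (M t) (M t.+1) a) ->
  quillen_equivalence (M 0) (M r) (iterF F r) (iterF G r).
Proof.
move=> ha; suff [b hb] : exists b : adjunction (iterF F r) (iterF G r),
  strong_quillen_equivalence (M 0) (M r) b by exact: quillen_equivalence_of_strong hb.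
elim: r => [|r [b hb]].
  by exists (id_adjunction C); exact: (strong_quillen_equivalence_id (M 0)).
rewrite (iterFS G); exists (comp_adjunction b a).
exact: (strong_quillen_equivalence_comp hb (ha r)).
Qed.

Lemma quillen_equivalence_iter_down r :
  (forall t, strong_quillen_equivalence (M t.+1) (M t) a) ->
  quillen_equivalence (M r) (M 0) (iterF F r) (iterF G r).
Proof.
move=> ha; suff [b hb] : exists b : adjunction (iterF F r) (iterF G r),
  strong_quillen_equivalence (M r) (M 0) b by exact: quillen_equivalence_of_strong hb.
elim: r => [|r [b hb]].
  by exists (id_adjunction C); exact: (strong_quillen_equivalence_id (M 0)).
rewrite (iterFS F); exists (comp_adjunction a b).
exact: (strong_quillen_equivalence_comp (ha r) hb).
Qed.
End IteratedEquivalence.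

Local Open Scope ring_scope.

Arguments hcl {R r A p n}.
Arguments ephi {R} _ {i p n} : rename.
Arguments lw {R k} _ {i p n} : rename.
Arguments ls {R k} _ {i p n p' n'} ep en : rename.
Arguments gcast {R} A {p n p' n'} ep en : simpl never.

(** * Homology in terms of elements *)

Section HomologyElements.
Variable R : comPzRingType.
Implicit Types (r : nat) (p n : int).

Lemma represents_of_cycle r (A : bcomplex R r) p n (a : A p n) :
  is_cycle a -> exists h, represents h a.
Proof.
move=> ha; exists (hcl (msub (S := cycles A p n) ha)).
by exists (msub (S := cycles A p n) ha).
Qed.

Lemma representsB r (A : bcomplex R r) p n (h h' : homology A p n) a a' :
  represents h a -> represents h' a' -> represents (h - h') (a - a').
Proof.
by move=> ha hb; rewrite addrC [a - a']addrC -!scaleN1r; exact: representsZD.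
Qed.

Lemma representsP r (A : bcomplex R r) p n (h : homology A p n) a b :
  represents h a -> (represents h b <-> is_bnd (b - a)).
Proof.
move=> ha; split=> [hb|hb].
  by apply/represents0; rewrite -(subrr h); exact: representsB.
rewrite -(subrK a b) -(add0r h) -[b - a]scale1r -(scale1r 0).
by apply: representsZD => //; apply/represents0.
Qed.

Definition quasi_iso_at r (A B : bcomplex R r) (f : bhom A B) p n :=
  (forall a : A p n, is_cycle a -> is_bnd (f p n a) -> is_bnd a) /\
  (forall b : B p n, is_cycle b -> exists2 a : A p n, is_cycle a & is_bnd (b - f p n a)).

Lemma quasi_isoP r (A B : bcomplex R r) (f : bhom A B) :
  quasi_iso f <-> forall p n, quasi_iso_at f p n.
Proof.
split=> [hf p n|hf p n]; last first.
  have [finj fsurj] := hf p n.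
  have inj : injective (Hmap f p n).
    move=> h h' e; apply/eqP; rewrite -subr_eq0; apply/eqP.
    have [a ha] := represents_ex (h - h').
    have hfa := Hmap_represents f ha.
    rewrite linearB e subrr in hfa.
    apply: (represents_uniq ha); apply/represents0.
    by apply: finj; [exact: represents_cycle ha | apply/represents0].
  have surj h : exists k, Hmap f p n k = h.
    have [b hb] := represents_ex h.
    have [a /represents_of_cycle [k hk] hba] := fsurj b (represents_cycle hb).
    exists k; apply: (represents_uniq (Hmap_represents f hk)).
    apply/(representsP _ hb); rewrite -opprB -[- _]addr0 -scaleN1r.
    by apply: bndZD => //; exact: bnd0.
  exists (fun h => sval (cid (surj h))) => [k|h]; last by case: cid.
  by apply: inj; case: cid.
have [k kf fk] := hf p n; split=> [a ca|b cb].
  have [h ha] := represents_of_cycle ca => /represents0 hb.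
  apply/represents0; suff -> : 0 = h by [].
  apply: (bij_inj (hf p n)); rewrite linear0.
  exact: represents_uniq hb (Hmap_represents f ha).
have [h hb] := represents_of_cycle cb.
have [a ha] := represents_ex (k h).
have := Hmap_represents f ha; rewrite fk => hfa.
by exists a; [exact: represents_cycle ha | apply/(representsP _ hfa)].
Qed.

Lemma quasi_iso_bij r (A B : bcomplex R r) (f : bhom A B) :
  (forall p n, injective (f p n)) -> surjective f -> quasi_iso f.
Proof.
move=> finj fsurj; apply/quasi_isoP => p n; split=> [a _|b cb].
  move=> [p0 [n0 [ep [en [y hy]]]]]; have [x hx] := fsurj _ _ y.
  exists p0, n0, ep, en, x; apply: finj.
  by rewrite bfun_d hx.
have [a ha] := fsurj _ _ b; exists a.
  by rewrite /is_cycle; apply: finj; rewrite bfun_d ha linear0.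
by rewrite ha subrr; exact: bnd0.
Qed.
End HomologyElements.

(** * Transport along equations between bidegrees *)

Section Casts.
Variable R : comPzRingType.
Implicit Types (r k : nat).

(** Bidegrees such as 2 * p - (2 * p - n) and n are equal without being convertible.
    All structure maps commute with the resulting transports, because the transports
    are identities once the equations between variables are substituted. *)
Lemma bdiff_gcast r (A : bcomplex R r) (p n p' n' q m q' m' : int)
    (e1 : p = q) (e2 : n = m) (e1' : p' = q') (e2' : n' = m')
    (ep : p' = p - r%:Z) (en : n' = n + 1 - r%:Z)
    (eq : q' = q - r%:Z) (em : m' = m + 1 - r%:Z) x :
  bdiff A eq em (gcast A e1 e2 x) = gcast A e1' e2' (bdiff A ep en x).
Proof.
by subst q m q' m'; rewrite !gcast_id (Prop_irrelevance eq ep) (Prop_irrelevance em en).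
Qed.

Lemma bfun_gcast r (A B : bcomplex R r) (f : bhom A B) (p n q m : int)
    (e1 : p = q) (e2 : n = m) x :
  f q m (gcast A e1 e2 x) = gcast B e1 e2 (f p n x).
Proof. by subst; rewrite !gcast_id. Qed.

Lemma represents_gcast r r' (A : bcomplex R r) (B : bcomplex R r')
    (phi : forall p n : int, {linear A p n -> homology B p n}) (p n q m : int)
    (e1 : p = q) (e2 : n = m) x b :
  represents (phi p n x) b -> represents (phi q m (gcast A e1 e2 x)) (gcast B e1 e2 b).
Proof. by subst; rewrite !gcast_id. Qed.

Lemma lw_gcast k (L : lwb R k) i (p n q m : int) (e1 : p = q) (e2 : n = m)
    (x : L i.+1 p n) :
  lw L (gcast (L i.+1) e1 e2 x) = gcast (L i) e1 e2 (lw L x).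
Proof. by subst; rewrite !gcast_id. Qed.

Lemma ls_gcast k (L : lwb R k) i (p n p' n' q m q' m' : int) (e1 : p = q) (e2 : n = m)
    (e1' : p' = q') (e2' : n' = m') (ep : p' = p + 1) (en : n' = n + 1)
    (eq : q' = q + 1) (em : m' = m + 1) (x : L i p n) :
  ls L eq em (gcast (L i) e1 e2 x) = gcast (L i.+1) e1' e2' (ls L ep en x).
Proof.
by subst q m q' m'; rewrite !gcast_id (Prop_irrelevance eq ep) (Prop_irrelevance em en).
Qed.

Lemma gcast_irr (A : bimod R) (p n q m : int) (e1 f1 : p = q) (e2 f2 : n = m) x :
  gcast A e1 e2 x = gcast A f1 f2 x.
Proof. by rewrite (Prop_irrelevance e1 f1) (Prop_irrelevance e2 f2). Qed.

Lemma gcastK (A : bimod R) (p n q m : int) (e1 : p = q) (e2 : n = m)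
    (e1' : q = p) (e2' : m = n) : cancel (gcast A e1 e2) (gcast A e1' e2').
Proof. by move=> x; subst; rewrite !gcast_id. Qed.

Lemma gcast_inj (A : bimod R) (p n q m : int) (e1 : p = q) (e2 : n = m) :
  injective (gcast A e1 e2).
Proof. exact: can_inj (gcastK e1 e2 (esym e1) (esym e2)). Qed.
End Casts.

(** * Translation of complexes *)

Section Translation.
Variables (R : comPzRingType) (r : nat).
Implicit Types (A : bcomplex R r) (B : bcomplex R r.+1) (p n : int).

Lemma dblK p n : n = 2 * p - (2 * p - n). Proof. lia. Qed.

Lemma gcast_T A (p n q m : int) (e1 : p = q) (e2 : n = m) (x : Tcx A p n) :
  gcast (Tcx A) e1 e2 x = gcast A e2 (f_equal2 (fun a b => 2 * a - b) e2 e1) x :> A m (2 * m - q).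
Proof. by subst; rewrite !gcast_id. Qed.

Lemma gcast_Tinv B (p n q m : int) (e1 : p = q) (e2 : n = m) (x : Tinvcx B p n) :
  gcast (Tinvcx B) e1 e2 x =
    gcast B (f_equal2 (fun a b => 2 * a - b) e1 e2) e1 x :> B (2 * q - m) q.
Proof. by subst; rewrite !gcast_id. Qed.

(** T and its inverse cancel only up to transport of the bidegree. *)
Program Definition T_unit A : bhom A (Tinvcx (Tcx A)) :=
  @BHom R r A (Tinvcx (Tcx A)) (fun p n => gcast A erefl (dblK p n)) _.
Next Obligation. by rewrite /=; symmetry; apply: bdiff_gcast. Qed.

Program Definition Tinv_unit B : bhom B (Tcx (Tinvcx B)) :=
  @BHom R r.+1 B (Tcx (Tinvcx B)) (fun p n => gcast B (dblK n p) erefl) _.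
Next Obligation. by rewrite /=; symmetry; apply: bdiff_gcast. Qed.

Program Definition T_transpose A B (f : bhom A (Tinvcx B)) : bhom (Tcx A) B :=
  @BHom R r.+1 (Tcx A) B
    (fun p n => lincomp (gcast B (esym (dblK n p)) erefl) (f n (2 * n - p))) _.
Next Obligation. by rewrite /= bfun_d; symmetry; apply: bdiff_gcast. Qed.

Program Definition Tinv_transpose A B (f : bhom B (Tcx A)) : bhom (Tinvcx B) A :=
  @BHom R r (Tinvcx B) A
    (fun p n => lincomp (gcast A erefl (esym (dblK p n))) (f (2 * p - n) p)) _.
Next Obligation. by rewrite /= bfun_d; symmetry; apply: bdiff_gcast. Qed.

Lemma T_transposeK A B (f : bhom A (Tinvcx B)) p n x :
  T_transpose f (2 * p - n) p (T_unit A p n x) = f p n x.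
Proof.
by rewrite /= bfun_gcast gcast_Tinv; exact: gcastK.
Qed.

Lemma Tinv_transposeK A B (f : bhom B (Tcx A)) p n x :
  Tinv_transpose f n (2 * n - p) (Tinv_unit B p n x) = f p n x.
Proof.
by rewrite /= bfun_gcast gcast_T; exact: gcastK.
Qed.

(** Every bidegree (p, n) has the form (2 * q - m, q). *)
Lemma T_bhom_ext A (B : bcomplex R r.+1) (f g : bhom (Tcx A) B) :
  (forall p n x, f (2 * p - n) p x = g (2 * p - n) p x) -> f = g.
Proof.
move=> e; apply: bhom_ext => p n.
by have [m ->] : exists m, p = 2 * n - m; [exists (2 * n - p); lia | exact: e].
Qed.

Lemma Tinv_bhom_ext (A : bcomplex R r) B (f g : bhom (Tinvcx B) A) :
  (forall p n x, f n (2 * n - p) x = g n (2 * n - p) x) -> f = g.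
Proof.
move=> e; apply: bhom_ext => p n.
by have [m ->] : exists m, n = 2 * p - m; [exists (2 * p - n); lia | exact: e].
Qed.

Lemma gcast_surj (A : bimod R) (p n q m : int) (e1 : p = q) (e2 : n = m) y :
  exists x, gcast A e1 e2 x = y.
Proof. by exists (gcast A (esym e1) (esym e2) y); exact: gcastK. Qed.

Lemma T_unit_universal A : @universal _ _ (Tinv R r) A (Tcx A) (T_unit A).
Proof.
move=> B g; exists (T_transpose g); first by apply: bhom_ext => p n x; exact: T_transposeK.
move=> h e; apply: T_bhom_ext => p n x.
have [y <-] := gcast_surj erefl (dblK p n) (x : A _ _).
by apply: etrans (esym (T_transposeK g y)); rewrite -e.
Qed.

Lemma Tinv_unit_universal B : @universal _ _ (T R r) B (Tinvcx B) (Tinv_unit B).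
Proof.
move=> A g; exists (Tinv_transpose g); first by apply: bhom_ext => p n x; exact: Tinv_transposeK.
move=> h e; apply: Tinv_bhom_ext => p n x.
have [y <-] := gcast_surj (dblK n p) erefl (x : B _ _).
by apply: etrans (esym (Tinv_transposeK g y)); rewrite -e.
Qed.

Definition T_adjunction : adjunction (T R r) (Tinv R r).
Proof.
refine (@adjunction_of_unit (bC R r) (bC R r.+1) (Tinv R r) (T R r) (fun x => T_unit x) _
  T_unit_universal).
by move=> A B f; apply: bhom_ext => p n x; rewrite /= bfun_gcast.
Qed.

Definition Tinv_adjunction : adjunction (Tinv R r) (T R r).
Proof.
refine (@adjunction_of_unit (bC R r.+1) (bC R r) (T R r) (Tinv R r) (fun x => Tinv_unit x) _
  Tinv_unit_universal).
by move=> A B f; apply: bhom_ext => p n x; rewrite /= bfun_gcast.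
Qed.

Lemma T_unit_quasi_iso A : quasi_iso (T_unit A).
Proof.
by apply: quasi_iso_bij => p n; [exact: gcast_inj | exact: (gcast_surj erefl (dblK p n))].
Qed.

Lemma Tinv_unit_quasi_iso B : quasi_iso (Tinv_unit B).
Proof.
by apply: quasi_iso_bij => p n; [exact: gcast_inj | exact: (gcast_surj (dblK n p) erefl)].
Qed.

Lemma T_cycleE A p n (x : A n (2 * n - p)) :
  is_cycle (x : Tcx A p n) <-> is_cycle x.
Proof. by split=> [h|]; [exact: ((cycleP x _ _).2 h) | exact: Tcx_cycle]. Qed.

Lemma T_bndE A p n (x : A n (2 * n - p)) :
  is_bnd (x : Tcx A p n) <-> is_bnd x.
Proof.
split=> [[p0 [n0 [ep [en [y <-]]]]]|]; last exact: Tcx_bnd.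
by exists n0, (2 * n0 - p0); do 2!eexists; exists y.
Qed.

Lemma Tinv_cycleE B p n (x : B (2 * p - n) p) :
  is_cycle (x : Tinvcx B p n) <-> is_cycle x.
Proof. by split=> [h|]; [exact: ((cycleP x _ _).2 h) | exact: Tinvcx_cycle]. Qed.

Lemma Tinv_bndE B p n (x : B (2 * p - n) p) :
  is_bnd (x : Tinvcx B p n) <-> is_bnd x.
Proof.
split=> [[p0 [n0 [ep [en [y <-]]]]]|]; last exact: Tinvcx_bnd.
by exists (2 * p0 - n0), p0; do 2!eexists; exists y.
Qed.

Lemma T_quasi_iso A (A' : bcomplex R r) (f : bhom A A') :
  quasi_iso (Tcx_hom f) <-> quasi_iso f.
Proof.
have E p n : quasi_iso_at (Tcx_hom f) p n <-> quasi_iso_at f n (2 * n - p).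
  split=> -[fi fs]; split=> [a|b].
  - by move=> ca ba; apply/T_bndE/fi; [exact/T_cycleE | exact/T_bndE].
  - by move=> /T_cycleE /fs [a /T_cycleE ca /T_bndE ba]; exists a.
  - by move=> /T_cycleE ca /T_bndE ba; apply/T_bndE/fi.
  - by move=> /T_cycleE /fs [a ca ba]; exists a; [exact/T_cycleE | exact/T_bndE].
rewrite !quasi_isoP; split=> h p n; last exact/E/h.
by rewrite (dblK p n); exact/E/h.
Qed.

Lemma Tinv_quasi_iso B (B' : bcomplex R r.+1) (f : bhom B B') :
  quasi_iso (Tinvcx_hom f) <-> quasi_iso f.
Proof.
have E p n : quasi_iso_at (Tinvcx_hom f) p n <-> quasi_iso_at f (2 * p - n) p.
  split=> -[fi fs]; split=> [a|b].
  - by move=> ca ba; apply/Tinv_bndE/fi; [exact/Tinv_cycleE | exact/Tinv_bndE].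
  - by move=> /Tinv_cycleE /fs [a /Tinv_cycleE ca /Tinv_bndE ba]; exists a.
  - by move=> /Tinv_cycleE ca /Tinv_bndE ba; apply/Tinv_bndE/fi.
  - by move=> /Tinv_cycleE /fs [a ca ba]; exists a; [exact/Tinv_cycleE | exact/Tinv_bndE].
rewrite !quasi_isoP; split=> h p n; last exact/E/h.
by rewrite (dblK n p); exact/E/h.
Qed.

Lemma T_surjective A (A' : bcomplex R r) (f : bhom A A') :
  surjective f -> surjective (Tcx_hom f).
Proof. by move=> h p n; exact: h. Qed.

Lemma Tinv_surjective B (B' : bcomplex R r.+1) (f : bhom B B') :
  surjective f -> surjective (Tinvcx_hom f).
Proof. by move=> h p n; exact: h. Qed.
End Translation.

(** * Translation as a Quillen equivalence *)

Section TranslationEquivalence.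
Variable R : comPzRingType.
Variable CM : forall t : nat, model_structure (bC R t).
Hypothesis hCM : forall t : nat, has_fib_weq (CM t) (@fib_bC R t) (@weq_bC R t).

Lemma fibC t (A B : bcomplex R t) (f : bhom A B) :
  fib (CM t) (f : hom (A : bC R t) (B : bC R t)) <-> surjective f.
Proof. exact: (hCM f).1. Qed.

Lemma weqC t (A B : bcomplex R t) (f : bhom A B) :
  weq (CM t) (f : hom (A : bC R t) (B : bC R t)) <-> quasi_iso f.
Proof. exact: (hCM f).2. Qed.

Lemma T_strong r : strong_quillen_equivalence (CM r) (CM r.+1) (T_adjunction R r).
Proof.
apply: quillen_equivalence_criterion => [A B f|A B f|A].
- by move=> /fibC h; apply/fibC/Tinv_surjective.
- by rewrite (weqC f) (weqC (Tinvcx_hom f)) Tinv_quasi_iso.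
exists A, (idm A), (Tcx A), (T_unit A).
by split; [exact: weq_id | exact: T_unit_universal | exact/weqC/T_unit_quasi_iso].
Qed.

Lemma Tinv_strong r : strong_quillen_equivalence (CM r.+1) (CM r) (Tinv_adjunction R r).
Proof.
apply: quillen_equivalence_criterion => [A B f|A B f|B].
- by move=> /fibC h; apply/fibC/T_surjective.
- by rewrite (weqC f) (weqC (Tcx_hom f)) T_quasi_iso.
exists B, (idm B), (Tinvcx B), (Tinv_unit B).
by split; [exact: weq_id | exact: Tinv_unit_universal | exact/weqC/Tinv_unit_quasi_iso].
Qed.

Lemma Titer_quillen_equivalence r :
  quillen_equivalence (CM 0) (CM r) (Titer R r) (Tinviter R r).
Proof.
suff [b hb] : exists b : adjunction (Titer R r) (Tinviter R r),
  strong_quillen_equivalence (CM 0) (CM r) b by exact: quillen_equivalence_of_strong hb.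
elim: r => [|r [b hb]].
  by exists (id_adjunction _); exact: (strong_quillen_equivalence_id (CM 0)).
exists (comp_adjunction b (T_adjunction R r)).
exact: (strong_quillen_equivalence_comp hb (T_strong r)).
Qed.

Lemma Tinviter_quillen_equivalence r :
  quillen_equivalence (CM r) (CM 0) (Tinviter R r) (Titer R r).
Proof.
suff [b hb] : exists b : adjunction (Tinviter R r) (Titer R r),
  strong_quillen_equivalence (CM r) (CM 0) b by exact: quillen_equivalence_of_strong hb.
elim: r => [|r [b hb]].
  by exists (id_adjunction _); exact: (strong_quillen_equivalence_id (CM 0)).
exists (comp_adjunction (Tinv_adjunction R r) b).
exact: (strong_quillen_equivalence_comp (Tinv_strong r) hb).
Qed.
End TranslationEquivalence.

(** * Prolongation of linear witness books *)

Section Prolongation.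
Variable R : comPzRingType.

Notation up := (compF (Ftr R) (TL R 0)).
Notation down := (compF (TLinv R 0) (Utr R)).

Program Definition prolong_unit (L : lwb R 0) : lwbhom L (down (up L) : lwb R 0) :=
  @LwbHom R 0 L (down (up L) : lwb R 0) (fun i => T_unit (L i)) _ _.
Next Obligation. by rewrite /= lw_gcast. Qed.
Next Obligation. by rewrite /=; symmetry; apply: ls_gcast. Qed.

Section Transpose.
Variables (L M : lwb R 0) (g : lwbhom L (down M : lwb R 0)).

Let g1 i : bhom (Tcx (L i)) (M i.+1) := T_transpose (lfun g i).

(** On page 0 there is no choice: w_1 is the identity of the prolonged book, so a map
    out of it is determined there by its value on page 1. It commutes with the zero
    differential because the image of w consists of cycles. *)
Program Definition prolong_bottom : bhom (zero_cx 0 (Tcx (L 0))) (M 0) :=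
  @BHom R 0 (zero_cx 0 (Tcx (L 0))) (M 0) (fun p n => lincomp (lw M) (g1 0 p n)) _.
Next Obligation. by rewrite linear0; symmetry; apply/(cycleP _ ep en)/lw_cycle. Qed.

Definition prolong_page i : bhom (Ftr_page (Tlwb L) i) (M i) :=
  if i is j.+1 then g1 j else prolong_bottom.

Lemma transpose_lw i p n (x : Tcx (L i.+1) p n) :
  g1 i p n (lw L x) = lw M (g1 i.+1 p n x).
Proof.
exact: etrans (congr1 (gcast (M i.+1) _ _) (lfun_w g x)) (esym (lw_gcast (L := M) _ _ _)).
Qed.

Lemma transpose_ls i p n p' n' (ep : p' = p + 1) (en : n' = n + 1) (x : Tcx (L i) p n) :
  g1 i.+1 p' n' (ls (Tlwb L) ep en x) = ls M ep en (g1 i p n x).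
Proof.
apply: etrans (congr1 (gcast (M i.+2) _ _) (lfun_s g _ _ x)) _.
by symmetry; apply: ls_gcast.
Qed.

Program Definition prolong_transpose : lwbhom (up L : lwb R 0) M :=
  @LwbHom R 0 (up L : lwb R 0) M prolong_page _ _.
Next Obligation. by case: i x => [|i] x //; exact: transpose_lw. Qed.
Next Obligation.
case: i x => [|i] x; last exact: transpose_ls.
by rewrite [RHS]lsw; exact: linear0.
Qed.
End Transpose.

Lemma prolong_unit_universal L : @universal _ _ down L (up L) (prolong_unit L).
Proof.
move=> M g; exists (prolong_transpose g).
  by apply: lwbhom_ext => i p n x; exact: T_transposeK.
move=> h e.
have E i : (lfun h i.+1 : bhom (Tcx (L i)) (M i.+1)) = T_transpose (lfun g i).
  apply: T_bhom_ext => p n x.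
  have [y <-] := gcast_surj erefl (dblK p n) (x : L i _ _).
  by apply: etrans (esym (T_transposeK (lfun g i) y)); rewrite -e.
apply: lwbhom_ext => -[|i] p n x; last exact: (congr1 (fun f : bhom _ _ => f p n x) (E i)).
have := @lfun_w _ _ _ _ h 0 p n x; rewrite [lfun h 1]E; exact.
Qed.

Definition prolong_adjunction : adjunction up down.
Proof.
refine (@adjunction_of_unit (LWB R) (LWB R) down up (fun x => prolong_unit x) _
  prolong_unit_universal).
by move=> L M f; apply: lwbhom_ext => i p n x; rewrite /= bfun_gcast.
Qed.

Variable LM : forall t : nat, model_structure (LWB R).
Hypothesis hLM : forall t : nat, has_fib_weq (LM t) (@fib_LWB R t) (@weq_LWB R t).

Lemma fibL t (L M : LWB R) (f : hom L M) :
  fib (LM t) f <-> forall i, (i <= t)%N -> surjective (lfun f i).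
Proof. exact: (hLM t f).1. Qed.

Lemma weqL t (L M : LWB R) (f : hom L M) :
  weq (LM t) f <-> quasi_iso (lfun f t).
Proof. exact: (hLM t f).2. Qed.

Lemma prolong_strong r : strong_quillen_equivalence (LM r) (LM r.+1) prolong_adjunction.
Proof.
apply: quillen_equivalence_criterion => [L M f|L M f|L].
- by move=> /fibL h; apply/fibL => i hi; apply/Tinv_surjective/h.
- by rewrite !weqL; split=> /Tinv_quasi_iso.
exists L, (idm L), (up L), (prolong_unit L).
by split; [exact: weq_id | exact: prolong_unit_universal | exact/weqL/T_unit_quasi_iso].
Qed.
End Prolongation.

(** * The free witness book on a complex *)

Section Cokernel.
Variables (R : comPzRingType) (r : nat) (A : bcomplex R r).

Program Definition bnd_sub p n : submodule (A p n) := @Submodule R (A p n) (@is_bnd R r A p n) _ _.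
Next Obligation. exact: bnd0. Qed.
Next Obligation. exact: bndZD. Qed.

Definition coker : bimod R := fun p n => quotm (bnd_sub p n).
Definition coker_pi p n : {linear A p n -> coker p n} := qpi (bnd_sub p n).

Lemma coker_pi_surj p n (c : coker p n) : exists x, coker_pi p n x = c.
Proof. exact: qpi_surj. Qed.

Lemma coker_pi_bnd p n x : is_bnd x -> coker_pi p n x = 0.
Proof. by move=> h; apply/qpi_eq0. Qed.

Section CokerDiff.
Variables (p n p' n' : int) (ep : p' = p - r%:Z) (en : n' = n + 1 - r%:Z).

Lemma bdiff_bnd x : bnd_sub p n x -> bdiff A ep en x = 0.
Proof. by move=> /bnd_cycle /(cycleP x ep en). Qed.

Definition coker_d : {linear coker p n -> A p' n'} := qlift bdiff_bnd.

Lemma coker_dE x : coker_d (coker_pi p n x) = bdiff A ep en x.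
Proof. exact: qliftE. Qed.
End CokerDiff.
End Cokernel.
Arguments coker_d {R r A p n p' n'} ep en.

Section LinearPairs.
Variables (R : comPzRingType) (U V W : lmodType R).

Definition linpair (f : {linear U -> V}) (g : {linear U -> W}) : {linear U -> (V * W)%type} :=
  mklin (f := fun x => (f x, g x)) (fun a u v => congr2 pair (linearP f a u v) (linearP g a u v)).

Definition linfst : {linear (V * W)%type -> V} := mklin (f := fst) (fun a u v => erefl).
Definition linsnd : {linear (V * W)%type -> W} := mklin (f := snd) (fun a u v => erefl).

Lemma linadd_subproof (f g : {linear U -> V}) : linear (fun x => f x + g x).
Proof. by move=> a u v; rewrite !linearP scalerDr addrACA. Qed.
Definition linadd (f g : {linear U -> V}) : {linear U -> V} := mklin (linadd_subproof f g).
End LinearPairs.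
Arguments linfst {R V W}.
Arguments linsnd {R V W}.

Section FreeBook.
Variables (R : comPzRingType) (A : bcomplex R 0).

Section Page.
Variable i : nat.

(** An element (a, b) of page i.+1 stands for s^(i.+1) a + d s^(i.+1) b. Both are
    taken modulo boundaries of A, since s_0 d_0 = s_0 w_1 d_1 s_0 = 0. The
    bidegrees are those that a and b must have for the two terms to lie in (p, n);
    that of b is the same on all pages. *)
Definition free_mod p n : lmodType R :=
  (coker A (p - i.+1%:Z) (n - i.+1%:Z) * coker A p (n - 1))%type.

Lemma free_dn (n n' : int) : n' = n + 1 - i.+1%:Z -> n - i.+1%:Z = n' - 1.
Proof. lia. Qed.

Definition free_d p n p' n' (ep : p' = p - i.+1%:Z) (en : n' = n + 1 - i.+1%:Z) :
    {linear free_mod p n -> free_mod p' n'} :=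
  linpair (lin0 _ _) (lincomp (gcast (coker A) (esym ep) (free_dn en)) linfst).

Program Definition free_succ : bcomplex R i.+1 := @BComplex R i.+1 free_mod free_d _.
Next Obligation. by congr pair; exact: linear0. Qed.
End Page.

Definition free_page i : bcomplex R (0 + i)%N := if i is j.+1 then free_succ j else A.

Lemma free_wp (p : int) : p = p - (0 : nat)%:Z. Proof. lia. Qed.
Lemma free_wn (n : int) : n = n - 1 + 1 - (0 : nat)%:Z. Proof. lia. Qed.

Definition free_w i p n : {linear free_page i.+1 p n -> free_page i p n} :=
  if i is j.+1 then linpair (lin0 _ _) linsnd
  else lincomp (coker_d (free_wp p) (free_wn n)) linsnd.

Lemma free_s0 (p p' : int) : p' = p + 1 -> p = p' - 1%N%:Z. Proof. lia. Qed.
Lemma free_sj j (p p' : int) : p' = p + 1 -> p - j.+1%:Z = p' - j.+2%:Z. Proof. lia. Qed.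

Definition free_s i p n p' n' : p' = p + 1 -> n' = n + 1 ->
    {linear free_page i p n -> free_page i.+1 p' n'} :=
  if i is j.+1 then fun ep en =>
    linpair (lincomp (gcast (coker A) (free_sj j ep) (free_sj j en)) linfst) (lin0 _ _)
  else fun ep en =>
    linpair (lincomp (gcast (coker A) (free_s0 ep) (free_s0 en)) (coker_pi A p n)) (lin0 _ _).

Lemma coker_d_gcast r (B : bcomplex R r) (p n q m p' n' : int) (e1 : p = q) (e2 : n = m)
    (ep : p' = q - r%:Z) (en : n' = m + 1 - r%:Z)
    (ep' : p' = p - r%:Z) (en' : n' = n + 1 - r%:Z) (c : coker B p n) :
  coker_d ep en (gcast (coker B) e1 e2 c) = coker_d ep' en' c.
Proof.
by subst q m; rewrite gcast_id (Prop_irrelevance ep ep') (Prop_irrelevance en en').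
Qed.

Program Definition free_book : lwb R 0 := @Lwb R 0 free_page free_w free_s _ _ _.
Next Obligation.
case: i x => [|i] x; last by [].
exact: (linear0 (coker_d (free_wp p') (free_wn n'))).
Qed.
Next Obligation.
case: i x => [|i] [c1 c2]; congr pair; try exact: linear0.
have [a <-] := coker_pi_surj c2.
apply: etrans (congr1 (lincomp (gcast _ _ _) (coker_pi A p n)) (coker_dE _ _ a)) _.
apply: etrans (congr1 (gcast _ _ _) (coker_pi_bnd _)) (linear0 _).
by do 4!eexists; exists a.
Qed.
Next Obligation.
case: i ep' en' ep'' en'' x => [|i] ep' en' ep'' en'' x; last first.
  by congr pair; symmetry; exact: gcast_comp.
apply: esym; apply: etrans (congr1 (coker_d _ _) (gcast_comp _ _ _ _ _ _ _)) _.
- lia.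
- lia.
move=> e1 e2.
by apply: etrans (coker_d_gcast _ _ _ _ ep'' en'' _) (coker_dE _ _ _).
Qed.
End FreeBook.

(** From d_i = w d_(i+1) s and s w = 0. *)
Lemma sd0 (R : comPzRingType) (k : nat) (L : lwb R k) i (p n p1 n1 p2 n2 : int)
    (ep : p1 = p - (k + i)%N%:Z) (en : n1 = n + 1 - (k + i)%N%:Z)
    (ep' : p2 = p1 + 1) (en' : n2 = n1 + 1) (x : L i p n) :
  ls L ep' en' (bdiff (L i) ep en x) = 0.
Proof.
have e1 : p1 = p + 1 - (k + i.+1)%N%:Z by lia.
have e2 : n1 = n + 1 + 1 - (k + i.+1)%N%:Z by lia.
by rewrite (ldE erefl erefl e1 e2) lsw.
Qed.

Section FreeBookUniversal.
Variables (R : comPzRingType) (A : bcomplex R 0) (L : lwb R 0) (g : bhom A (L 0)).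

Lemma addz0 (p p' : int) : p' = p + 0%N%:Z -> p = p'. Proof. lia. Qed.
Lemma addzS j (p p' : int) : p' = p + j.+1%:Z -> p' = p + j%:Z + 1. Proof. lia. Qed.

(** These are forced: a morphism that extends g sends s^j a to s^j g a. *)
Fixpoint siter j p n : forall p' n', p' = p + j%:Z -> n' = n + j%:Z ->
    {linear A p n -> L j p' n'} :=
  if j is k.+1 return forall p' n', p' = p + j%:Z -> n' = n + j%:Z -> {linear A p n -> L j p' n'}
  then fun p' n' ep en => lincomp (ls L (addzS ep) (addzS en)) (@siter k p n _ _ erefl erefl)
  else fun p' n' ep en => lincomp (gcast (L 0) (addz0 ep) (addz0 en)) (g p n).

Lemma siter_s j (p n p1 n1 p2 n2 : int) (ep1 : p1 = p + j%:Z) (en1 : n1 = n + j%:Z)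
    (ep : p2 = p1 + 1) (en : n2 = n1 + 1) (ep2 : p2 = p + j.+1%:Z) (en2 : n2 = n + j.+1%:Z) a :
  ls L ep en (siter ep1 en1 a) = siter ep2 en2 a.
Proof.
subst p1 n1 => /=; rewrite (Prop_irrelevance ep (addzS ep2)).
by rewrite (Prop_irrelevance en (addzS en2)).
Qed.

Lemma siter1 (p n p' n' : int) (ep : p' = p + 1%N%:Z) (en : n' = n + 1%N%:Z)
    (ep' : p' = p + 1) (en' : n' = n + 1) a :
  siter ep en a = ls L ep' en' (g p n a).
Proof.
apply: etrans (ls_gcast (L := L) _ _ erefl erefl ep' en' _ _ _) _.
by rewrite gcast_id.
Qed.

Lemma siter_bnd j p n p' n' (ep : p' = p + j.+1%:Z) (en : n' = n + j.+1%:Z) a :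
  bnd_sub A p n a -> siter ep en a = 0.
Proof.
move=> [p0 [n0 [e1 [e2 [x <-]]]]].
elim: j p' n' ep en => [|j IH] p' n' ep en; last first.
  by apply: etrans (congr1 (ls L _ _) (IH _ _ _ _)) (linear0 _).
have e3 : p + 0%N%:Z = p0 - 0%N%:Z by lia.
have e4 : n + 0%N%:Z = n0 + 1 - 0%N%:Z by lia.
rewrite /= bfun_d -(@bdiff_gcast R 0 (L 0) _ _ _ _ _ _ _ _ erefl erefl _ _ _ _ e3 e4).
exact: sd0.
Qed.

Definition sbar j p n p' n' (ep : p' = p + j.+1%:Z) (en : n' = n + j.+1%:Z) :
    {linear coker A p n -> L j.+1 p' n'} :=
  qlift (fun a => @siter_bnd j p n p' n' ep en a).

Lemma sbarE j p n p' n' (ep : p' = p + j.+1%:Z) (en : n' = n + j.+1%:Z) a :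
  sbar ep en (coker_pi A p n a) = siter ep en a.
Proof. exact: qliftE. Qed.

Lemma sbar_gcast j (p n q m p' n' : int) (e1 : p = q) (e2 : n = m)
    (ep : p' = q + j.+1%:Z) (en : n' = m + j.+1%:Z)
    (ep' : p' = p + j.+1%:Z) (en' : n' = n + j.+1%:Z) (c : coker A p n) :
  sbar ep en (gcast (coker A) e1 e2 c) = sbar ep' en' c.
Proof.
by subst q m; rewrite gcast_id (Prop_irrelevance ep ep') (Prop_irrelevance en en').
Qed.

Lemma sbar_s j (p n p1 n1 p2 n2 : int) (ep1 : p1 = p + j.+1%:Z) (en1 : n1 = n + j.+1%:Z)
    (ep : p2 = p1 + 1) (en : n2 = n1 + 1) (ep2 : p2 = p + j.+2%:Z) (en2 : n2 = n + j.+2%:Z) c :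
  ls L ep en (sbar ep1 en1 c) = sbar ep2 en2 c.
Proof.
have [a <-] := coker_pi_surj c.
apply: etrans (congr1 (ls L ep en) (sbarE ep1 en1 a)) _.
by apply: etrans (siter_s ep1 en1 ep en ep2 en2 a) (esym (sbarE _ _ _)).
Qed.

Lemma lw_sbar j p n p' n' (ep : p' = p + j.+1%:Z) (en : n' = n + j.+1%:Z) c :
  lw L (sbar ep en c) = 0.
Proof.
have [a <-] := coker_pi_surj c.
apply: etrans (congr1 (lw L) (sbarE ep en a)) _; exact: lws.
Qed.

Lemma lw_d_siter j (p n p1 n1 p2 n2 : int) (ep1 : p1 = p + j.+1%:Z) (en1 : n1 = n + j.+1%:Z)
    (ep : p2 = p1 - j.+1%:Z) (en : n2 = n1 + 1 - j.+1%:Z)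
    (e1 : p2 = p + j%:Z - j%:Z) (e2 : n2 = n + j%:Z + 1 - j%:Z) a :
  lw L (bdiff (L j.+1 : bcomplex R j.+1) ep en (siter ep1 en1 a)) =
  bdiff (L j : bcomplex R j) e1 e2 (@siter j p n _ _ erefl erefl a).
Proof. symmetry; exact: (@ldE R 0 L j). Qed.

Lemma subzK (p : int) j : p = p - j.+1%:Z + j.+1%:Z. Proof. lia. Qed.
Lemma addzK (p : int) j : p = p + j.+1%:Z - j.+1%:Z. Proof. lia. Qed.
Lemma addzK1 (n : int) j : n = n - 1 + j.+1%:Z + 1 - j.+1%:Z. Proof. lia. Qed.

Definition free_ext_succ j p n : {linear free_mod A j p n -> L j.+1 p n} :=
  linadd (lincomp (sbar (subzK p j) (subzK n j)) linfst)
   (lincomp (bdiff (L j.+1 : bcomplex R j.+1) (addzK p j) (addzK1 n j))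
     (lincomp (sbar erefl erefl) linsnd)).

Lemma free_ext_succE j p n c1 c2 : free_ext_succ j p n (c1, c2) =
  sbar (subzK p j) (subzK n j) c1 +
  bdiff (L j.+1 : bcomplex R j.+1) (addzK p j) (addzK1 n j) (sbar erefl erefl c2).
Proof. by []. Qed.

Lemma free_ext_succ_fst j p n c1 : free_ext_succ j p n (c1, 0) = sbar (subzK p j) (subzK n j) c1.
Proof.
rewrite free_ext_succE (linear0 (sbar (erefl (p + j.+1%:Z)) (erefl (n - 1 + j.+1%:Z)))).
by rewrite linear0 addr0.
Qed.

Lemma free_ext_succ_snd j p n c2 p0 n0 (ep : p0 = p + j.+1%:Z) (en : n0 = n - 1 + j.+1%:Z)
   (ep' : p = p0 - j.+1%:Z) (en' : n = n0 + 1 - j.+1%:Z) : free_ext_succ j p n (0, c2) =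
  bdiff (L j.+1 : bcomplex R j.+1) ep' en' (sbar ep en c2).
Proof.
rewrite free_ext_succE linear0 add0r; subst p0 n0.
by rewrite (Prop_irrelevance ep' (addzK p j)) (Prop_irrelevance en' (addzK1 n j)).
Qed.

Program Definition free_ext_succ_hom j : bhom (free_succ A j) (L j.+1 : bcomplex R j.+1) :=
  @BHom R j.+1 (free_succ A j) (L j.+1 : bcomplex R j.+1) (free_ext_succ j) _.
Next Obligation.
case: x => c1 c2; have e1 : p = p' + j.+1%:Z by lia.
have e2 : n = n' - 1 + j.+1%:Z by lia.
apply: etrans (free_ext_succ_snd (gcast (coker A) (esym ep) (free_dn en) c1) e1 e2 ep en) _.
rewrite free_ext_succE linearD bdiffK addr0; congr (bdiff _ _ _ _).
exact: sbar_gcast.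
Qed.

Definition free_ext_page j : bhom (free_page A j) (L j) :=
  if j is i.+1 then free_ext_succ_hom i else g.

Program Definition free_ext : lwbhom (free_book A) L :=
  @LwbHom R 0 (free_book A) L free_ext_page _ _.
Next Obligation.
case: i x => [|i] [c1 c2].
  rewrite [RHS](congr1 (lw L) (free_ext_succE _ _)) linearD lw_sbar add0r.
  have [a <-] := coker_pi_surj c2; rewrite [RHS](congr1 _ (congr1 _ (sbarE _ _ _))).
  have e1 : p = p + 0%N%:Z - 0%N%:Z by lia.
  have e2 : n = n - 1 + 0%N%:Z + 1 - 0%N%:Z by lia.
  rewrite (lw_d_siter _ _ _ _ e1 e2).
  rewrite [RHS](bdiff_gcast (A := L 0 : bcomplex R 0) _ _ erefl erefl (free_wp p) (free_wn n)).
  apply: etrans (congr1 (g p n) (coker_dE _ _ a)) _; exact: bfun_d.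
rewrite [RHS](congr1 (lw L) (free_ext_succE _ _)) linearD lw_sbar add0r.
apply: etrans (free_ext_succ_snd c2 erefl erefl (addzK p i) (addzK1 n i)) _.
have [a <-] := coker_pi_surj c2; rewrite [RHS](congr1 _ (congr1 _ (sbarE _ _ _))).
rewrite (lw_d_siter _ _ _ _ (addzK p i) (addzK1 n i)); congr (bdiff _ _ _ _).
exact: sbarE.
Qed.
Next Obligation.
case: i x => [|i] x.
  apply: etrans (free_ext_succ_fst _) _.
  apply: etrans (sbar_gcast _ _ _ _ ep en _) _.
  by apply: etrans (sbarE _ _ _) (siter1 _ _ _ _ _).
case: x => c1 c2; apply: etrans (free_ext_succ_fst _) _.
rewrite [RHS](congr1 (ls L _ _) (free_ext_succE _ _)) linearD sd0 addr0.
have e1 : p' = p - i.+1%:Z + i.+2%:Z by lia.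
have e2 : n' = n - i.+1%:Z + i.+2%:Z by lia.
exact: etrans (sbar_gcast _ _ _ _ e1 e2 _) (esym (sbar_s _ _ _ _ _ _ _)).
Qed.

(** Every element of page j.+1 is s^(j.+1) a + d s^(j.+1) b, and h commutes with s
    and d. *)
Lemma free_ext_unique (h : lwbhom (free_book A) L) : lfun h 0 = g -> h = free_ext.
Proof.
move=> h0.
(* The elements (c1, 0) of page j.+2 are the images under s of such elements of page
   j.+1; the elements (0, c2) are their differentials. *)
have h_fst j p n c1 : lfun h j.+1 p n (c1, 0) = sbar (subzK p j) (subzK n j) c1.
  elim: j p n c1 => [|j IH] p n c1.
    have [a <-] := coker_pi_surj c1.
    have ep : p = p - 1%N%:Z + 1 by lia.
    have en : n = n - 1%N%:Z + 1 by lia.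
    have -> : (coker_pi A (p - 1%N%:Z) (n - 1%N%:Z) a, 0) = ls (free_book A) (i := 0) ep en a.
      by congr pair; symmetry; exact: gcast_id.
    rewrite lfun_s; apply: etrans (congr1 (ls L ep en) _) _.
      exact: (congr1 (fun k : bhom A (L 0) => k _ _ a) h0).
    by apply: esym; apply: etrans (sbarE _ _ _) (siter1 _ _ _ _ _).
  have ep : p = p - 1 + 1 by lia.
  have en : n = n - 1 + 1 by lia.
  have e1 : p - j.+2%:Z = p - 1 - j.+1%:Z by lia.
  have e2 : n - j.+2%:Z = n - 1 - j.+1%:Z by lia.
  have -> : (c1, 0) = ls (free_book A) (i := j.+1) ep en (gcast (coker A) e1 e2 c1, 0).
    by congr pair; symmetry; exact: gcastK.
  have e3 : p - 1 = p - j.+2%:Z + j.+1%:Z by lia.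
  have e4 : n - 1 = n - j.+2%:Z + j.+1%:Z by lia.
  rewrite lfun_s IH.
  exact: etrans (congr1 (ls L ep en) (sbar_gcast _ _ _ _ e3 e4 _)) (sbar_s _ _ _ _ _ _ _).
apply: lwbhom_ext => -[|j] p n x; first by rewrite h0.
case: x => c1 c2.
have ep := addzK p j; have en := addzK1 n j.
set p0 := p + _ in ep; set n0 := n - 1 + _ in en.
have e1 : p = p0 - j.+1%:Z by lia.
have e2 : n - 1 = n0 - j.+1%:Z by lia.
have -> : (c1, c2) = (c1, 0) + bdiff (free_succ A j) ep en (gcast (coker A) e1 e2 c2, 0).
  by congr pair; rewrite ?addr0 // [RHS]add0r; symmetry; exact: gcastK.
rewrite !linearD h_fst; congr (_ + _); first by rewrite [RHS]free_ext_succ_fst.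
rewrite (bfun_d (lfun h j.+1 : bhom (free_succ A j) (L j.+1 : bcomplex R j.+1))).
rewrite (bfun_d (lfun free_ext j.+1 : bhom (free_succ A j) (L j.+1 : bcomplex R j.+1))).
by congr (bdiff _ _ _ _); rewrite h_fst [RHS]free_ext_succ_fst.
Qed.
End FreeBookUniversal.

Lemma free_book_universal (R : comPzRingType) (A : bcomplex R 0) :
  @universal _ _ (Upage R 0) A (free_book A) (bid A).
Proof.
move=> L g; exists (free_ext g); first by apply: bhom_ext.
move=> h e; apply: free_ext_unique; rewrite -e; exact: bhom_ext.
Qed.

(** * Free witness books on a complex placed at an arbitrary page *)

Section FreeAtPage.
Variable R : comPzRingType.

Lemma quasi_iso_comp r (A B C : bcomplex R r) (g : bhom B C) (f : bhom A B) :
  quasi_iso g -> quasi_iso f -> quasi_iso (bcomp g f).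
Proof.
move=> hg hf p n; apply: (eq_bij (bij_comp (hg p n) (hf p n))) => h.
by rewrite [RHS]Hmap_comp.
Qed.

Lemma quasi_iso_id r (A : bcomplex R r) : quasi_iso (bid A).
Proof. by apply: quasi_iso_bij => [p n x y|p n y]; last exists y. Qed.

Lemma Tinv_faithful r (A B : bcomplex R r.+1) (f g : bhom A B) :
  Tinvcx_hom f = Tinvcx_hom g -> f = g.
Proof.
move=> e; apply: bhom_ext => p n.
have [m ->] : exists m, p = 2 * n - m by exists (2 * n - p); lia.
by move=> x; exact: (congr1 (fun h : bhom (Tinvcx A) (Tinvcx B) => h n m x) e).
Qed.

Lemma Tinv_Tinv_unit r (B : bcomplex R r.+1) :
  Tinvcx_hom (Tinv_unit B) = T_unit (Tinvcx B).
Proof.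
apply: bhom_ext => p n x; have E := gcast_Tinv (erefl p) (dblK p n) (x : Tinvcx B p n).
apply: esym; apply: etrans E _.
exact: gcast_irr.
Qed.

(** Quantifying over i with i.+1 = t makes the condition on s_(t-1) empty for t = 0. *)
Definition structure_maps_vanish (L : lwb R 0) t :=
  forall i, i.+1 = t -> forall p n p' n' (ep : p' = p + 1) (en : n' = n + 1) (x : L i p n),
    ls L ep en x = 0.

(** Page t.+1 of a book translated and prolonged from L is the translate of L_t.
    Since translation is invertible on complexes, a universal arrow for page t gives
    one for page t.+1, by the adjunction between prolongation and truncation. *)
Lemma free_at_page t (A : bcomplex R t) : exists (L : lwb R 0) (u : bhom A (L t)),
  [/\ @universal _ _ (Upage R t) A L u, quasi_iso u & structure_maps_vanish L t].
Proof.
elim: t A => [|t IH] A.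
  exists (free_book A), (bid A); split=> //; first exact: free_book_universal.
  exact: quasi_iso_id.
have [L [u [uu wu vL]]] := IH (Tinvcx A).
exists (Ftr_ob (Tlwb L)), (bcomp (Tcx_hom u) (Tinv_unit A)); split; last first.
- case: t IH A u uu wu vL => [|t] IH A u uu wu vL i [->] // p n p' n' ep en x.
  exact: vL.
- by apply: quasi_iso_comp; [exact/T_quasi_iso | exact: Tinv_unit_quasi_iso].
move=> N g.
(* On page t.+1 a map h out of the prolonged book extends g iff, translated back and
   restricted to L, it extends the translate of g. *)
have tr (h : lwbhom (Ftr_ob (Tlwb L)) N) :
    bcomp (lfun h t.+1 : bhom (Tcx (L t)) (N t.+1)) (bcomp (Tcx_hom u) (Tinv_unit A)) = g <->
    bcomp (bcomp (Tinvcx_hom (lfun h t.+1 : bhom (Tcx (L t)) (N t.+1))) (T_unit (L t))) u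
      = Tinvcx_hom g.
  have E : bcomp (bcomp (Tinvcx_hom (lfun h t.+1 : bhom (Tcx (L t)) (N t.+1))) (T_unit (L t))) u =
      Tinvcx_hom (bcomp (lfun h t.+1 : bhom (Tcx (L t)) (N t.+1))
        (bcomp (Tcx_hom u) (Tinv_unit A))).
    have <- : bcomp (Tinvcx_hom (lfun h t.+1 : bhom (Tcx (L t)) (N t.+1)))
       (bcomp (Tinvcx_hom (Tcx_hom u)) (Tinvcx_hom (Tinv_unit A))) =
      Tinvcx_hom (bcomp (lfun h t.+1 : bhom (Tcx (L t)) (N t.+1))
        (bcomp (Tcx_hom u) (Tinv_unit A))) by exact: bhom_ext.
    by rewrite Tinv_Tinv_unit; apply: bhom_ext => p n x; rewrite /= bfun_gcast.
  by rewrite E; split=> [->|/Tinv_faithful].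
pose N' : lwb R 0 := Tinvlwb (Utr_ob N).
have [k ku uk] := uu N' (Tinvcx_hom g).
have [h hu uh] := @prolong_unit_universal R L N k.
exists h; first by apply/tr; rewrite -ku -hu.
move=> h' /tr e; apply: uh; apply: uk; exact: e.
Qed.

Variable CM : forall t : nat, model_structure (bC R t).
Variable LM : forall t : nat, model_structure (LWB R).
Hypothesis hCM : forall t : nat, has_fib_weq (CM t) (@fib_bC R t) (@weq_bC R t).
Hypothesis hLM : forall t : nat, has_fib_weq (LM t) (@fib_LWB R t) (@weq_LWB R t).

Lemma Upage_left_adjoint t :
  exists F : functor (bC R t) (LWB R), inhabited (adjunction F (Upage R t)).
Proof.
apply: left_adjoint_of_universal => A; have [L [u [uu _ _]]] := free_at_page A.
by exists L, u.
Qed.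

Lemma Upage_strong t (F : functor (bC R t) (LWB R)) (a : adjunction F (Upage R t)) :
  strong_quillen_equivalence (CM t) (LM t) a.
Proof.
apply: quillen_equivalence_criterion => [L M f|L M f|A].
- by move=> /(fibL hLM) h; apply/(fibC hCM)/h.
- by rewrite (weqL hLM) (weqC hCM).
have [L [u [uu wu _]]] := free_at_page A.
exists A, (idm A), L, u; split=> //; [exact: weq_id | exact/(weqC hCM)].
Qed.
End FreeAtPage.

(** * Witnesses and the nerve *)

Section Witnesses.
Variable R : comPzRingType.
Implicit Types (X Y : ess R).

Lemma esshom_of_represents X Y (f : forall i, bhom (X i) (Y i)) :
  (forall i p n (x : X i.+1 p n), exists2 a,
     represents (ephi X x) a & represents (ephi Y (f i.+1 p n x)) (f i p n a)) ->
  forall i p n (x : X i.+1 p n), ephi Y (f i.+1 p n x) = Hmap (f i) p n (ephi X x).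
Proof.
move=> h i p n x; have [a ha hfa] := h i p n x.
exact: represents_uniq hfa (Hmap_represents (f i) ha).
Qed.

Lemma esshom_represents X Y (f : esshom X Y) i p n (x : X i.+1 p n) a :
  represents (ephi X x) a -> represents (ephi Y (f i.+1 p n x)) (f i p n a).
Proof. by rewrite efun_phi; exact: Hmap_represents. Qed.

(** Witnesses are built downwards from the top page: each characteristic map gives a
    homology class one page below, in which a representative is chosen. *)
Lemma descending_choice X p n (P : forall i, X i p n -> Prop) r (x : X r p n) :
  (forall i (y : X i.+1 p n), (i < r)%N -> P i.+1 y ->
     exists2 a, represents (ephi X y) a & P i a) ->
  P r x ->
  exists y : forall i, X i p n, [/\ y r = x, forall i, (i <= r)%N -> P i (y i) &
    forall i, (i < r)%N -> represents (ephi X (y i.+1)) (y i)].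
Proof.
elim: r x => [|r IH] x hP Px.
  exists (dfwith (fun i => 0 : X i p n) x); split=> //; first exact: dfwith_in.
  by move=> i; rewrite leqn0 => /eqP ->; rewrite dfwith_in.
have [a ha Pa] := hP r x (ltnSn r) Px.
have [|y [ya Py hy]] := IH a _ Pa; first by move=> i y hi; apply: hP; exact: leqW.
have yE i : (i <= r)%N -> dfwith y x i = y i by move=> hi; rewrite dfwith_out // gtn_eqF.
exists (dfwith y x); split=> [|i|i]; first exact: dfwith_in.
  rewrite leq_eqVlt => /orP[/eqP -> |hi]; first by rewrite dfwith_in.
  by rewrite yE //; exact: Py.
rewrite ltnS leq_eqVlt => /orP[/eqP -> |hi]; first by rewrite dfwith_in yE // ya.
by rewrite !yE ?(ltnW hi) //; exact: hy.
Qed.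

Definition tuple_of X p n (y : forall i, X i p n) r : wtuple X r p n := fun i => y i.
Arguments tuple_of {X p n} y r i.

Lemma witness_ex X r p n (x : X r p n) : exists2 y, witness y & wtop (y : wtuple X r p n) = x.
Proof.
have [i y _ _|//|y [yx _ hy]] := @descending_choice X p n (fun _ _ => True) r x.
  by have [a ha] := represents_ex (ephi X y); exists a.
by exists (tuple_of y r) => // i hi; exact: hy.
Qed.

(** A representative is corrected by the lift of a bounding chain. *)
Lemma witness_lift X Y (f : esshom X Y) r p n (y : wtuple Y r p n) (x : X r p n) :
  (forall i, (i < r)%N -> surjective (f i)) -> witness y -> f r p n x = wtop y ->
  exists x' : wtuple X r p n, [/\ witness x', wtop x' = x & wmap f r p n x' = y].
Proof.
move=> fs hy hx.
have [i z hi Pz|h|z [zx Pz hz]] := @descending_choice X p n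
    (fun i a => forall h : (i < r.+1)%N, f i p n a = y (Ordinal h)) r x.
- have hi1 : (i.+1 < r.+1)%N by [].
  have [a ha] := represents_ex (ephi X z).
  have := esshom_represents f ha; rewrite (Pz hi1) => hfa.
  have [p0 [n0 [ep [en [w hw]]]]] := (representsP _ hfa).1 (hy i hi1).
  have [v hv] := fs i hi _ _ w.
  exists (a + bdiff (X i) ep en v).
    by apply/(representsP _ ha); rewrite addrC addrA addNr add0r; exists p0, n0, ep, en, v.
  by move=> h; rewrite linearD bfun_d hv hw addrC subrK; exact: ordinal_irr.
- by rewrite hx; exact: ordinal_irr.
exists (tuple_of z r); split=> //.
by apply: dprod_ext => -[i h]; exact: Pz.
Qed.

Definition mk_nerve X r p n (x : wtuple X r p n) x' (h : is_nerve (x, x')) :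
  nerve_mod X r p n := msub (S := nerve_sub X r p n) h.

Lemma nerve_eq X r p n (u v : nerve_mod X r p n) :
  (mval u).1 = (mval v).1 -> (mval u).2 = (mval v).2 -> u = v.
Proof.
move=> e1 e2; apply: mval_inj; rewrite [LHS]surjective_pairing [RHS]surjective_pairing.
exact: congr2 e1 e2.
Qed.

Lemma nerve_map_surjective X Y (f : esshom X Y) r :
  (forall i, (i <= r)%N -> surjective (f i)) -> surjective (nerve_map_bhom f r).
Proof.
move=> fs p n v; have [h1 h2 h3] := nerveP v.
have [x hx] := fs r (leqnn r) p n (wtop (mval v).1).
have fs' i : (i < r)%N -> surjective (f i) by move=> hi; exact/fs/ltnW.
have [y [hy yx fy]] := witness_lift fs' h1 hx.
have hdx : f r _ _ (bdiff (X r) erefl erefl x) = wtop (mval v).2 by rewrite bfun_d hx.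
have [z [hz zx fz]] := witness_lift fs' h2 hdx.
have hu : is_nerve (y, z) by split=> //=; rewrite yx zx.
by exists (mk_nerve hu); apply: nerve_eq; [exact: fy | exact: fz].
Qed.

(** A cycle of the nerve has the form (x; 0). If the top of x is d y, a tuple z of
    witnesses of y gives the element (z; x), whose differential is (x; 0). *)
Lemma rho_quasi_iso X r : quasi_iso (rho X r).
Proof.
apply/quasi_isoP => p n; split=> [u cu|b cb]; last first.
  have [y hy yb] := witness_ex b.
  have hu : is_nerve (y, 0 : wtuple X r _ _).
    by split=> //=; [exact: witness0 | rewrite yb; exact: cb].
  exists (mk_nerve hu); last by rewrite [rho _ _ _ _ _]yb subrr; exact: bnd0.
  by apply: nerve_eq => //; apply: dprod_ext => i; exact: linear0.
move=> [p0 [n0 [ep [en [y hy]]]]].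
have u2 : (mval u).2 = 0.
  have := congr1 (fun v => (mval v).1) cu => /= e.
  by apply: dprod_ext => i; exact: (congr1 (fun x : wtuple X r _ _ => x i) e).
have [z hz zy] := witness_ex y; have [h1 _ _] := nerveP u.
subst p n.
have hv : is_nerve (z, (mval u).1) by split=> //=; rewrite zy.
exists p0, n0, erefl, erefl, (mk_nerve hv); apply: nerve_eq; last by rewrite u2.
exact: dprod_ext.
Qed.

Lemma rho_nat X Y (f : esshom X Y) r :
  bcomp (f r) (rho X r) = bcomp (rho Y r) (nerve_map_bhom f r).
Proof. exact: bhom_ext. Qed.

Section IntoNerve.
Variables (X : ess R) (r : nat) (A : bcomplex R r).

Section Build.
Variable k : forall p n, {linear A p n -> wtuple X r p n}.
Hypothesis kw : forall p n x, witness (k p n x).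
Hypothesis kd : forall p n x,
  wtop (k _ _ (bdiff A (erefl (p - r%:Z)) (erefl (n + 1 - r%:Z)) x)) =
  bdiff (X r) erefl erefl (wtop (k p n x)).

Definition into_nerve_fun p n : {linear A p n -> nerve_amb X r p n} :=
  linpair (k p n) (lincomp (k _ _) (bdiff A erefl erefl)).

Lemma into_nerveP p n x : is_nerve (into_nerve_fun p n x).
Proof. by split; [exact: kw | exact: kw | rewrite -kd]. Qed.

Program Definition into_nerve : bhom A (nerve_cx X r) :=
  @BHom R r A (nerve_cx X r)
    (fun p n => sublift (S := nerve_sub X r p n) (@into_nerveP p n)) _.
Next Obligation.
subst p' n'; apply: nerve_eq; first exact: dprod_ext.
by apply: etrans (congr1 (k _ _) (bdiffK _ _ _ _ x)) (linear0 _).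
Qed.

End Build.

(** The second component of an element of the nerve is the first component of
    its differential. *)
Lemma into_nerve_ext (f g : bhom A (nerve_cx X r)) :
  (forall p n x, (mval (f p n x)).1 = (mval (g p n x)).1) -> f = g.
Proof.
move=> e; apply: bhom_ext => p n x; apply: nerve_eq => //.
have := e _ _ (bdiff A (erefl (p - r%:Z)) (erefl (n + 1 - r%:Z)) x).
rewrite !bfun_d => /= h; apply: dprod_ext => i.
exact: (congr1 (fun x : wtuple X r _ _ => x i) h).
Qed.
End IntoNerve.
End Witnesses.

Section NerveWeq.
Variable R : comPzRingType.
Variable CM : forall t : nat, model_structure (bC R t).
Hypothesis hCM : forall t : nat, has_fib_weq (CM t) (@fib_bC R t) (@weq_bC R t).

Lemma nerve_map_quasi_iso (X Y : ess R) (f : esshom X Y) r :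
  quasi_iso (nerve_map_bhom f r) <-> quasi_iso (f r).
Proof.
have wX := (weqC hCM _).2 (rho_quasi_iso X r).
have wY := (weqC hCM _).2 (rho_quasi_iso Y r).
have e : @compm (bC R r) _ _ _ (f r) (rho X r) =
    @compm (bC R r) _ _ _ (rho Y r) (nerve_map_bhom f r)
  := rho_nat f r.
split=> /(weqC hCM) h; apply/(weqC hCM).
  by apply: (weq_cancelr wX); rewrite e; exact: weq_comp.
by apply: (weq_cancell wY); rewrite -e; exact: weq_comp.
Qed.
End NerveWeq.

(** * The adjunction between witness books and extended spectral sequences *)

Section QuotientLift.
Variables (R : comPzRingType) (r : nat) (A B : bcomplex R r).
Variable S : forall p n, submodule (A p n).
Hypothesis Sd : forall p n p' n' (ep : p' = p - r%:Z) (en : n' = n + 1 - r%:Z) x,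
  S p n x -> S p' n' (bdiff A ep en x).
Variables (f : bhom A B) (fS : forall p n x, S p n x -> f p n x = 0).

Program Definition quot_lift : bhom (quot_cx Sd) B :=
  @BHom R r (quot_cx Sd) B (fun p n => qlift (@fS p n)) _.
Next Obligation.
have [y <-] := qpi_surj x.
rewrite -(bfun_d (quot_pi Sd)).
apply: etrans (qliftE (@fS p' n') _) _; rewrite bfun_d; congr (bdiff _ _ _ _).
exact/esym/qliftE.
Qed.

Lemma quot_liftE p n x : quot_lift p n (quot_pi Sd p n x) = f p n x.
Proof. exact: qliftE. Qed.
End QuotientLift.

Section QNerve.
Variable R : comPzRingType.

Section Unit.
Variable L : lwb R 0.

(** The family (w^r x, ..., w x, x), extended by zero above page r so that its index
    ranges over all pages. *)
Fixpoint wdown r p n : L r p n -> forall i, L i p n :=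
  if r is k.+1 then fun x => dfwith (wdown (lw L x)) x
  else fun x => dfwith (fun i => 0 : L i p n) x.

Lemma wdown_top r p n (x : L r p n) : wdown x r = x.
Proof. by case: r x => [|r] x; exact: dfwith_in. Qed.

Lemma wdown_lt r p n (x : L r.+1 p n) i : (i <= r)%N -> wdown x i = wdown (lw L x) i.
Proof. by move=> hi; rewrite /= dfwith_out // gtn_eqF. Qed.

Lemma wdown_w r p n (x : L r p n) i : (i < r)%N -> lw L (wdown x i.+1) = wdown x i.
Proof.
elim: r x => [|r IH] x //; rewrite ltnS leq_eqVlt => /orP[/eqP -> |hi].
  by rewrite wdown_top wdown_lt // wdown_top.
by rewrite !wdown_lt // ?(ltnW hi) // IH.
Qed.

Lemma wdown_linear r p n i a (x y : L r p n) :
  wdown (a *: x + y) i = a *: wdown x i + wdown y i.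
Proof.
elim: r x y => [|r IH] x y.
  have [->|i0] := eqVneq i 0%N; first by rewrite !wdown_top.
  by rewrite /= !dfwith_out 1?eq_sym // scaler0 addr0.
have [->|ir] := eqVneq i r.+1; first by rewrite !wdown_top.
by rewrite /= !dfwith_out 1?eq_sym // linearP IH.
Qed.

Lemma wdown0 r p n i : wdown (0 : L r p n) i = 0.
Proof. by have := wdown_linear i (-1) (0 : L r p n) 0; rewrite scaler0 addr0 scaleN1r addNr. Qed.

Lemma wdown_gcast r (p n q m : int) (e1 : p = q) (e2 : n = m) (x : L r p n) i :
  wdown (gcast (L r) e1 e2 x) i = gcast (L i) e1 e2 (wdown x i).
Proof. by subst; rewrite !gcast_id. Qed.

(** The first half of the unit L -> N Q L: an element x of page r is sent to the
    classes of w^r x, ..., w x, x. *)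
Definition Q_tuple_fun r p n (x : L r p n) : wtuple (Qob L) r p n :=
  fun i => Qpi L i p n (wdown x i).

Lemma Q_tuple_linear r p n : linear (@Q_tuple_fun r p n).
Proof.
move=> a x y; apply: dprod_ext => i.
exact: etrans (congr1 (Qpi L i p n) (wdown_linear i a x y)) (linearP _ _ _ _).
Qed.

Definition Q_tuple r p n : {linear L r p n -> wtuple (Qob L) r p n} :=
  mklin (@Q_tuple_linear r p n).

Lemma Q_tuple_top r p n x : wtop (Q_tuple r p n x) = Qpi L r p n x.
Proof. by have := congr1 (fun y : L r p n => Qpi L r p n y) (wdown_top x). Qed.

Lemma Q_tuple_witness r p n x : witness (Q_tuple r p n x).
Proof.
move=> i hi; have := Qphi_represents (wdown x i.+1).
by rewrite wdown_w.
Qed.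

Lemma Q_tuple_d r p n (x : L r p n) :
  wtop (Q_tuple r _ _ (bdiff (L r : bcomplex R r) (erefl (p - r%:Z)) (erefl (n + 1 - r%:Z)) x)) =
  bdiff (Qob L r) erefl erefl (wtop (Q_tuple r p n x)).
Proof. by rewrite !Q_tuple_top bfun_d. Qed.

Definition Q_unit_page r : bhom (L r : bcomplex R r) (nerve_cx (Qob L) r) :=
  into_nerve (@Q_tuple_witness r) (@Q_tuple_d r).

Lemma Qpi_s i p n (x : L i.+1 p n) : in_s x -> Qpi L i.+1 p n x = 0.
Proof.
by move=> h; apply/qpi_eq0; exists x, 0; split; [|exact: in_ds0|rewrite addr0].
Qed.

Lemma Qpi_ds i p n (x : L i.+1 p n) : in_ds x -> Qpi L i.+1 p n x = 0.
Proof.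
by move=> h; apply/qpi_eq0; exists 0, x; split; [exact: in_s0| |rewrite add0r].
Qed.

Program Definition Q_unit : lwbhom L (nerve (Qob L)) :=
  @LwbHom R 0 L (nerve (Qob L)) Q_unit_page _ _.
Next Obligation.
apply: nerve_eq.
  by apply: dprod_ext => -[j hj]; apply: (congr1 (Qpi L j p n)); rewrite [RHS]wdown_lt.
by apply: etrans (congr1 (Q_tuple i _ _) (lw_cycle x)) (linear0 _).
Qed.
Next Obligation.
have low j q m (y : L i.+1 q m) : (j < i.+2)%N -> (j != i.+1)%N -> wdown y j = wdown (lw L y) j.
  by move=> hj ji; apply: wdown_lt; rewrite -ltnS ltn_neqAle ji -ltnS.
apply: nerve_eq; apply: dprod_ext => -[j hj].
  have [e|ji] := eqVneq j i.+1.
    by subst j; apply: etrans (congr1 _ (wdown_top _)) (Qpi_s _); exists p, n, ep, en, x.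
  apply: etrans (congr1 (Qpi L j p' n') (low _ _ _ _ hj ji)) _.
  by rewrite lws wdown0; exact: linear0.
have [e|ji] := eqVneq j i.+1.
  subst j; rewrite [RHS](congr1 (gcast _ _ _) (wext_max _ _)) linear0.
  apply: etrans (congr1 _ (wdown_top _)) (Qpi_ds _).
  by exists p', n', erefl, erefl, (ls L ep en x); split=> //; exists p, n, ep, en, x.
have hj' : (j < i.+1)%N by rewrite ltn_neqAle ji -ltnS.
apply: etrans (congr1 (Qpi L j _ _) (low _ _ _ _ hj ji)) _.
rewrite [RHS](congr1 (gcast _ _ _) (wext_lt _ hj hj')).
have e1 : p' - i.+1%:Z = p - i%:Z by lia.
have e2 : n' + 1 - i.+1%:Z = n + 1 - i%:Z by lia.
rewrite -(@ldE R 0 L i p n p' n' _ _ ep en erefl erefl e1 e2 x).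
apply: esym; apply: etrans (esym (bfun_gcast (Qpi L j) _ _ _)) _; congr (Qpi L j _ _ _).
rewrite -wdown_gcast; apply: (congr1 (fun y => wdown y j)).
rewrite -(bdiff_gcast (A := L i : bcomplex R i) erefl erefl _ _ _ _ e1 e2) gcast_id //.
Qed.
End Unit.

Section Extension.
Variables (L : lwb R 0) (X : ess R) (g : lwbhom L (nerve X)).

Definition Q_ext_top r : bhom (L r : bcomplex R r) (X r) := bcomp (rho X r) (lfun g r).

Lemma Q_ext_s i p n (x : L i.+1 p n) : in_s x -> Q_ext_top i.+1 p n x = 0.
Proof.
move=> [p0 [n0 [ep [en [b ->]]]]].
exact: (congr1 (fun u : nerve_mod X i.+1 p n => wtop (mval u).1) (lfun_s g ep en b)).
Qed.

Lemma Q_ext_sds i p n (x : L i.+1 p n) : sds L i p n x -> Q_ext_top i.+1 p n x = 0.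
Proof.
move=> [y [z [hy [p0 [n0 [ep [en [u [hu ->]]]]]] ->]]].
by rewrite linearD bfun_d (Q_ext_s hy) (Q_ext_s hu) linear0 addr0.
Qed.

Definition Q_ext_page i : bhom (Qpage L i) (X i) :=
  if i is j.+1 then quot_lift (@sds_d R L j) (@Q_ext_sds j) else Q_ext_top 0.

Lemma Q_ext_pageE i p n x : Q_ext_page i p n (Qpi L i p n x) = Q_ext_top i p n x.
Proof. by case: i x => [|i] x //; exact: quot_liftE. Qed.

Lemma Q_ext_phi i p n (x : Qob L i.+1 p n) :
  ephi X (Q_ext_page i.+1 p n x) = Hmap (Q_ext_page i) p n (ephi (Qob L) x).
Proof.
apply: (esshom_of_represents (X := Qob L)) => {i p n x} i p n q.
have [x <-] := qpi_surj q.
exists (Qpi L i p n (lw L x)); first exact: (Qphi_represents x).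
rewrite (Q_ext_pageE (i := i.+1)) Q_ext_pageE.
have [hw _ _] := nerveP (lfun g i.+1 p n x).
have := hw i (ltnSn i.+1); congr (represents (ephi X _) _).
apply: etrans (esym (congr1 (fun u : nerve_mod X i p n => wtop (mval u).1) (lfun_w g x))).
exact: ordinal_irr.
Qed.

Definition Q_ext : esshom (Qob L) X := EssHom Q_ext_phi.

(** A map into a nerve commutes with w, which drops the last coordinate, so its i-th
    coordinate is the last one after going down to page i. *)
Lemma nerve_coordinate r p n (x : L r p n) i (hi : (i < r.+1)%N) :
  Q_ext_top i p n (wdown x i) = (mval (lfun g r p n x)).1 (Ordinal hi).
Proof.
elim: r x hi => [|r IH] x hi.
  have e : i = 0%N by case: i hi.
  by subst i; rewrite wdown_top; exact: ordinal_irr.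
have [e|ir] := eqVneq i r.+1; first by subst i; rewrite wdown_top; exact: ordinal_irr.
have hi' : (i < r.+1)%N by rewrite ltn_neqAle ir -ltnS.
rewrite wdown_lt // IH.
apply: etrans (congr1 (fun u : nerve_mod X r p n => (mval u).1 (Ordinal hi')) (lfun_w g x)) _.
exact: (ordinal_irr (mval (lfun g r.+1 p n x : nerve_mod X r.+1 p n)).1 _ hi).
Qed.
End Extension.

Lemma Q_unit_universal L : @universal _ _ (Nerve R) L (Qob L) (Q_unit L).
Proof.
move=> X g; exists (Q_ext g).
  apply: lwbhom_ext => r p n x.
  have e : bcomp (nerve_map_bhom (Q_ext g) r) (Q_unit_page L r) = lfun g r.
    apply: into_nerve_ext => {p n x} p n x; apply: dprod_ext => -[i hi].
    by apply: etrans (Q_ext_pageE g _) _; exact: nerve_coordinate.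
  exact: (congr1 (fun k : bhom (L r : bcomplex R r) (nerve_cx X r) => k p n x) e).
move=> h e; apply: esshom_ext => i p n q.
have [x <-] : exists x, Qpi L i p n x = q by case: i q => [|i] q; [exists q | exact: qpi_surj].
apply: esym; apply: etrans (Q_ext_pageE g x) _.
rewrite -e /=; congr (h i p n _); exact: Q_tuple_top.
Qed.

Lemma wdown_map (L M : lwb R 0) (f : lwbhom L M) r p n (x : L r p n) i :
  lfun f i p n (wdown x i) = wdown (lfun f r p n x) i.
Proof.
elim: r x => [|r IH] x.
  have [->|i0] := eqVneq i 0%N; first by rewrite !wdown_top.
  by rewrite /= !dfwith_out 1?eq_sym // linear0.
have [->|ir] := eqVneq i r.+1; first by rewrite !wdown_top.
by rewrite /= !dfwith_out 1?eq_sym // IH lfun_w.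
Qed.

Definition Q_adjunction : adjunction (Q R) (Nerve R).
Proof.
refine (@adjunction_of_unit (LWB R) (ESpSe R) (Nerve R) (Q R) (fun L => Q_unit L) _
  Q_unit_universal) => L M f.
apply: lwbhom_ext => r p n x.
have e : bcomp (nerve_map_bhom (Qhom f) r) (Q_unit_page L r) = bcomp (Q_unit_page M r) (lfun f r).
  apply: into_nerve_ext => {p n x} p n x; apply: dprod_ext => i.
  by apply: etrans (Qhom_pi f _) _; rewrite wdown_map.
exact: (congr1 (fun k : bhom (L r : bcomplex R r) (nerve_cx (Qob M) r) => k p n x) e).
Qed.

Variable CM : forall t : nat, model_structure (bC R t).
Variable LM : forall t : nat, model_structure (LWB R).
Variable EM : forall t : nat, model_structure (ESpSe R).
Hypothesis hCM : forall t : nat, has_fib_weq (CM t) (@fib_bC R t) (@weq_bC R t).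
Hypothesis hLM : forall t : nat, has_fib_weq (LM t) (@fib_LWB R t) (@weq_LWB R t).
Hypothesis hEM : forall t : nat, has_fib_weq (EM t) (@fib_ESpSe R t) (@weq_ESpSe R t).

Lemma fibE t (X Y : ESpSe R) (f : hom X Y) :
  fib (EM t) f <-> forall i, (i <= t)%N -> surjective (efun f i).
Proof. exact: (hEM t f).1. Qed.

Lemma weqE t (X Y : ESpSe R) (f : hom X Y) : weq (EM t) f <-> quasi_iso (efun f t).
Proof. exact: (hEM t f).2. Qed.

(** The projection of page t onto its quotient by s and d s is then bijective, and it
    is the unit followed by the quasi-isomorphism rho. *)
Lemma Q_unit_quasi_iso (L : lwb R 0) t :
  structure_maps_vanish L t -> quasi_iso (Q_unit_page L t).
Proof.
move=> vL; have e : bcomp (rho (Qob L) t) (Q_unit_page L t) = Qpi L t.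
  by apply: bhom_ext => p n x; exact: Q_tuple_top.
apply/(weqC hCM); apply: (weq_cancell ((weqC hCM _).2 (rho_quasi_iso (Qob L) t))).
apply/(weqC hCM); rewrite [compm _ _]e.
apply: quasi_iso_bij; last by case: t vL e => [|t] vL _ p n q; [exists q | exact: qpi_surj].
case: t vL e => [|t] vL _ p n x y // exy; apply/eqP; rewrite -subr_eq0; apply/eqP.
have s0 p0 n0 (z : L t.+1 p0 n0) : in_s z -> z = 0.
  by move=> [p1 [n1 [ep [en [b ->]]]]]; exact: vL.
have /qpi_eq0 [u [v [/s0 -> [p0 [n0 [ep [en [w [/s0 -> ->]]]]]] ->]]] :
    Qpi L t.+1 p n (x - y) = 0 by rewrite linearB exy subrr.
by rewrite linear0 addr0.
Qed.

(** The free book on L_t maps to L by the arrow h that corresponds to the identity of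
    L_t. On page t, h is a one-sided inverse of the quasi-isomorphism u. *)
Lemma Q_strong t : strong_quillen_equivalence (LM t) (EM t) Q_adjunction.
Proof.
apply: quillen_equivalence_criterion => [X Y f|X Y f|L].
- move=> /fibE h; apply/(fibL hLM) => i hi; apply: nerve_map_surjective => j hj.
  exact/h/(leq_trans hj).
- by rewrite weqE (weqL hLM) -(nerve_map_quasi_iso hCM).
have [Z [u [uu wu vZ]]] := free_at_page (L t : bcomplex R t).
have [h hu _] := uu L (bid (L t : bcomplex R t)).
exists Z, h, (Qob Z), (Q_unit Z); split.
- apply/(weqL hLM)/(weqC hCM); apply: (weq_cancelr ((weqC hCM _).2 wu)).
  by apply/(weqC hCM); move: hu => /= ->; exact: quasi_iso_id.
- exact: Q_unit_universal.
- exact/(weqL hLM)/Q_unit_quasi_iso.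
Qed.
End QNerve.

(** * Shift and decalage *)

Section RepresentTranslated.
Variable R : comPzRingType.

Lemma HT_representsE r (A : bcomplex R r) p n (h : homology A n (2 * n - p)) a :
  represents (HT A p n h) (a : Tcx A p n) <-> represents h a.
Proof.
have [b hb] := represents_ex h.
by rewrite (representsP _ (HT_represents hb)) (representsP _ hb) T_bndE.
Qed.

Lemma HTinv_representsE r (B : bcomplex R r.+1) p n (h : homology B (2 * p - n) p) b :
  represents (HTinv B p n h) (b : Tinvcx B p n) <-> represents h b.
Proof.
have [c hc] := represents_ex h.
by rewrite (representsP _ (HTinv_represents hc)) (representsP _ hc) Tinv_bndE.
Qed.

Lemma Hzero_representsE r (A : bimod R) p n (x a : A p n) :
  represents (Hzero r A p n x) a <-> a = x.
Proof.
split=> [|->]; last exact: Hzero_represents.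
rewrite (representsP _ (Hzero_represents r x)) => -[p0 [n0 [ep [en [y e]]]]].
by apply/eqP; rewrite -subr_eq0 -e.
Qed.

Lemma shift_representsE (X : ess R) i p n (x : Tcx (X i.+1) p n) (a : Tcx (X i) p n) :
  represents (ephi (shift X) (x : shift X i.+2 p n)) (a : shift X i.+1 p n)
  <-> represents (ephi X (x : X i.+1 _ _)) (a : X i _ _).
Proof. exact: HT_representsE. Qed.

Lemma dec_representsE (X : ess R) i p n (x : Tinvcx (X i.+3) p n) (a : Tinvcx (X i.+2) p n) :
  represents (ephi (dec X) (x : dec X i.+2 p n)) (a : dec X i.+1 p n)
  <-> represents (ephi X (x : X i.+3 _ _)) (a : X i.+2 _ _).
Proof. exact: HTinv_representsE. Qed.

(** Page 0 of Dec X is a translate of page 1 of the nerve, and the characteristic map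
    above it is defined through the inverse of the isomorphism that rho induces on
    homology. *)
Lemma dec0_representsE (X : ess R) p n (x : Tinvcx (X 2) p n)
    (u : Tinvcx (nerve_cx X 1) p n) : is_cycle u ->
  (represents (ephi (dec X) (x : dec X 1 p n)) (u : dec X 0 p n)
   <-> represents (ephi X (x : X 2 _ _)) (rho X 1 _ _ u)).
Proof.
move=> /Tinv_cycleE cu.
apply: (iff_trans (HTinv_representsE _ _)); split=> hu.
  by have := Hmap_represents (rho X 1) hu; rewrite lininvK.
have [h hh] := represents_of_cycle cu.
have e : lininv (@rho1_quasi_iso R X (2 * p - n) p) (ephi X (x : X 2 _ _)) = h.
  apply: (bij_inj (@rho1_quasi_iso R X (2 * p - n) p)); rewrite lininvK.
  exact: represents_uniq hu (Hmap_represents (rho X 1) hh).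
exact: (eq_ind_r (fun k => represents k (u : nerve_cx X 1 _ _)) hh e).
Qed.
End RepresentTranslated.

Section ShiftDec.
Variable R : comPzRingType.

Section Unit.
Variable X : ess R.

(** The pair (x, x), which is a witness because phi_1 is the identity on a shift. *)
Definition diag_tuple p n : {linear Tcx (X 0) p n -> wtuple (shift X) 1 p n}.
Proof.
refine (@mklin _ _ _ (fun x : Tcx (X 0) p n => @wpair _ (shift X) p n x x) _) => a x y.
by apply: dprod_ext => -[[|[|i]] hi].
Defined.

Lemma diag_tuple_witness p n x : witness (diag_tuple p n x).
Proof. apply: wpair_witness; exact: Hzero_represents. Qed.

Lemma diag_tuple_d p n (x : Tcx (X 0) p n) :
  wtop (diag_tuple _ _ (bdiff (Tcx (X 0)) (erefl (p - 1%N%:Z)) (erefl (n + 1 - 1%N%:Z)) x)) =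
  bdiff (shift X 1) erefl erefl (wtop (diag_tuple p n x)).
Proof. by []. Qed.

Definition diag : bhom (Tcx (X 0)) (nerve_cx (shift X) 1) :=
  into_nerve diag_tuple_witness diag_tuple_d.

Definition shift_unit_page i : bhom (X i) (dec (shift X) i) :=
  if i is j.+1 then T_unit (X j.+1) else bcomp (Tinvcx_hom diag) (T_unit (X 0)).

Program Definition shift_unit : esshom X (dec (shift X)) :=
  @EssHom R X (dec (shift X)) shift_unit_page _.
Next Obligation.
apply: esshom_of_represents => {i p n x} i p n x.
have [a ha] := represents_ex (ephi X x); exists a => //.
case: i x a ha => [|i] x a ha.
  apply/dec0_representsE.
    exact: (bhom_cycle (shift_unit_page 0) (represents_cycle ha)).
  apply/shift_representsE.
  exact: (represents_gcast (phi := @ephi R X 0) erefl (dblK p n) ha).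
apply/dec_representsE/shift_representsE.
exact: (represents_gcast (phi := @ephi R X i.+1) erefl (dblK p n) ha).
Qed.
End Unit.

Section Transpose.
Variables (X Y : ess R) (g : esshom X (dec Y)).

(** A map X_0 -> T^-1 N(Y)_1 amounts to a map T X_0 -> N(Y)_1. Its two
    coordinates are the components on pages 0 and 1 of the transposed map
    Shift X -> Y. *)
Definition into_nerve1 : bhom (Tcx (X 0)) (nerve_cx Y 1) := T_transpose (g 0).

Lemma into_nerve1_represents p n x :
  represents (ephi Y (rho Y 1 p n (into_nerve1 p n x))) ((mval (into_nerve1 p n x)).1 ord0).
Proof.
have [h _ _] := nerveP (into_nerve1 p n x).
have := h 0%N isT; congr (represents (ephi Y _) _); exact: ordinal_irr.
Qed.

Definition shift_ext_bottom_fun p n : {linear Tcx (X 0) p n -> Y 0 p n}.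
Proof.
refine (@mklin _ _ _ (fun x : Tcx (X 0) p n => (mval (into_nerve1 p n x)).1 ord0) _) => a x y.
by rewrite linearP.
Defined.

Program Definition shift_ext_bottom : bhom (zero_cx 0 (Tcx (X 0))) (Y 0) :=
  @BHom R 0 (zero_cx 0 (Tcx (X 0))) (Y 0) shift_ext_bottom_fun _.
Next Obligation.
rewrite [bdiff _ _ _ x]/= linear0; symmetry; apply/(cycleP _ ep en).
exact: represents_cycle (into_nerve1_represents x).
Qed.

Definition shift_ext_page i : bhom (shift X i) (Y i) :=
  match i with
  | 0 => shift_ext_bottom
  | 1 => bcomp (rho Y 1) into_nerve1
  | j.+2 => T_transpose (g j.+1)
  end.

Program Definition shift_ext : esshom (shift X) Y := @EssHom R (shift X) Y shift_ext_page _.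
Next Obligation.
apply: (esshom_of_represents (X := shift X)) => {i p n x} i p n x.
case: i x => [|i] x.
  exists x; first exact: Hzero_represents.
  exact: into_nerve1_represents.
have [a ha] := represents_ex (ephi (shift X) x); exists a => //.
case: i x a ha => [|i] x a /shift_representsE ha.
  have /dec0_representsE h : represents (ephi (dec Y) (g 1%N _ _ x)) (g 0%N _ _ a).
    exact: esshom_represents.
  have {}h := h (bhom_cycle (g 0) (represents_cycle ha)).
  have := represents_gcast (phi := @ephi R Y 1) (esym (dblK n p)) erefl h.
  by rewrite -bfun_gcast.
have /dec_representsE h : represents (ephi (dec Y) (g i.+2 _ _ x)) (g i.+1 _ _ a).
  exact: esshom_represents.
exact: (represents_gcast (phi := @ephi R Y i.+2) (esym (dblK n p)) erefl h).
Qed.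
End Transpose.

Lemma shift_unit_universal X : @universal _ _ (Dec R) X (shift X) (shift_unit X).
Proof.
move=> Y g.
(* On page 0 the condition that h extends g is transposed to the nerve. *)
have E (h : esshom (shift X) Y) :
    (forall p n x, dec_fun h 0 p n (shift_unit_page X 0 p n x) = g 0 p n x) <->
    bcomp (nerve_map_bhom h 1) (diag X) = into_nerve1 g.
  split=> [e|e p n x]; last first.
    rewrite -(T_transposeK (g 0)) -/(into_nerve1 g) -e.
    by [].
  apply: (universal_inj (@T_unit_universal R 0 (X 0))); apply: bhom_ext => p n x.
  by apply: etrans (e p n x) (esym (T_transposeK (g 0) x)).
exists (shift_ext g).
  apply: esshom_ext => -[|i] p n x; last exact: T_transposeK.
  move: p n x; apply/E; apply: into_nerve_ext => p n x.
  apply: dprod_ext => -[[|[|i]] hi] //.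
    exact: (ordinal_irr (mval (into_nerve1 g p n x)).1 (ltn0Sn 1) hi).
  exact: (ordinal_irr (mval (into_nerve1 g p n x)).1 (ltnSn 1) hi).
move=> h e.
have e0 : bcomp (nerve_map_bhom h 1) (diag X) = into_nerve1 g by apply/E => p n x; rewrite -e.
apply: esshom_ext => -[|[|i]] p n x.
- exact: (congr1 (fun k : bhom (Tcx (X 0)) (nerve_cx Y 1) => (mval (k p n x)).1 ord0) e0).
- exact: (congr1 (fun k : bhom (Tcx (X 0)) (nerve_cx Y 1) => wtop (mval (k p n x)).1) e0).
have -> : h i.+2 = T_transpose (g i.+1) :> bhom (Tcx (X i.+1)) (Y i.+2).
  apply: (universal_inj (@T_unit_universal R i.+1 (X i.+1))); apply: bhom_ext => q m y.
  by rewrite [RHS]T_transposeK -e.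
by [].
Qed.

Definition shift_adjunction : adjunction (Shift R) (Dec R).
Proof.
refine (@adjunction_of_unit (ESpSe R) (ESpSe R) (Dec R) (Shift R) (fun X => shift_unit X) _
  shift_unit_universal) => X Y f.
apply: esshom_ext => -[|i] p n x; last by rewrite /= bfun_gcast.
have e : bcomp (nerve_map_bhom (shift_hom f) 1) (diag X) = bcomp (diag Y) (Tcx_hom (f 0)).
  by apply: into_nerve_ext => q m y; apply: dprod_ext => -[[|[|i]] hi].
have := congr1 (fun k : bhom (Tcx (X 0)) (nerve_cx (shift Y) 1) =>
  k _ _ (T_unit (X 0) p n x)) e.
move=> /= ->; by rewrite bfun_gcast.
Qed.
End ShiftDec.

Section ShiftFull.
Variable R : comPzRingType.

Lemma T_faithful r (A B : bcomplex R r) (f g : bhom A B) : Tcx_hom f = Tcx_hom g -> f = g.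
Proof.
move=> e; apply: bhom_ext => p n.
have [m ->] : exists m, n = 2 * p - m by exists (2 * p - n); lia.
by move=> x; exact: (congr1 (fun h : bhom (Tcx A) (Tcx B) => h m p x) e).
Qed.

Lemma Tcx_T_unit r (A : bcomplex R r) : Tcx_hom (T_unit A) = Tinv_unit (Tcx A).
Proof.
apply: bhom_ext => p n x.
have E := gcast_T (dblK n p) (erefl n) (x : Tcx A p n).
apply: esym; apply: etrans E _; exact: gcast_irr.
Qed.

Lemma T_full r (A B : bcomplex R r) (g : bhom (Tcx A) (Tcx B)) : exists h, Tcx_hom h = g.
Proof.
exists (bcomp (Tinv_transpose g) (T_unit A)).
have -> : Tcx_hom (bcomp (Tinv_transpose g) (T_unit A)) =
  bcomp (Tcx_hom (Tinv_transpose g)) (Tcx_hom (T_unit A)) by exact: bhom_ext.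
by rewrite Tcx_T_unit; apply: bhom_ext => p n x; exact: Tinv_transposeK.
Qed.

(** The identity is universal because Shift is fully faithful: a map between shifts is
    determined by its components on pages i.+1, which are translates, while the
    component on page 0 equals that on page 1 because phi_1 is the identity. *)
Lemma shift_id_universal (Y : ess R) :
  @universal _ _ (Shift R) (shift Y) Y (idm (shift Y : ESpSe R)).
Proof.
move=> Z g.
pose h i : bhom (Y i) (Z i) := sval (cid (T_full (g i.+1 : bhom (Tcx (Y i)) (Tcx (Z i))))).
have hE i : Tcx_hom (h i) = g i.+1 by rewrite /h; case: cid.
have hE' i p n x : h i n (2 * n - p) x = g i.+1 p n x.
  exact: (congr1 (fun k : bhom (Tcx (Y i)) (Tcx (Z i)) => k p n x) (hE i)).
have hphi : forall i p n (x : Y i.+1 p n), ephi Z (h i.+1 p n x) = Hmap (h i) p n (ephi Y x).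
  apply: esshom_of_represents => i p n.
  have [m ->] : exists m, n = 2 * p - m by exists (2 * p - n); lia.
  move=> x; have [a ha] := represents_ex (ephi Y x); exists a => //.
  apply/(shift_representsE (X := Z) (p := m) (n := p)); rewrite !hE'.
  by apply: (esshom_represents (g : esshom (shift Y) (shift Z))); apply/shift_representsE.
exists (EssHom hphi).
  apply: esshom_ext => -[|i] p n x; last exact: hE'.
  apply: etrans (hE' 0%N p n x) _.
  have := esshom_represents (g : esshom (shift Y) (shift Z))
    (Hzero_represents 0 (x : Tcx (Y 0) p n)).
  by move=> /Hzero_representsE.
move=> k e; apply: esshom_ext => i p n x; have -> // : k i = h i.
by apply: T_faithful; rewrite hE -e; exact: bhom_ext.
Qed.

Variable CM : forall t : nat, model_structure (bC R t).
Variable EM : forall t : nat, model_structure (ESpSe R).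
Hypothesis hCM : forall t : nat, has_fib_weq (CM t) (@fib_bC R t) (@weq_bC R t).
Hypothesis hEM : forall t : nat, has_fib_weq (EM t) (@fib_ESpSe R t) (@weq_ESpSe R t).

Lemma shift_unit_quasi_iso (X : ess R) i : quasi_iso (shift_unit_page X i).
Proof.
case: i => [|i]; last exact: T_unit_quasi_iso.
apply: quasi_iso_comp; last exact: T_unit_quasi_iso.
apply/Tinv_quasi_iso/(weqC hCM).
apply: (weq_cancell ((weqC hCM _).2 (rho_quasi_iso (shift X) 1))).
have -> : compm (rho (shift X) 1 : @hom (bC R 1) _ _) (diag X) = idm (Tcx (X 0) : bC R 1).
  exact: bhom_ext.
exact: weq_id.
Qed.

Lemma dec_weq t (X Y : ESpSe R) (f : hom X Y) :
  weq (EM t.+1) f <-> weq (EM t) (fmap (Dec R) f).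
Proof.
rewrite !(weqE hEM); case: t => [|t].
  by rewrite -(nerve_map_quasi_iso hCM); symmetry; exact: Tinv_quasi_iso.
by symmetry; exact: Tinv_quasi_iso.
Qed.

Lemma shift_strong t : strong_quillen_equivalence (EM t) (EM t.+1) (shift_adjunction R).
Proof.
apply: quillen_equivalence_criterion => [X Y f|X Y f|X]; last 1 first.
- exists X, (idm X), (shift X), (shift_unit X).
  split; [exact: weq_id | exact: shift_unit_universal |].
  exact/(weqE hEM)/shift_unit_quasi_iso.
- move=> /(fibE hEM) h; apply/(fibE hEM) => -[|i] hi; last exact/Tinv_surjective/h.
  by apply/Tinv_surjective/nerve_map_surjective => j hj; apply: h; exact: leq_trans hj _.
- exact: dec_weq.
Qed.

Lemma shift_fib t (X Y : ESpSe R) (f : hom X Y) :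
  fib (EM t) f -> fib (EM t.+1) (fmap (Shift R) f).
Proof.
move=> /(fibE hEM) h; apply/(fibE hEM) => -[|i] hi; last exact/T_surjective/h.
exact: (T_surjective (h 0%N isT)).
Qed.

Lemma shift_weq t (X Y : ESpSe R) (f : hom X Y) :
  weq (EM t) f <-> weq (EM t.+1) (fmap (Shift R) f).
Proof. by rewrite !(weqE hEM); symmetry; exact: T_quasi_iso. Qed.

(** The weak equivalence h : Shift Dec X -> X corresponds to the identity of Dec X, and
    it is one because Dec h is a left inverse of the unit at Dec X. *)
Lemma ldec_strong t (LDec : functor (ESpSe R) (ESpSe R)) (a : adjunction LDec (Shift R)) :
  strong_quillen_equivalence (EM t.+1) (EM t) a.
Proof.
apply: quillen_equivalence_criterion => [X Y f|X Y f|X].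
- exact: shift_fib.
- exact: shift_weq.
have [h hu _] := shift_unit_universal (idm (dec X : ESpSe R)).
exists (shift (dec X)), h, (dec X), (idm _); split.
- apply/dec_weq.
  have wu : weq (EM t) (shift_unit (dec X) : @hom (ESpSe R) _ _).
    exact/(weqE hEM)/shift_unit_quasi_iso.
  by apply: (weq_cancelr wu); rewrite hu; exact: weq_id.
- exact: shift_id_universal.
- exact: weq_id.
Qed.
End ShiftFull.

(** * The left adjoint of the shift *)

Section HomologyToCokernel.
Variables (R : comPzRingType) (r : nat) (A : bcomplex R r) (p n : int).

Lemma coker_of_homology_subproof z :
  bnds A p n z -> lincomp (coker_pi A p n) (mval (S := cycles A p n)) z = 0.
Proof. exact: coker_pi_bnd. Qed.

(** The inclusion of cycles modulo boundaries into all elements modulo boundaries. *)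
Definition coker_of_homology : {linear homology A p n -> coker A p n} :=
  qlift coker_of_homology_subproof.

Lemma coker_of_homologyE h a : represents h a -> coker_of_homology h = coker_pi A p n a.
Proof. by move=> [z <- <-]; exact: qliftE. Qed.
End HomologyToCokernel.

Section LDecObject.
Variables (R : comPzRingType) (X : ess R).

Let C := coker (X 0).

Definition phi_coker p n : {linear X 1 p n -> C p n} :=
  lincomp (coker_of_homology (X 0) p n) (ephi X).

Lemma phi_coker_gcast (p n q m : int) (e1 : p = q) (e2 : n = m) x :
  phi_coker q m (gcast (X 1) e1 e2 x) = gcast C e1 e2 (phi_coker p n x).
Proof. by subst; rewrite !gcast_id. Qed.

(** The triple (x, c, c') stands for x + c + d c', where c and c' range over the
    cokernel of the differential of page 0 and d c' is a new, free boundary. *)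
Definition pre_mod p n : lmodType R := (X 1 p n * (C p n * C (p + 1)%R n))%type.

Lemma pre_dp (p p' : int) : p' = p - 1%N%:Z -> p = p' + 1. Proof. lia. Qed.
Lemma pre_dn (n n' : int) : n' = n + 1 - 1%N%:Z -> n = n'. Proof. lia. Qed.

Definition pre_d p n p' n' (ep : p' = p - 1%N%:Z) (en : n' = n + 1 - 1%N%:Z) :
    {linear pre_mod p n -> pre_mod p' n'} :=
  linpair (lincomp (bdiff (X 1) ep en) linfst)
    (linpair (lin0 _ _)
      (lincomp (gcast C (pre_dp ep) (pre_dn en)) (lincomp linfst linsnd))).

Program Definition pre_cx : bcomplex R 1 := @BComplex R 1 pre_mod pre_d _.
Next Obligation.
congr pair; first exact: bdiffK.
by congr pair; exact: linear0.
Qed.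

Lemma pre_up (p : int) : p = p + 1 - 1%N%:Z. Proof. lia. Qed.
Lemma pre_un (n : int) : n = n + 1 - 1%N%:Z. Proof. lia. Qed.

Definition d_into p n : {linear X 1 (p + 1) n -> X 1 p n} := bdiff (X 1) (pre_up p) (pre_un n).

(** The relations phi x = x and d phi y = d y generate the elements
    (x + d y, - phi x, - phi y); here x is expressed through the first coordinate. *)
Definition in_rel p n (u : pre_mod p n) := exists y : X 1 (p + 1) n,
  u.2.2 = - phi_coker (p + 1) n y /\ u.2.1 = - phi_coker p n (u.1 - d_into p n y).

Lemma in_rel0 p n : in_rel (0 : pre_mod p n).
Proof.
exists 0; split; first by rewrite [phi_coker _ _ _]linear0 oppr0.
by rewrite [d_into _ _ _]linear0 [_ - _]subr0 [phi_coker _ _ _]linear0 oppr0.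
Qed.

Lemma in_relZD p n a (u v : pre_mod p n) : in_rel u -> in_rel v -> in_rel (a *: u + v).
Proof.
move: u v => [u1 [u2 u3]] [v1 [v2 v3]] [y [/= -> ->]] [z [/= -> ->]].
exists (a *: y + z); split.
  by rewrite [phi_coker _ _ (_ *: _ + _)]linearP opprD -scalerN.
have e : a *: u1 + v1 - d_into p n (a *: y + z) = a *: (u1 - d_into p n y) + (v1 - d_into p n z).
  by rewrite [d_into _ _ _]linearP opprD scalerBr addrACA.
apply: etrans (congr1 (fun x => - phi_coker p n x) (esym e)).
by rewrite [phi_coker p n (_ *: _ + _)]linearP opprD -scalerN.
Qed.

Definition rel p n : submodule (pre_mod p n) := Submodule (@in_rel0 p n) (@in_relZD p n).

Lemma rel_d (p n p' n' : int) (ep : p' = p - 1%N%:Z) (en : n' = n + 1 - 1%N%:Z) u :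
  rel p n u -> rel p' n' (bdiff pre_cx ep en u).
Proof.
move=> [y [e1 e2]].
(* The generator (x + d y, - phi x, - phi y) has differential (d x, 0, - phi x), the
   generator attached to 0 and x. *)
exists (gcast (X 1) (pre_dp ep) (pre_dn en) (u.1 - d_into p n y)).
have E : d_into p' n' (gcast (X 1) (pre_dp ep) (pre_dn en) (u.1 - d_into p n y)) =
    bdiff (X 1) ep en u.1.
  rewrite [LHS](bdiff_gcast _ _ erefl erefl ep en) gcast_id linearB bdiffK; exact: subr0.
split; last by rewrite E subrr linear0 oppr0.
rewrite phi_coker_gcast -linearN; apply: (congr1 (gcast C _ _)); exact: e2.
Qed.

(** The pushout of X_1 and the free complex on C along the free complex on X_1. A map
    X -> Shift Y is given on page 0 by a map C -> T Y_0 and on page 1 by a map of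
    complexes X_1 -> T Y_0, and the condition on phi_1 says that they agree along
    phi; together they are a map out of this pushout. *)
Definition glued_cx : bcomplex R 1 := @quot_cx R 1 pre_cx rel rel_d.

Definition glued_pi : bhom pre_cx glued_cx := @quot_pi R 1 pre_cx rel rel_d.

Lemma glued_pi_surj p n q : exists u, glued_pi p n u = q.
Proof. exact: qpi_surj. Qed.

Program Definition pre_inl : bhom (X 1) pre_cx :=
  @BHom R 1 (X 1) pre_cx (fun p n => linpair (linid _) (lin0 _ _)) _.
Next Obligation. by congr pair; congr pair; symmetry; exact: linear0. Qed.

Definition page1_in : bhom (X 1) glued_cx := bcomp glued_pi pre_inl.

Definition pre_inr p n : {linear C p n -> pre_mod p n} :=
  linpair (lin0 _ _) (linpair (linid _) (lin0 _ _)).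

Definition coker_in p n : {linear C p n -> glued_cx p n} :=
  lincomp (glued_pi p n) (pre_inr p n).

Lemma glued_rel p n x : page1_in p n x = coker_in p n (phi_coker p n x).
Proof.
apply: (qpi_eq (rel p n) (pre_inl p n x) (pre_inr p n (phi_coker p n x))).2.
exists 0; split; first by rewrite [phi_coker (p + 1) n 0]linear0 oppr0; exact: subr0.
have e : x - 0 - d_into p n 0 = x by rewrite [d_into p n 0]linear0 !subr0.
apply: etrans (sub0r _) _; exact: (congr1 (fun z => - phi_coker p n z) (esym e)).
Qed.

Lemma glued_bhom_ext (B : bcomplex R 1) (f f' : bhom glued_cx B) :
  (forall p n x, f p n (page1_in p n x) = f' p n (page1_in p n x)) ->
  (forall p n c, f p n (coker_in p n c) = f' p n (coker_in p n c)) -> f = f'.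
Proof.
move=> e1 e2; apply: bhom_ext => p n q; have [[x [c c']] <-] := glued_pi_surj q.
have -> : (x, (c, c')) = pre_inl p n x +
    (pre_inr p n c + bdiff pre_cx (pre_up p) (pre_un n) (pre_inr (p + 1) n c')).
  have e : gcast C (pre_dp (pre_up p)) (pre_dn (pre_un n)) c' = c' by exact: gcast_id.
  congr pair; last congr pair.
  - apply: esym; apply: etrans (congr1 (fun z => x + (0 + z)) (linear0 _)) _.
    by rewrite !addr0.
  - exact: esym (etrans (add0r _) (addr0 _)).
  exact: esym (etrans (add0r _) (etrans (add0r _) e)).
rewrite !linearD !(bfun_d glued_pi) !bfun_d [f _ _ _]e1 [f _ _ _]e2 [X in bdiff _ _ _ X]e2.
by [].
Qed.

Definition ldec_page i : bcomplex R i :=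
  if i is j.+1 then Tinvcx (X j.+2) else Tinvcx glued_cx.

Definition ldec_phi i (p n : int) : {linear ldec_page i.+1 p n -> homology (ldec_page i) p n} :=
  if i is j.+1 then lincomp (HTinv (X j.+2) p n) (ephi X)
  else lincomp (HTinv glued_cx p n) (lincomp (Hmap page1_in _ _) (ephi X)).

Definition ldec : ess R := Ess ldec_phi.

Program Definition ldec_unit_bottom : bhom (X 0) (zero_cx 0 (Tcx (Tinvcx glued_cx))) :=
  @BHom R 0 (X 0) (zero_cx 0 (Tcx (Tinvcx glued_cx)))
    (fun p n => lincomp (Tinv_unit glued_cx p n)
                  (lincomp (coker_in p n) (coker_pi (X 0) p n))) _.
Next Obligation.
apply: etrans (congr1 _ (congr1 (coker_in p' n') (coker_pi_bnd _))) _.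
  by exists p, n, ep, en, x.
by apply: etrans (congr1 _ (linear0 _)) (linear0 _).
Qed.

Definition ldec_unit_page i : bhom (X i) (shift ldec i) :=
  match i with
  | 0 => ldec_unit_bottom
  | 1 => bcomp (Tinv_unit glued_cx) page1_in
  | j.+2 => Tinv_unit (X j.+2)
  end.

Lemma ldec0_represents p n (x : X 2 (2 * p - n) p) a :
  represents (ephi X x) a ->
  represents (ephi ldec (x : ldec 1 p n)) (page1_in _ _ a : ldec 0 p n).
Proof. by move=> h; apply/HTinv_representsE/Hmap_represents. Qed.

Program Definition ldec_unit : esshom X (shift ldec) := @EssHom R X (shift ldec) ldec_unit_page _.
Next Obligation.
apply: esshom_of_represents => {i p n x} i p n x.
have [a ha] := represents_ex (ephi X x); exists a => //.
case: i x a ha => [|[|i]] x a ha.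
- apply/Hzero_representsE; apply: (congr1 (Tinv_unit glued_cx p n)).
  rewrite glued_rel /phi_coker; apply: (congr1 (coker_in p n)).
  by rewrite [RHS](coker_of_homologyE ha).
- apply/(shift_representsE (X := ldec)).
  have := represents_gcast (phi := @ephi R X 1) (dblK n p) erefl ha.
  by move/ldec0_represents; rewrite bfun_gcast.
apply/(shift_representsE (X := ldec))/HTinv_representsE.
exact: (represents_gcast (phi := @ephi R X i.+2) (dblK n p) erefl ha).
Qed.
End LDecObject.

Section LDecUniversal.
Variables (R : comPzRingType) (X Y : ess R) (g : esshom X (shift Y)).

Let g0 : bhom (X 0) (zero_cx 0 (Tcx (Y 0))) := g 0.
Let g1 : bhom (X 1) (Tcx (Y 0)) := g 1.

Lemma g0_bnd p n x : bnd_sub (X 0) p n x -> g0 p n x = 0.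
Proof. by move=> [p0 [n0 [ep [en [y <-]]]]]; rewrite bfun_d. Qed.

Definition g0_coker p n : {linear coker (X 0) p n -> Tcx (Y 0) p n} := qlift (@g0_bnd p n).

Lemma g0_cokerE p n x : g0_coker p n (coker_pi (X 0) p n x) = g0 p n x.
Proof. exact: qliftE. Qed.

Lemma g0_coker_gcast (p n q m : int) (e1 : p = q) (e2 : n = m) c :
  g0_coker q m (gcast (coker (X 0)) e1 e2 c) = gcast (Tcx (Y 0)) e1 e2 (g0_coker p n c).
Proof. by subst; rewrite !gcast_id. Qed.

(** The characteristic map of page 1 of a shift is the identity. *)
Lemma g0_phi p n x : g0_coker p n (phi_coker X p n x) = g1 p n x.
Proof.
have [a ha] := represents_ex (ephi X x).
apply: etrans (congr1 (g0_coker p n) (coker_of_homologyE ha)) _.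
rewrite g0_cokerE; have := esshom_represents g ha.
by move=> /Hzero_representsE.
Qed.

Definition pre_ext_fun p n : {linear pre_mod X p n -> Tcx (Y 0) p n} :=
  linadd (lincomp (g1 p n) linfst)
    (linadd (lincomp (g0_coker p n) (lincomp linfst linsnd))
      (lincomp (bdiff (Tcx (Y 0)) (pre_up p) (pre_un n))
        (lincomp (g0_coker (p + 1) n) (lincomp linsnd linsnd)))).

Lemma pre_ext_funE p n x c c' : pre_ext_fun p n (x, (c, c')) =
  g1 p n x + (g0_coker p n c + bdiff (Tcx (Y 0)) (pre_up p) (pre_un n) (g0_coker (p + 1) n c')).
Proof. by []. Qed.

Program Definition pre_ext : bhom (pre_cx X) (Tcx (Y 0)) :=
  @BHom R 1 (pre_cx X) (Tcx (Y 0)) pre_ext_fun _.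
Next Obligation.
case: x => x [c c']; apply: etrans (pre_ext_funE _ _ _) _.
rewrite pre_ext_funE !linearD bdiffK addr0 linear0 add0r bfun_d; congr (_ + _).
rewrite g0_coker_gcast (bdiff_gcast (A := Tcx (Y 0)) _ _ erefl erefl ep en) gcast_id.
by [].
Qed.

Lemma pre_ext_rel p n u : rel X p n u -> pre_ext p n u = 0.
Proof.
case: u => x [c c'] [y [/= -> ->]]; apply: etrans (pre_ext_funE _ _ _) _.
rewrite !linearN !g0_phi linearB /d_into bfun_d.
by rewrite -opprD subrK subrr.
Qed.

Definition glued_ext : bhom (glued_cx X) (Tcx (Y 0)) := 
  @quot_lift R 1 (pre_cx X) (Tcx (Y 0)) (rel X) (@rel_d R X) pre_ext pre_ext_rel.

Lemma glued_extE p n u : glued_ext p n (glued_pi X p n u) = pre_ext_fun p n u.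
Proof. exact: quot_liftE. Qed.

Lemma glued_ext_page1 p n x : glued_ext p n (page1_in X p n x) = g1 p n x.
Proof.
apply: etrans (glued_extE (pre_inl X p n x)) _; apply: etrans (pre_ext_funE _ _ _) _.
by rewrite ![g0_coker _ _ _]linear0 linear0 !addr0.
Qed.

Lemma glued_ext_coker p n x : glued_ext p n (coker_in X p n (coker_pi _ _ _ x)) = g0 p n x.
Proof.
apply: etrans (glued_extE (pre_inr X p n (coker_pi _ _ _ x))) _.
apply: etrans (pre_ext_funE _ _ _) _.
by rewrite [g1 _ _ _]linear0 add0r g0_cokerE [g0_coker _ _ _]linear0 linear0 addr0.
Qed.

Definition ldec_ext_page i : bhom (ldec X i) (Y i) :=
  if i is j.+1 then Tinv_transpose (g j.+2 : bhom (X j.+2) (Tcx (Y j.+1)))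
  else Tinv_transpose glued_ext.

Program Definition ldec_ext : esshom (ldec X) Y := @EssHom R (ldec X) Y ldec_ext_page _.
Next Obligation.
apply: (esshom_of_represents (X := ldec X)) => {i p n x} i p n x.
case: i x => [|i] x; have [a ha] := represents_ex (ephi X (x : X _ (2 * p - n) p)).
  exists (page1_in X _ _ a : ldec X 0 p n); first exact: ldec0_represents.
  have /(shift_representsE (X := Y)) h := esshom_represents g ha.
  have := represents_gcast (phi := @ephi R Y 0) erefl (esym (dblK p n)) h.
  by rewrite -[g 1%N _ _ a]glued_ext_page1.
exists (a : ldec X i.+1 p n); first exact/HTinv_representsE.
have /(shift_representsE (X := Y)) h := esshom_represents g ha.
exact: (represents_gcast (phi := @ephi R Y i.+1) erefl (esym (dblK p n)) h).
Qed.

Lemma ldec_ext_unit : esscomp (shift_hom ldec_ext) (ldec_unit X) = g.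
Proof.
apply: esshom_ext => -[|[|i]] p n x.
- by apply: etrans (Tinv_transposeK glued_ext _) _; exact: glued_ext_coker.
- by apply: etrans (Tinv_transposeK glued_ext _) _; exact: glued_ext_page1.
exact: Tinv_transposeK.
Qed.

Lemma ldec_ext_unique h : esscomp (shift_hom h) (ldec_unit X) = g -> h = ldec_ext.
Proof.
move=> e; apply: esshom_ext => i; suff -> : h i = ldec_ext_page i by [].
case: i => [|i].
  apply: (universal_inj (@Tinv_unit_universal R 0 (glued_cx X))).
  apply: glued_bhom_ext => p n x; rewrite [RHS]Tinv_transposeK.
    by rewrite glued_ext_page1 /g1 -e.
  have [a <-] := coker_pi_surj x.
  by rewrite glued_ext_coker /g0 -e.
apply: (universal_inj (@Tinv_unit_universal R i.+1 (X i.+2))); apply: bhom_ext => p n x.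
by rewrite [RHS]Tinv_transposeK -e.
Qed.
End LDecUniversal.

Lemma shift_left_adjoint (R : comPzRingType) :
  exists LDec : functor (ESpSe R) (ESpSe R), inhabited (adjunction LDec (Shift R)).
Proof.
apply: left_adjoint_of_universal => X; exists (ldec X), (ldec_unit X) => Y g.
by exists (ldec_ext g); [exact: ldec_ext_unit | exact: ldec_ext_unique].
Qed.

(** * The equivalences *)

Local Close Scope ring_scope.
Unset Implicit Arguments.

Theorem corollary7p2p4 (R : comPzRingType) (r : nat)
  (CM : forall t : nat, model_structure (bC R t))
  (LM : forall t : nat, model_structure (LWB R))
  (EM : forall t : nat, model_structure (ESpSe R))
  (hCM : forall t : nat, has_fib_weq (CM t) (@fib_bC R t) (@weq_bC R t))
  (hLM : forall t : nat, has_fib_weq (LM t) (@fib_LWB R t) (@weq_LWB R t))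
  (hEM : forall t : nat, has_fib_weq (EM t) (@fib_ESpSe R t) (@weq_ESpSe R t)) :
  (* LDec and the functors F_[t] exist *)
  ((exists LDec : functor (ESpSe R) (ESpSe R), inhabited (adjunction LDec (Shift R))) /\
   (forall t : nat, exists Ft : functor (bC R t) (LWB R),
      inhabited (adjunction Ft (Upage R t)))) /\
  forall (LDec : functor (ESpSe R) (ESpSe R)) (_ : adjunction LDec (Shift R))
    (Fpage : forall t : nat, functor (bC R t) (LWB R))
    (_ : forall t : nat, adjunction (Fpage t) (Upage R t)),
  [/\
    (* (a) *)
    quillen_equivalence (EM 0) (EM r) (iterF (Shift R) r) (iterF (Dec R) r) /\
    quillen_equivalence (EM r) (EM 0) (iterF LDec r) (iterF (Shift R) r),
    (* (b) *)
    quillen_equivalence (EM r) (EM r.+1) (Shift R) (Dec R) /\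
    quillen_equivalence (EM r.+1) (EM r) LDec (Shift R),
    (* (c) *)
    quillen_equivalence (LM 0) (LM r)
      (iterF (compF (Ftr R) (TL R 0)) r) (iterF (compF (TLinv R 0) (Utr R)) r) /\
    quillen_equivalence (LM r) (LM r.+1)
      (compF (Ftr R) (TL R 0)) (compF (TLinv R 0) (Utr R)),
    (* (d), in both directions *)
    [/\ quillen_equivalence (CM 0) (CM r) (Titer R r) (Tinviter R r),
        quillen_equivalence (CM r) (CM 0) (Tinviter R r) (Titer R r),
        quillen_equivalence (CM r) (CM r.+1) (T R r) (Tinv R r) &
        quillen_equivalence (CM r.+1) (CM r) (Tinv R r) (T R r)] &
    (* (e) *)
    forall t : nat, t \in [:: 0; r; r.+1] ->
      quillen_equivalence (LM t) (EM t) (Q R) (Nerve R) /\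
      quillen_equivalence (CM t) (LM t) (Fpage t) (Upage R t)].
Proof.
split; first by split; [exact: shift_left_adjoint | exact: Upage_left_adjoint].
move=> LDec aLDec Fpage aFpage; split.
- split; first exact: (quillen_equivalence_iter_up r (shift_strong hCM hEM)).
  exact: (quillen_equivalence_iter_down r (fun t => ldec_strong hCM hEM t aLDec)).
- split; first exact: quillen_equivalence_of_strong (shift_strong hCM hEM r).
  exact: quillen_equivalence_of_strong (ldec_strong hCM hEM r aLDec).
- split; first exact: (quillen_equivalence_iter_up r (prolong_strong hLM)).
  exact: quillen_equivalence_of_strong (prolong_strong hLM r).
- split.
  + exact: Titer_quillen_equivalence.
  + exact: Tinviter_quillen_equivalence.
  + exact: quillen_equivalence_of_strong (T_strong hCM r).
  + exact: quillen_equivalence_of_strong (Tinv_strong hCM r).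
move=> t _; split; first exact: quillen_equivalence_of_strong (Q_strong hCM hLM hEM t).
exact: quillen_equivalence_of_strong (Upage_strong hCM hLM (aFpage t)).
Qed.
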